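(* Let $1 \le p < \infty$, let $\nu$ be a positive continuous radial function on $\mathbb{D}$, and let $\varphi, \psi$ be analytic self-maps of $\mathbb{D}$. Then $C_{\varphi} - C_{\psi}$ is a compact operator from $B^{p}$ into $\mathcal{B}_{\nu,0}$ if and only if $\varphi$ and $\psi$ satisfy both of the following conditions: (a) $\displaystyle \lim_{|z| \to 1^{-}} \max\left\{\frac{|\varphi'(z)|}{1-|\varphi(z)|^{2}}, \frac{|\psi'(z)|}{1-|\psi(z)|^{2}}\right\} \nu(z)\rho(\varphi(z), \psi(z)) = 0$; (b) $\displaystyle \lim_{|z| \to 1^{-}} \left| \frac{\nu(z)\varphi'(z)}{1-|\varphi(z)|^{2}} - \frac{\nu(z)\psi'(z)}{1-|\psi(z)|^{2}} \right| = 0$.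
   Context: $\mathbb{D}$ is the open unit disk, $dA$ normalized area measure on $\mathbb{D}$, $H(\mathbb{D})$ the analytic functions on $\mathbb{D}$. For $1<p<\infty$, the analytic Besov space $B^{p}$ is the set of $f \in H(\mathbb{D})$ with $\int_{\mathbb{D}}|f'(z)|^{p}(1-|z|^{2})^{p-2}dA(z)<\infty$, normed by $\|f\|_p = |f(0)| + \left(\int_{\mathbb{D}}|f'(z)|^{p}(1-|z|^{2})^{p-2}dA(z)\right)^{1/p}$. The space $B^{1}$ is the set of $f \in H(\mathbb{D})$ with $\int_{\mathbb{D}}|f''(z)|\,dA(z)<\infty$; each such $f$ can be written $f = c_0 + \sum_{j\ge1} c_j \alpha_{w_j}$ with $\{c_j\}\in \ell^1$, $\{w_j\}\subset\mathbb{D}$, where $\alpha_w(z) = (w-z)/(1-\overline{w}z)$, and $\|f\|_1 = \inf \sum_{j\ge 0}|c_j|$ over all such representations (this norm is comparable to $|f(0)|+|f'(0)|+\int_{\mathbb{D}}|f''|\,dA$). For a positive continuous radial function $\nu$ on $\mathbb{D}$ (radial: $\nu(z)=\nu(|z|)$), the Bloch type space $\mathcal{B}_{\nu}$ consists of $f\in H(\mathbb{D})$ with $\sup_{z\in\mathbb{D}}\nu(z)|f'(z)|<\infty$ (normed by $|f(0)|+\sup_{z}\nu(z)|f'(z)|$), and $\mathcal{B}_{\nu,0}$ is the closed subspace of $f\in\mathcal{B}_\nu$ with $\nu(z)|f'(z)|\to 0$ as $|z|\to1^-$. For an analytic self-map $\varphi$ of $\mathbb{D}$, $C_\varphi f =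 f\circ\varphi$. $\rho(z,w) = \left|\frac{z-w}{1-\overline{w}z}\right|$ is the pseudo-hyperbolic distance on $\mathbb{D}$. *)

(* Defs.v *)
From HB Require Import structures.
From mathcomp Require Import all_boot all_order all_algebra.
From mathcomp Require Import all_classical all_reals all_analysis.
From mathcomp Require Import complex.
Import Order.TTheory GRing.Theory Num.Theory.
Import numFieldNormedType.Exports.
Local Open Scope ring_scope.
Local Open Scope classical_set_scope.

Set Implicit Arguments.
Unset Strict Implicit.
Unset Printing Implicit Defensive.

Section BesovBloch.
Variable R : realType.

Definition cabs (z : R[i]) : R := ComplexField.Normc.normc z.

Definition disk : set R[i] := [set z | cabs z < 1].

Definition cderiv (f : R[i] -> R[i]) : R[i] -> R[i] :=
  fun z => (f : R[i]^o -> R[i]^o)^`() z.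

Definition holo (f : R[i] -> R[i]) : Prop :=
  forall z, disk z -> derivable (f : R[i]^o -> R[i]^o) z 1.

Definition selfmap (phi : R[i] -> R[i]) : Prop :=
  holo phi /\ forall z, disk z -> disk (phi z).

Definition area_int (F : R[i] -> \bar R) : \bar R :=
  ((pi^-1)%:E *
   \int[(@lebesgue_measure R) \x (@lebesgue_measure R)]_(xy in
        [set xy : R * R | (xy.1 ^+ 2 + xy.2 ^+ 2 < 1)%R]) F (Complex xy.1 xy.2))%E.

Definition moebius (w z : R[i]) : R[i] := (w - z) / (1 - Num.conj w * z).

Definition rho (z w : R[i]) : R := cabs ((z - w) / (1 - Num.conj w * z)).

Definition besov_int (p : R) (f : R[i] -> R[i]) : \bar R :=
  area_int (fun z => (powR (cabs (cderiv f z)) p * powR (1 - cabs z ^+ 2) (p - 2))%:E).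

Definition besov1_int (f : R[i] -> R[i]) : \bar R :=
  area_int (fun z => (cabs (cderiv (cderiv f) z))%:E).

Definition besov (p : R) (f : R[i] -> R[i]) : Prop :=
  holo f /\ (if p == 1 then (besov1_int f < +oo)%E else (besov_int p f < +oo)%E).

Definition B1_repr (f : R[i] -> R[i]) (c : nat -> R[i]) : Prop :=
  exists w : nat -> R[i],
    (forall j, disk (w j)) /\
    (\sum_(0 <= j <oo) (cabs (c j))%:E < +oo)%E /\
    forall z, disk z ->
      ((fun n => \sum_(1 <= j < n) c j * moebius (w j) z) : nat -> R[i]^o)
        @ \oo --> ((f z - c 0%N) : R[i]^o).

Definition besov1_norm (f : R[i] -> R[i]) : \bar R :=
  ereal_inf [set (\sum_(0 <= j <oo) (cabs (c j))%:E)%E | c in B1_repr f].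

Definition besov_norm (p : R) (f : R[i] -> R[i]) : \bar R :=
  if p == 1 then besov1_norm f
  else (cabs (f 0) + powR (fine (besov_int p f)) p^-1)%:E.

Definition bloch_sup (nu : R[i] -> R) (f : R[i] -> R[i]) : \bar R :=
  ereal_sup [set (nu z * cabs (cderiv f z))%:E | z in disk].

Definition bloch_norm (nu : R[i] -> R) (f : R[i] -> R[i]) : \bar R :=
  ((cabs (f 0))%:E + bloch_sup nu f)%E.

Definition bloch (nu : R[i] -> R) (f : R[i] -> R[i]) : Prop :=
  holo f /\ (bloch_sup nu f < +oo)%E.

Definition lim_bdry0 (F : R[i] -> R) : Prop :=
  forall e : R, 0 < e -> exists r : R, r < 1 /\
    forall z, r < cabs z -> cabs z < 1 -> `|F z| < e.

Definition little_bloch (nu : R[i] -> R) (f : R[i] -> R[i]) : Prop :=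
  bloch nu f /\ lim_bdry0 (fun z => nu z * cabs (cderiv f z)).

Definition comp_diff (phi psi : R[i] -> R[i]) (f : R[i] -> R[i]) : R[i] -> R[i] :=
  fun z => f (phi z) - f (psi z).

(* T is a compact operator from B^p into B_{nu,0}: T maps B^p into B_{nu,0}
   and the image of the closed unit ball of B^p is relatively compact in
   B_{nu,0}, i.e. every sequence in it has a subsequence converging in the
   B_nu norm to an element of B_{nu,0}. *)
Definition compact_Bp_Bnu0 (p : R) (nu : R[i] -> R)
    (T : (R[i] -> R[i]) -> (R[i] -> R[i])) : Prop :=
  (forall f, besov p f -> little_bloch nu (T f)) /\
  forall u : nat -> (R[i] -> R[i]),
    (forall n, besov p (u n) /\ (besov_norm p (u n) <= 1)%E) ->
    exists (s : nat -> nat) (g : R[i] -> R[i]),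
      (forall m n, (m < n)%N -> (s m < s n)%N) /\
      little_bloch nu g /\
      (fun n => bloch_norm nu (fun z => T (u (s n)) z - g z)) @ \oo --> 0%E.

End BesovBloch.

(* Main.v *)
(** If the conditions hold: a function [f] in the unit ball of [B^p] satisfies
    [|f'(z)| (1 - |z|^2) <= C] with [C] uniform (bound [f'] at a point by its
    area mean over a square), hence [(1 - |z|^2) f'(z)] is Lipschitz for [rho],
    and [nu |(f o phi - f o psi)'|] is at most a constant times the sum of the
    quantities in (a) and (b).  So it vanishes at the boundary uniformly in [f],
    and Montel's theorem gives a subsequence converging in the Bloch norm.

    Conversely, the automorphisms [alpha_w] have bounded [B^p] norm, so that
    compactness makes [nu |(alpha_w o phi - alpha_w o psi)'|] vanish at the
    boundary uniformly in [w].  At a point [z] this is used for [w = phi z] and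
    for a second point [w] at pseudo-hyperbolic distance at most [1/2] from
    [phi z]; comparing the two bounds separates the terms of [phi] and [psi] and
    yields (a), then (b). *)

Require Import Defs.
From HB Require Import structures.
From mathcomp Require Import all_boot all_order all_algebra.
From mathcomp Require Import all_classical all_reals all_analysis.
From mathcomp Require Import measurable_realfun complex ring lra.
Import Order.TTheory GRing.Theory Num.Theory.
Import numFieldNormedType.Exports.
Local Open Scope ring_scope.
Local Open Scope classical_set_scope.
Set Implicit Arguments.
Unset Strict Implicit.
Unset Printing Implicit Defensive.


(** Area is a product measure, so the work is Cartesian: Cauchy's formula is proved on rectangles,
    whose sides are sections that Tonelli's theorem controls, and Besov integrals are computed along
    chords. The delicate uniform bound is that of the Besov integrals of [moebius w] for p > 1. As p
    - 2 may be negative, the weight can blow up at the circle, near which the mass concentrates as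
    |w| tends to 1; the majorant is arranged to have explicit primitives, and its powers of 1 - |w|
    cancel. For p = 1 the norm is an infimum over atomic sums, not an integral. In the unit ball,
    atoms of modulus at most 1 bound f itself and Cauchy estimates bound f'; an arbitrary member of
    B^1 is known only through f'', whose bound is integrated along a radius. In the converse, one
    test gives only a difference of two terms. With a = phi z and b = psi z, the function alpha_w
    for w = alpha_a(u) is alpha_u o alpha_a up to a unimodular constant: passing from u = 0 to a
    suitable u multiplies the kernel at b by a real factor at least 1 + rho(a, b) and leaves the one
    at a alone, up to a common 1 - |u|^2. *)

Lemma eqW d (T : porderType d) (x y : T) : x = y -> (x <= y)%O.
Proof. by move->. Qed.

(** * Complex derivatives *)

Section Modulus.
Variable R : realType.
Implicit Types z w : R[i].

Lemma cabs_sq z : cabs z ^+ 2 = complex.Re z ^+ 2 + complex.Im z ^+ 2.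
Proof.
by case: z => a b; rewrite /cabs /= sqr_sqrtr ?addr_ge0 ?sqr_ge0.
Qed.

Lemma cabs_ge0 z : 0 <= cabs z.
Proof. by case: z => a b; rewrite /cabs /= sqrtr_ge0. Qed.

Lemma cabsM z w : cabs (z * w) = cabs z * cabs w.
Proof. exact: ComplexField.Normc.normcM. Qed.

Lemma cabsV z : cabs z^-1 = (cabs z)^-1.
Proof. exact: ComplexField.Normc.normcV. Qed.

Lemma cabsN z : cabs (- z) = cabs z.
Proof. exact: normcN. Qed.

Lemma cabsB z w : cabs (z - w) = cabs (w - z).
Proof. by rewrite -cabsN opprB. Qed.

Lemma cabs0 : cabs (0 : R[i]) = 0.
Proof. exact: ComplexField.Normc.normc0. Qed.

Lemma cabs1 : cabs (1 : R[i]) = 1.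
Proof. exact: ComplexField.Normc.normc1. Qed.

Lemma cabs_eq0 z : (cabs z == 0) = (z == 0).
Proof.
apply/eqP/eqP => [|->]; last exact: cabs0.
exact: ComplexField.Normc.eq0_normc.
Qed.

Lemma cabs_gt0 z : (0 < cabs z) = (z != 0).
Proof. by rewrite lt_neqAle cabs_ge0 andbT eq_sym cabs_eq0. Qed.

Lemma cabsX z n : cabs (z ^+ n) = cabs z ^+ n.
Proof. by elim: n => [|n IH]; rewrite ?expr0 ?cabs1// !exprS cabsM IH. Qed.

Lemma cabs_real (x : R) : cabs x%:C%C = `|x|.
Proof. by rewrite /cabs /= expr0n /= addr0 sqrtr_sqr. Qed.

Lemma cabsD z w : cabs (z + w) <= cabs z + cabs w.
Proof. exact: le_normcD. Qed.

Lemma cabs_subD z w u : cabs (z - u) <= cabs (z - w) + cabs (w - u).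
Proof. by rewrite -[z - u](subrKA w) cabsD. Qed.

Lemma cabsDl z w : cabs z - cabs w <= cabs (z + w).
Proof.
by rewrite lerBlDr -{1}[z](addrK w) -[cabs w]cabsN cabsD.
Qed.

Lemma cabs_Re z : `|complex.Re z| <= cabs z.
Proof.
rewrite -(@ler_pXn2r _ 2) ?nnegrE ?cabs_ge0// cabs_sq.
by rewrite real_normK ?num_real// lerDl sqr_ge0.
Qed.

Lemma cabs_Im z : `|complex.Im z| <= cabs z.
Proof.
rewrite -(@ler_pXn2r _ 2) ?nnegrE ?cabs_ge0// cabs_sq.
by rewrite real_normK ?num_real// lerDr sqr_ge0.
Qed.

Lemma cabs_le_ReIm z : cabs z <= `|complex.Re z| + `|complex.Im z|.
Proof.
rewrite -(@ler_pXn2r _ 2) ?nnegrE ?cabs_ge0 ?addr_ge0// cabs_sq.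
rewrite sqrrD !real_normK ?num_real// -addrA (addrC (_ *+ 2)) addrA lerDl.
by rewrite mulrn_wge0 ?mulr_ge0.
Qed.

Lemma conjcE z : Num.conj z = conjc z.
Proof.
have : z * Num.conj z = z * conjc z.
  rewrite -normCK; case: z => a b; rewrite normc_def -rmorphXn /= sqr_sqrtr ?addr_ge0 ?sqr_ge0//.
have [->|z0] := eqVneq z 0; first by rewrite !rmorph0.
exact: mulfI.
Qed.

Lemma cabs_conj z : cabs (Num.conj z) = cabs z.
Proof. by rewrite conjcE; case: z => a b; rewrite /cabs /= sqrrN. Qed.

Lemma mul_conj z : z * Num.conj z = (cabs z ^+ 2)%:C%C.
Proof.
by rewrite conjcE cabs_sq; case: z => a b; simpc; apply/eqP; rewrite eq_complex /=; apply/andP; split; apply/eqP; ring.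
Qed.

Lemma conjK z : Num.conj (Num.conj z) = z.
Proof. by rewrite !conjcE conjcK. Qed.

Lemma cabs_sum (I : Type) (s : seq I) (P : pred I) (F : I -> R[i]) :
  cabs (\sum_(i <- s | P i) F i) <= \sum_(i <- s | P i) cabs (F i).
Proof.
elim/big_ind2: _ => //; first by rewrite cabs0.
move=> x1 x2 y1 y2 h1 h2; apply: le_trans (cabsD _ _) _; exact: lerD.
Qed.

Lemma normc_cabs z : `|z| = (cabs z)%:C%C.
Proof. by rewrite normc_def; case: z. Qed.

(** The norm of [R[i]] takes values in [R[i]], so a ball has a complex radius; being positive, that
    radius is real and its real part serves. This is what permits real epsilons below. *)
Lemma nbhs_cabs (z : R[i]) (A : set R[i]) :
  nbhs (z : R[i]^o) A <-> exists2 d : R, 0 < d & forall w, cabs (w - z) < d -> A w.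
Proof.
split.
  move=> /nbhs_normP[e /= e0 eA]; have er : e = (complex.Re e)%:C%C.
    by rewrite RRe_real// ger0_real// ltW.
  exists (complex.Re e); first by rewrite -ltcR -er.
  by move=> w wz; apply: eA; rewrite /ball_ /= normc_cabs er ltcR cabsB.
case=> d d0 dA; apply/(@nbhs_normP R[i] R[i]^o); exists d%:C%C; first by rewrite /= ltcR.
by move=> w; rewrite /ball_ /= normc_cabs ltcR cabsB; exact: dA.
Qed.

Lemma cvg_cabs (T : Type) (F : set_system T) {FF : Filter F} (f : T -> R[i]) (l : R[i]) :
  (f : T -> R[i]^o) @ F --> (l : R[i]^o) <->
  forall e : R, 0 < e -> \forall x \near F, cabs (f x - l) < e.
Proof.
split.
  move=> fl e e0; apply: (fl [set w | cabs (w - l) < e]).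
  by apply/nbhs_cabs; exists e.
move=> H A /nbhs_cabs[d d0 dA]; apply: filterS (H _ d0) => x; exact: dA.
Qed.

End Modulus.

(* Locked so that unification does not unfold the derivative. *)
HB.lock Definition cD (R : realType) (f : R[i] -> R[i]) (z : R[i]) : R[i] := cderiv f z.

Section Derivative.
Variable R : realType.
Implicit Types (f g : R[i] -> R[i]) (z w h l : R[i]).

(** The derivative without quotients and with real radii: [h = 0] is allowed, and the remainders of
    products, composites and Cauchy integrals can be bounded directly. *)
Definition hasD f z l := forall e : R, 0 < e -> exists2 d : R, 0 < d &
  forall h, cabs h < d -> cabs (f (z + h) - f z - h * l) <= e * cabs h.

Lemma hasD_deriv f z l : hasD f z l ->
  derivable (f : R[i]^o -> R[i]^o) z 1 /\ cderiv f z = l.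
Proof.
move=> fl.
have H : (fun h : R[i]^o => h^-1 *: (((f : R[i]^o -> R[i]^o) \o shift z) (h *: (1 : R[i]^o)) - f z))
   @ (0 : R[i]^o)^' --> (l : R[i]^o).
  apply/cvg_cabs => e e0; have [d d0 fd] := fl (e / 2) (divr_gt0 e0 (ltr0Sn _ 1)).
  rewrite near_withinE; apply/(nbhs_cabs (0 : R[i])).
  exists d => // h; rewrite subr0 => hd h0.
  have := fd _ hd; rewrite /= /shift /= addrC.
  have -> : h *: (1 : R[i]^o) = h :> R[i] by rewrite /GRing.scale /= mulr1.
  move=> hh; have h0' : 0 < cabs h by rewrite cabs_gt0.
  have -> : h^-1 *: (f (h + z) - f z : R[i]^o) - l =
    h^-1 * (- f z - h * l + f (h + z)) :> R[i].
    by rewrite /GRing.scale /= ; field.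
  rewrite cabsM cabsV mulrC ltr_pdivrMr//; apply: le_lt_trans (_ : e / 2 * cabs h < _).
    apply: le_trans hh; apply: eqW; congr cabs.
    by rewrite (addrC h); ring.
  by rewrite ltr_pM2r// ltr_pdivrMr// mulr_natr mulr2n ltrDl.
split; first by apply/cvg_ex; exists (l : R[i]^o).
rewrite /cderiv derive1E; apply: (@cvg_lim R[i]^o); first exact: norm_hausdorff.
exact: H.
Qed.

Lemma deriv_hasD f z : derivable (f : R[i]^o -> R[i]^o) z 1 -> hasD f z (cderiv f z).
Proof.
move=> df e e0.
have : (fun h : R[i]^o => h^-1 *: (((f : R[i]^o -> R[i]^o) \o shift z) (h *: (1 : R[i]^o)) - f z))
   @ (0 : R[i]^o)^' --> (cderiv f z : R[i]^o).
  by rewrite /cderiv derive1E; exact: df.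
move=> /cvg_cabs /(_ _ e0); rewrite near_withinE => /(nbhs_cabs (0 : R[i])) [d d0 H].
exists d => // h hd; have [->|h0] := eqVneq h 0.
  by rewrite addr0 subrr mul0r subr0 cabs0 mulr0.
have := H h; rewrite subr0 => /(_ hd h0) /=; rewrite /shift /=.
have -> : h *: (1 : R[i]^o) = h :> R[i] by rewrite /GRing.scale /= mulr1.
move=> /ltW H1; have h0' : 0 < cabs h by rewrite cabs_gt0.
rewrite -ler_pdivrMr// mulrC -cabsV -cabsM; apply: le_trans H1.
apply: eqW; congr cabs.
by rewrite /GRing.scale /= (addrC h); field.
Qed.

Lemma cDE f z : cD f z = cderiv f z.
Proof. by rewrite cD.unlock. Qed.

Lemma holo_hasD f z : holo f -> disk z -> hasD f z (cD f z).
Proof. by move=> fh dz; rewrite cDE; apply: deriv_hasD; exact: fh. Qed.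

Lemma hasD_holo f (g : R[i] -> R[i]) : (forall z, disk z -> hasD f z (g z)) -> holo f.
Proof. by move=> fg z dz; have [] := hasD_deriv (fg z dz). Qed.

Lemma hasD_cD f z l : hasD f z l -> cD f z = l.
Proof. by rewrite cDE; case/hasD_deriv. Qed.

Lemma hasD_local f g z l (r : R) : 0 < r -> (forall w, cabs (w - z) < r -> f w = g w) ->
  hasD f z l -> hasD g z l.
Proof.
move=> r0 fg fl e e0; have [d d0 H] := fl e e0.
exists (Num.min d r) => [|h]; first by rewrite lt_min d0.
rewrite lt_min => /andP[hd hr]; rewrite -!fg ?subrr ?cabs0//; first exact: H.
by rewrite addrC addKr.
Qed.

(** Cauchy's formula produces remainders of second order; this is how they become derivatives. *)
Lemma hasD_sq f z l (K r : R) : 0 < r ->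
  (forall h, cabs h < r -> cabs (f (z + h) - f z - h * l) <= K * cabs h ^+ 2) ->
  hasD f z l.
Proof.
move=> r0 H e e0; have K0 : 0 < `|K| + 1 by rewrite ltr_wpDl.
exists (Num.min r (e / (`|K| + 1))) => [|h].
  by rewrite lt_min r0 divr_gt0.
rewrite lt_min => /andP[hr hK]; apply: le_trans (H _ hr) _.
rewrite expr2 mulrA ler_wpM2r ?cabs_ge0//.
have [K1|K1] := leP K 0.
  by apply: le_trans (ltW e0); rewrite mulr_le0_ge0 ?cabs_ge0.
move: hK; rewrite ltr_pdivlMr// gtr0_norm// => /ltW hK.
by apply: le_trans hK; rewrite mulrDr mulr1 mulrC lerDl cabs_ge0.
Qed.

Lemma hasD_cont f z l : hasD f z l -> forall e : R, 0 < e -> exists2 d : R, 0 < d &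
  forall w, cabs (w - z) < d -> cabs (f w - f z) < e.
Proof.
move=> fl e e0; have [d d0 H] := fl 1 ltr01.
have K0 : 0 < 1 + cabs l by rewrite ltr_wpDr ?cabs_ge0.
exists (Num.min d (e / (1 + cabs l))) => [|w]; first by rewrite lt_min d0 divr_gt0.
rewrite lt_min => /andP[wd we].
have := H _ wd; rewrite mul1r (addrC z) subrK => Hw.
have : cabs (f w - f z) <= cabs (w - z) * (1 + cabs l).
  have := cabsD (f w - f z - (w - z) * l) ((w - z) * l); rewrite subrK => h1.
  by apply: le_trans h1 _; rewrite cabsM mulrDr mulr1 lerD2r.
by move=> /le_lt_trans; apply; rewrite -ltr_pdivlMr.
Qed.

Lemma hasD_cst (c z : R[i]) : hasD (fun=> c) z 0.
Proof.
move=> e e0; exists 1 => // h _.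
by rewrite subrr mulr0 subr0 cabs0 mulr_ge0 ?cabs_ge0// ltW.
Qed.

Lemma hasD_id z : hasD id z 1.
Proof.
move=> e e0; exists 1 => // h _.
rewrite (addrC z) addrK mulr1 subrr cabs0 mulr_ge0 ?cabs_ge0//; exact: ltW.
Qed.

Lemma hasDD f g z l m : hasD f z l -> hasD g z m -> hasD (fun w => f w + g w) z (l + m).
Proof.
move=> fl gm e e0; have e2 : 0 < e / 2 by rewrite divr_gt0.
have [d1 d10 H1] := fl _ e2; have [d2 d20 H2] := gm _ e2.
exists (Num.min d1 d2) => [|h]; first by rewrite lt_min d10.
rewrite lt_min => /andP[h1 h2].
rewrite (_ : _ - _ = (f (z + h) - f z - h * l) + (g (z + h) - g z - h * m)); last by ring.
apply: le_trans (cabsD _ _) _.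
by rewrite [e in leRHS]splitr mulrDl lerD ?H1 ?H2.
Qed.

Lemma hasDM f g z l m : hasD f z l -> hasD g z m ->
  hasD (fun w => f w * g w) z (l * g z + f z * m).
Proof.
move=> fl gm e e0.
(* [K] dominates |g| near [z], |f z| and |l|; each of the three error terms below receives
   [e / 3]. *)
pose K := 1 + cabs (g z) + cabs (f z) + cabs l.
have K1 : 1 <= K by rewrite /K -!addrA lerDl !addr_ge0 ?cabs_ge0.
have K0 : 0 < K by apply: lt_le_trans K1.
have e3 : 0 < e / (3 * K) by rewrite divr_gt0// mulr_gt0.
have [d1 d10 H1] := fl _ e3; have [d2 d20 H2] := gm _ e3.
have e3' : 0 < Num.min (e / (3 * K)) 1 by rewrite lt_min e3 /=.
have [d3 d30 H3] := hasD_cont gm e3'.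
exists (Num.min d1 (Num.min d2 d3)) => [|h]; first by rewrite !lt_min d10 d20.
rewrite !lt_min => /andP[h1 /andP[h2 h3]].
have {}h3 : cabs (g (z + h) - g z) < Num.min (e / (3 * K)) 1.
  by apply: H3; rewrite addrC addKr.
move: h3; rewrite lt_min => /andP[h3 h4].
rewrite (_ : _ - _ = (f (z + h) - f z - h * l) * g (z + h)
   + f z * (g (z + h) - g z - h * m) + h * l * (g (z + h) - g z)); last by ring.
apply: le_trans (cabsD _ _) _; rewrite cabsM.
apply: le_trans (lerD (cabsD _ _) (lexx _)) _; rewrite !cabsM.
have gb : cabs (g (z + h)) <= K.
  rewrite -[g (z + h)](subrK (g z)); apply: le_trans (cabsD _ _) _.
  rewrite /K -!addrA lerD ?(ltW h4)// lerDl addr_ge0 ?cabs_ge0//.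
have E : e / (3 * K) * K = e / 3 by field; rewrite gt_eqF.
have -> : e * cabs h = e / 3 * cabs h + e / 3 * cabs h + e / 3 * cabs h by field.
rewrite !lerD//.
- apply: le_trans (ler_pM (cabs_ge0 _) (cabs_ge0 _) (H1 _ h1) gb) _.
  by rewrite mulrAC E.
- have fb : cabs (f z) <= K.
    by rewrite /K addrAC lerDr !addr_ge0 ?cabs_ge0.
  apply: le_trans (ler_pM (cabs_ge0 _) (cabs_ge0 _) fb (H2 _ h2)) _.
  by rewrite mulrA (mulrC K) E.
- have lb : cabs l <= K by rewrite /K lerDr !addr_ge0 ?cabs_ge0.
  apply: le_trans (ler_pM (mulr_ge0 (cabs_ge0 _) (cabs_ge0 _)) (cabs_ge0 _) (ler_wpM2l (cabs_ge0 h) lb) (ltW h3)) _.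
  by rewrite -mulrA (mulrC K) E mulrC.
Qed.

Lemma hasDN f z l : hasD f z l -> hasD (fun w => - f w) z (- l).
Proof.
move=> fl e e0; have [d d0 H] := fl e e0; exists d => // h hd.
by rewrite mulrN -opprD -opprD cabsN; exact: H.
Qed.

Lemma hasDB f g z l m : hasD f z l -> hasD g z m -> hasD (fun w => f w - g w) z (l - m).
Proof. by move=> fl gm; apply: hasDD => //; exact: hasDN. Qed.

Lemma hasD_comp f g z l m : hasD f (g z) l -> hasD g z m ->
  hasD (f \o g) z (m * l).
Proof.
move=> fl gm e e0.
pose K := 1 + cabs m + cabs l.
have K1 : 1 <= K by rewrite /K -!addrA lerDl !addr_ge0 ?cabs_ge0.
have K0 : 0 < K by apply: lt_le_trans K1.
have e3 : 0 < e / (2 * K) by rewrite divr_gt0// mulr_gt0.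
have [d1 d10 H1] := fl _ e3; have [d3 d30 H3] := hasD_cont gm d10.
have e3' : 0 < Num.min (e / (2 * K)) 1 by rewrite lt_min e3 /=.
have [d2 d20 H2] := gm _ e3'.
exists (Num.min d2 d3) => [|h]; first by rewrite !lt_min d20.
rewrite !lt_min => /andP[h2 h3] /=.
set k := g (z + h) - g z.
have kd : cabs k < d1 by apply: H3; rewrite addrC addKr.
have kb := H2 _ h2; rewrite -/k in kb.
have kb1 : cabs k <= K * cabs h.
  rewrite -[k](subrK (h * m)); apply: le_trans (cabsD _ _) _.
  rewrite cabsM.
  have -> : K * cabs h = cabs h + (cabs m * cabs h + cabs l * cabs h) by rewrite /K; ring.
  apply: lerD; first by rewrite -[leRHS]mul1r; apply: le_trans kb _; rewrite ler_wpM2r ?cabs_ge0// ge_min lexx orbT.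
  by rewrite mulrC lerDl mulr_ge0 ?cabs_ge0.
have := H1 _ kd; rewrite {1}/k (addrC (g z)) subrK => H.
rewrite (_ : _ - _ = (f (g (z + h)) - f (g z) - k * l) + l * (k - h * m)); last by ring.
apply: le_trans (cabsD _ _) _; rewrite cabsM.
have E : e / (2 * K) * K = e / 2 by field; rewrite gt_eqF.
have -> : e * cabs h = e / 2 * cabs h + e / 2 * cabs h by field.
apply: lerD.
  apply: le_trans H _; apply: le_trans (ler_wpM2l (ltW e3) kb1) _.
  by rewrite mulrA E.
have lb : cabs l <= K by rewrite /K lerDr !addr_ge0 ?cabs_ge0.
apply: le_trans (ler_pM (cabs_ge0 _) (cabs_ge0 _) lb kb) _.
rewrite mulrA; apply: ler_wpM2r; first exact: cabs_ge0.
by rewrite -E mulrC ler_wpM2r ?ge_min ?lexx// ltW.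
Qed.

End Derivative.

(** * Cauchy's formula on rectangles *)

Section Bisection.
Variable R : realType.
Variables (X Y w h : R) (P : R -> R -> R -> Prop).
Hypotheses (w0 : 0 <= w) (h0 : 0 <= h).
Hypothesis P4 : forall x y s, 0 < s ->
  P x y (s / 2) -> P (x + s / 2 * w) y (s / 2) ->
  P x (y + s / 2 * h) (s / 2) -> P (x + s / 2 * w) (y + s / 2 * h) (s / 2) ->
  P x y s.
Hypothesis Ploc : forall x y, X <= x <= X + w -> Y <= y <= Y + h ->
  exists2 d : R, 0 < d & forall x' y' s, 0 < s < d ->
    x' <= x <= x' + s * w -> y' <= y <= y' + s * h -> P x' y' s.

(** [P x y s] speaks of the rectangle with corner [(x, y)] and sides [s * w], [s * h]. If [P X Y 1]
    failed, some quarter would fail at each stage; the nested quarters shrink to a point, where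
    [Ploc] gives a contradiction. *)
Lemma rectangle_bisection : P X Y 1.
Proof.
apply: contrapT => nP.
(* The hypotheses sit under the existential so that [choice] yields a total map on triples; a triple
   with [s <= 0] is sent to itself. *)
have step (p : R * R * R) : exists q : R * R * R, 0 < p.2 -> ~ P p.1.1 p.1.2 p.2 ->
  [/\ ~ P q.1.1 q.1.2 q.2, q.2 = p.2 / 2,
      p.1.1 <= q.1.1 & q.1.1 + q.2 * w <= p.1.1 + p.2 * w] /\
  (p.1.2 <= q.1.2 /\ q.1.2 + q.2 * h <= p.1.2 + p.2 * h).
  case: p => -[x y] s /=.
  have [s0|s0] := ltP 0 s; last by exists (x, y, s).
  have sw : 0 <= s / 2 * w by rewrite mulr_ge0// divr_ge0// ltW.
  have sh : 0 <= s / 2 * h by rewrite mulr_ge0// divr_ge0// ltW.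
  have Ew : s * w = s / 2 * w + s / 2 * w by field.
  have Eh : s * h = s / 2 * h + s / 2 * h by field.
  have [p1|n1] := pselect (P x y (s / 2)); last first.
    by exists (x, y, s / 2) => /= _ _; split; [split => //|]; lra.
  have [p2|n2] := pselect (P (x + s / 2 * w) y (s / 2)); last first.
    by exists (x + s / 2 * w, y, s / 2) => /= _ _; split; [split => //|]; lra.
  have [p3|n3] := pselect (P x (y + s / 2 * h) (s / 2)); last first.
    by exists (x, y + s / 2 * h, s / 2) => /= _ _; split; [split => //|]; lra.
  have [p4|n4] := pselect (P (x + s / 2 * w) (y + s / 2 * h) (s / 2)); last first.
    by exists (x + s / 2 * w, y + s / 2 * h, s / 2) => /= _ _; split; [split => //|]; lra.
  by exists (x, y, s) => /= _ n; exfalso; apply: n; exact: P4.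
have [f fP] := choice step.
pose u n := iter n f (X, Y, 1).
have us n : (u n).2 = 2^-1 ^+ n /\ ~ P (u n).1.1 (u n).1.2 (u n).2.
  elim: n => [|n [IH1 IH2]]; first by rewrite expr0.
  have s0 : 0 < (u n).2 by rewrite IH1 exprn_gt0// invr_gt0.
  by have [[a b _ _] _] := fP (u n) s0 IH2; split => //; rewrite b IH1 exprSr.
have us0 n : 0 < (u n).2 by rewrite (us n).1 exprn_gt0// invr_gt0.
have ustep n := fP (u n) (us0 n) (us n).2.
have um m n : (m <= n)%N -> [/\ (u m).1.1 <= (u n).1.1,
   (u n).1.1 + (u n).2 * w <= (u m).1.1 + (u m).2 * w,
   (u m).1.2 <= (u n).1.2 &
   (u n).1.2 + (u n).2 * h <= (u m).1.2 + (u m).2 * h].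
  move=> /subnK <-; elim: (n - m)%N => [|k [IH1 IH2 IH3 IH4]]; first by split.
  have [[_ _ a b] [c d]] := ustep (k + m)%N.
  by rewrite addSn; split;
    [apply: le_trans a | apply: le_trans b _ | apply: le_trans c | apply: le_trans d _].
(* Nested intervals in one coordinate: every right end bounds every left end, so the supremum of the
   left ends lies in all of them. *)
have key (g : nat -> R) (k : nat -> R) : (forall m n, (m <= n)%N -> g m <= g n) ->
   (forall m n, (m <= n)%N -> g n + k n <= g m + k m) -> (forall n, 0 <= k n) ->
   forall n, g n <= sup (range g) <= g n + k n.
  move=> gm gk k0 n.
  have ub m : g m <= g n + k n.
    have := gm _ _ (leq_maxl m n); have := gk _ _ (leq_maxr m n).
    by have := k0 (maxn m n); lra.
  apply/andP; split.
    apply: ub_le_sup; last by exists n.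
    by exists (g n + k n) => _ [m _ <-].
  apply: ge_sup; first by exists (g n), n.
  by move=> _ [m _ <-].
have kx := key (fun n => (u n).1.1) (fun n => (u n).2 * w)
  (fun m n mn => let: And4 a _ _ _ := um m n mn in a)
  (fun m n mn => let: And4 _ a _ _ := um m n mn in a)
  (fun n => mulr_ge0 (ltW (us0 n)) w0).
have ky := key (fun n => (u n).1.2) (fun n => (u n).2 * h)
  (fun m n mn => let: And4 _ _ a _ := um m n mn in a)
  (fun m n mn => let: And4 _ _ _ a := um m n mn in a)
  (fun n => mulr_ge0 (ltW (us0 n)) h0).
have := kx 0%N; have := ky 0%N; rewrite /= !mul1r => ky0 kx0.
have [d d0 Pd] := Ploc kx0 ky0.
have [n nd] : exists n, 2^-1 ^+ n < d.
  have : (2^-1 : R) ^+ n @[n --> \oo] --> (0 : R).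
    by apply: cvg_expr; rewrite ger0_norm ?invf_lt1 ?ltr1n// invr_ge0.
  move=> /cvgr0Pnorm_lt /(_ d d0) [N _ /(_ N (leqnn N))] /= H.
  by exists N; rewrite -[ltLHS]ger0_norm// exprn_ge0// invr_ge0.
apply: (us n).2; apply: Pd; [|exact: kx|exact: ky].
by rewrite us0 (us n).1.
Qed.

End Bisection.

(** * Integrals of complex functions along segments *)

Section LineIntegral.
Variable R : realType.
Notation mu := (@lebesgue_measure R).
Implicit Types (g : R -> R[i]) (a b : R).

Definition contw g a b := forall x, a <= x <= b -> forall e : R, 0 < e ->
  exists2 d : R, 0 < d & forall y, a <= y <= b -> `|y - x| < d -> cabs (g y - g x) < e.

Definition cint g a b : R[i] :=
  Complex (\int[mu]_(x in `[a, b]) complex.Re (g x))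
          (\int[mu]_(x in `[a, b]) complex.Im (g x)).

Lemma contw_part (p : R[i] -> R) g a b :
  (forall z w, `|p z - p w| <= cabs (z - w)) -> contw g a b ->
  {within `[a, b], continuous (p \o g)}.
Proof.
move=> pL cg; apply/subspace_continuousP => x /=; rewrite in_itv/= => xab.
apply/cvgrPdist_lt => e e0; rewrite near_withinE.
have [d d0 H] := cg x xab e e0; apply: filterS (nbhsx_ballx x d d0) => y /= yd.
rewrite in_itv/= => yab; rewrite distrC; apply: le_lt_trans (pL _ _) _.
by apply: H => //; rewrite distrC.
Qed.

Lemma Re_lip (z w : R[i]) : `|complex.Re z - complex.Re w| <= cabs (z - w).
Proof. by apply: le_trans (cabs_Re _); case: z; case: w. Qed.

Lemma Im_lip (z w : R[i]) : `|complex.Im z - complex.Im w| <= cabs (z - w).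
Proof. by apply: le_trans (cabs_Im _); case: z; case: w. Qed.

Lemma contw_int (p : R[i] -> R) g a b :
  (forall z w, `|p z - p w| <= cabs (z - w)) -> contw g a b ->
  mu.-integrable `[a, b] (EFin \o (p \o g)).
Proof.
move=> pL cg; apply: continuous_compact_integrable; first exact: segment_compact.
exact: contw_part.
Qed.

Lemma contw_Re g a b : contw g a b ->
  mu.-integrable `[a, b] (EFin \o (fun x => complex.Re (g x))).
Proof. by move=> /(contw_int Re_lip). Qed.

Lemma contw_Im g a b : contw g a b ->
  mu.-integrable `[a, b] (EFin \o (fun x => complex.Im (g x))).
Proof. by move=> /(contw_int Im_lip). Qed.

Lemma Rint_split (f : R -> R) a m b : a <= m -> m <= b ->
  mu.-integrable `[a, b] (EFin \o f) ->
  \int[mu]_(x in `[a, b]) f x = \int[mu]_(x in `[a, m]) f x + \int[mu]_(x in `[m, b]) f x.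
Proof.
move=> am mb fi; have := @Rintegral_itvB _ f (BLeft a) (BRight b) m fi.
rewrite !bnd_simp => /(_ am mb) /eqP; rewrite subr_eq => /eqP ->.
rewrite addrC; congr (_ + _); apply: Rintegral_itv_obnd_cbnd.
apply: integrableS fi => //; apply: subset_itvr; by rewrite bnd_simp.
Qed.

Lemma cint_split g a m b : a <= m -> m <= b -> contw g a b ->
  cint g a b = cint g a m + cint g m b.
Proof.
move=> am mb cg; rewrite /cint (Rint_split am mb (contw_Re cg)).
by rewrite (Rint_split am mb (contw_Im cg)).
Qed.

Lemma contwD g1 g2 a b : contw g1 a b -> contw g2 a b ->
  contw (fun x => g1 x + g2 x) a b.
Proof.
move=> c1 c2 x xab e e0; have e2 : 0 < e / 2 by rewrite divr_gt0.
have [d1 d10 H1] := c1 x xab _ e2; have [d2 d20 H2] := c2 x xab _ e2.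
exists (Num.min d1 d2) => [|y yab]; first by rewrite lt_min d10.
rewrite lt_min => /andP[y1 y2]; rewrite opprD addrACA.
apply: le_lt_trans (cabsD _ _) _; rewrite [e]splitr ltrD ?H1 ?H2//.
Qed.

Lemma contwZ (c : R[i]) g a b : contw g a b -> contw (fun x => c * g x) a b.
Proof.
move=> cg x xab e e0.
have c0 : 0 < cabs c + 1 by rewrite ltr_wpDl ?cabs_ge0.
have [d d0 H] := cg x xab (e / (cabs c + 1)) (divr_gt0 e0 c0).
exists d => // y yab yd; rewrite -mulrBr cabsM.
have := H y yab yd; rewrite ltr_pdivlMr// => /(le_lt_trans _); apply.
by rewrite mulrC ler_wpM2l ?cabs_ge0// lerDl.
Qed.

Lemma cintD g1 g2 a b : contw g1 a b -> contw g2 a b ->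
  cint (fun x => g1 x + g2 x) a b = cint g1 a b + cint g2 a b.
Proof.
move=> c1 c2; rewrite /cint.
have -> : \int[mu]_(x in `[a, b]) complex.Re (g1 x + g2 x) =
   \int[mu]_(x in `[a, b]) (complex.Re (g1 x) + complex.Re (g2 x)).
  by apply: eq_Rintegral => x _; case: (g1 x); case: (g2 x).
have -> : \int[mu]_(x in `[a, b]) complex.Im (g1 x + g2 x) =
   \int[mu]_(x in `[a, b]) (complex.Im (g1 x) + complex.Im (g2 x)).
  by apply: eq_Rintegral => x _; case: (g1 x); case: (g2 x).
rewrite !RintegralD//; by [exact: contw_Re | exact: contw_Im].
Qed.

Lemma cintZ (c : R[i]) g a b : contw g a b ->
  cint (fun x => c * g x) a b = c * cint g a b.
Proof.
move=> cg; rewrite /cint; case: c => u v.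
have i1 := contw_Re cg; have i2 := contw_Im cg.
have iz (k : R) (f : R -> R) : mu.-integrable `[a, b] (EFin \o f) ->
   mu.-integrable `[a, b] (EFin \o (fun x => k * f x)).
  move=> fi; rewrite (_ : EFin \o _ = (fun x => k%:E * (EFin \o f) x)%E)//; exact: integrableZl.
have -> : \int[mu]_(x in `[a, b]) complex.Re (Complex u v * g x) =
   \int[mu]_(x in `[a, b]) (u * complex.Re (g x) - v * complex.Im (g x)).
  by apply: eq_Rintegral => x _; case: (g x).
have -> : \int[mu]_(x in `[a, b]) complex.Im (Complex u v * g x) =
   \int[mu]_(x in `[a, b]) (u * complex.Im (g x) + v * complex.Re (g x)).
  by apply: eq_Rintegral => x _; case: (g x).
rewrite RintegralB ?RintegralD//; try exact: iz.
by rewrite !RintegralZl.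
Qed.

(** Real and imaginary parts are bounded separately, hence the factor 2; only the order of magnitude
    matters later. *)
Lemma cint_bound g a b (M : R) : a <= b -> contw g a b ->
  (forall x, a <= x <= b -> cabs (g x) <= M) -> cabs (cint g a b) <= 2 * M * (b - a).
Proof.
move=> ab cg gM.
have B (p : R[i] -> R) : (forall z w, `|p z - p w| <= cabs (z - w)) ->
    (forall z, `|p z| <= cabs z) ->
    `|\int[mu]_(x in `[a, b]) p (g x)| <= M * (b - a).
  move=> pL pb; have pi := contw_int pL cg.
  apply: le_trans (le_normr_Rintegral _ pi) _ => //.
  apply: (@le_trans _ _ (\int[mu]_(x in `[a, b]) M)).
    apply: le_Rintegral => //.
    - have := integrable_abse pi; apply: eq_integrable => // x _ //=.
    - apply: continuous_compact_integrable; first exact: segment_compact.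
      by apply/continuous_subspaceT => x; exact: cvg_cst.
    - move=> x; rewrite /= in_itv/= => xab; apply: le_trans (pb _) _; exact: gM.
  rewrite Rintegral_cst//.
  have -> // : fine (mu `[a, b]) = b - a.
  transitivity (fine (lebesgue_measure [set` `[a, b]%R])) => //.
  rewrite lebesgue_measure_itv/= lte_fin.
  by case: ltP => // ba; apply/esym/eqP; rewrite subr_eq0 eq_le ab ba.
apply: le_trans (cabs_le_ReIm _) _ => /=.
have -> : 2 * M * (b - a) = M * (b - a) + M * (b - a) by ring.
by apply: lerD; apply: B; by [exact: Re_lip|exact: Im_lip|exact: cabs_Re|exact: cabs_Im].
Qed.

Lemma Rint_ftc (G g : R -> R) a b : a <= b -> (forall x : R, is_derive x 1 G (g x)) ->
  continuous g -> \int[mu]_(x in `[a, b]) g x = G b - G a.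
Proof.
rewrite le_eqVlt => /predU1P[-> _ _|ab dG cg].
  by rewrite subrr set_itv1 Rintegral_set1.
rewrite /Rintegral (@continuous_FTC2 _ g G)//.
- exact: continuous_subspaceT.
- have cG : continuous G.
    by move=> x; apply: differentiable_continuous; apply/derivable1_diffP; have := dG x; case.
  split.
  + by move=> x _; have := dG x; case.
  + apply: cvg_at_right_filter; exact: cG.
  + apply: cvg_at_left_filter; exact: cG.
- by move=> x _; rewrite derive1E; have := dG x => -[_ ->].
Qed.

End LineIntegral.

(** * Contour integrals over rectangles and Goursat's theorem *)

Section Rectangle.
Variable R : realType.
Notation mu := (@lebesgue_measure R).
Implicit Types (F G : R[i] -> R[i]).

Definition ccont F (z : R[i]) := forall e : R, 0 < e -> exists2 d : R, 0 < d &
  forall w, cabs (w - z) < d -> cabs (F w - F z) < e.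

Definition hline F y : R -> R[i] := fun x => F (Complex x y).
Definition vline F x : R -> R[i] := fun y => F (Complex x y).

(** The counterclockwise contour integral: bottom minus top, plus ['i] times right minus left
    because dz is i dy on vertical sides. *)
Definition rint F (x0 x1 y0 y1 : R) : R[i] :=
  cint (hline F y0) x0 x1 - cint (hline F y1) x0 x1 +
  'i%C * (cint (vline F x1) y0 y1 - cint (vline F x0) y0 y1).

Lemma cabs_hor (x x' y : R) : cabs (Complex x y - Complex x' y) = `|x - x'|.
Proof. by rewrite -cabs_real; congr cabs; apply/eqP; rewrite eq_complex /= subrr !eqxx. Qed.

Lemma cabs_ver (x y y' : R) : cabs (Complex x y - Complex x y') = `|y - y'|.
Proof.
rewrite (_ : _ - _ = 'i%C * (y - y')%:C%C); last by apply/eqP; rewrite eq_complex /= !mul0r mulr0 mul1r subrr subr0 add0r !eqxx.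
by rewrite cabsM cabs_real /cabs /= expr0n /= add0r expr1n sqrtr1 mul1r.
Qed.

Lemma ccont_hline F y a b : (forall x, a <= x <= b -> ccont F (Complex x y)) ->
  contw (hline F y) a b.
Proof.
move=> H x xab e e0; have [d d0 Hd] := H x xab e e0.
by exists d => // x' _ xx; apply: Hd; rewrite cabs_hor.
Qed.

Lemma ccont_vline F x a b : (forall y, a <= y <= b -> ccont F (Complex x y)) ->
  contw (vline F x) a b.
Proof.
move=> H y yab e e0; have [d d0 Hd] := H y yab e e0.
by exists d => // y' _ yy; apply: Hd; rewrite cabs_ver.
Qed.

Definition bdcont F (x0 x1 y0 y1 : R) :=
  [/\ contw (hline F y0) x0 x1, contw (hline F y1) x0 x1,
      contw (vline F x0) y0 y1 & contw (vline F x1) y0 y1].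

Lemma rint_splitx F x0 m x1 y0 y1 : x0 <= m <= x1 ->
  contw (hline F y0) x0 x1 -> contw (hline F y1) x0 x1 ->
  rint F x0 x1 y0 y1 = rint F x0 m y0 y1 + rint F m x1 y0 y1.
Proof.
move=> /andP[am mb] c0 c1; rewrite /rint (cint_split am mb c0) (cint_split am mb c1).
by ring.
Qed.

Lemma rint_splity F x0 x1 y0 m y1 : y0 <= m <= y1 ->
  contw (vline F x0) y0 y1 -> contw (vline F x1) y0 y1 ->
  rint F x0 x1 y0 y1 = rint F x0 x1 y0 m + rint F x0 x1 m y1.
Proof.
move=> /andP[am mb] c0 c1; rewrite /rint (cint_split am mb c0) (cint_split am mb c1).
by ring.
Qed.

Lemma rintD F G x0 x1 y0 y1 : bdcont F x0 x1 y0 y1 -> bdcont G x0 x1 y0 y1 ->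
  rint (fun z => F z + G z) x0 x1 y0 y1 = rint F x0 x1 y0 y1 + rint G x0 x1 y0 y1.
Proof.
move=> [f1 f2 f3 f4] [g1 g2 g3 g4]; rewrite /rint.
rewrite (cintD f1 g1) (cintD f2 g2) (cintD f3 g3) (cintD f4 g4).
by ring.
Qed.

Lemma rintZ (c : R[i]) F x0 x1 y0 y1 : bdcont F x0 x1 y0 y1 ->
  rint (fun z => c * F z) x0 x1 y0 y1 = c * rint F x0 x1 y0 y1.
Proof.
move=> [f1 f2 f3 f4]; rewrite /rint (cintZ _ f1) (cintZ _ f2) (cintZ _ f3) (cintZ _ f4).
by ring.
Qed.

Lemma bdcontZ (c : R[i]) F x0 x1 y0 y1 : bdcont F x0 x1 y0 y1 ->
  bdcont (fun z => c * F z) x0 x1 y0 y1.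
Proof. by move=> [f1 f2 f3 f4]; split; exact: contwZ. Qed.

Lemma bdcontD F G x0 x1 y0 y1 : bdcont F x0 x1 y0 y1 -> bdcont G x0 x1 y0 y1 ->
  bdcont (fun z => F z + G z) x0 x1 y0 y1.
Proof. by move=> [f1 f2 f3 f4] [g1 g2 g3 g4]; split; exact: contwD. Qed.

Lemma rintB F G x0 x1 y0 y1 : bdcont F x0 x1 y0 y1 -> bdcont G x0 x1 y0 y1 ->
  rint (fun z => F z - G z) x0 x1 y0 y1 = rint F x0 x1 y0 y1 - rint G x0 x1 y0 y1.
Proof.
move=> f g; have -> : (fun z => F z - G z) = (fun z => F z + (-1) * G z).
  by apply/funext => z; rewrite mulN1r.
by rewrite rintD ?rintZ ?mulN1r//; exact: bdcontZ.
Qed.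

Definition onbd (x0 x1 y0 y1 : R) (z : R[i]) :=
  let x := complex.Re z in let y := complex.Im z in
  [&& x0 <= x <= x1, y0 <= y <= y1 & [|| x == x0, x == x1, y == y0 | y == y1]].

Lemma bdcont_ccont F x0 x1 y0 y1 : x0 <= x1 -> y0 <= y1 ->
  (forall z, onbd x0 x1 y0 y1 z -> ccont F z) -> bdcont F x0 x1 y0 y1.
Proof.
move=> x01 y01 E; split; [apply: ccont_hline|apply: ccont_hline|apply: ccont_vline|apply: ccont_vline];
  by move=> t tab; apply: E; rewrite /onbd /= ?tab ?lexx ?x01 ?y01 ?eqxx ?orbT.
Qed.

Lemma rint_bound F x0 x1 y0 y1 (M : R) : x0 <= x1 -> y0 <= y1 ->
  bdcont F x0 x1 y0 y1 -> (forall z, onbd x0 x1 y0 y1 z -> cabs (F z) <= M) ->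
  cabs (rint F x0 x1 y0 y1) <= 4 * M * ((x1 - x0) + (y1 - y0)).
Proof.
move=> x01 y01 [f1 f2 f3 f4] FM.
have b1 : cabs (cint (hline F y0) x0 x1) <= 2 * M * (x1 - x0).
  by apply: cint_bound => // t tab; apply: FM; rewrite /onbd /= ?tab ?lexx ?x01 ?y01 ?eqxx ?orbT.
have b2 : cabs (cint (hline F y1) x0 x1) <= 2 * M * (x1 - x0).
  by apply: cint_bound => // t tab; apply: FM; rewrite /onbd /= ?tab ?lexx ?x01 ?y01 ?eqxx ?orbT.
have b3 : cabs (cint (vline F x0) y0 y1) <= 2 * M * (y1 - y0).
  by apply: cint_bound => // t tab; apply: FM; rewrite /onbd /= ?tab ?lexx ?x01 ?y01 ?eqxx ?orbT.
have b4 : cabs (cint (vline F x1) y0 y1) <= 2 * M * (y1 - y0).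
  by apply: cint_bound => // t tab; apply: FM; rewrite /onbd /= ?tab ?lexx ?x01 ?y01 ?eqxx ?orbT.
rewrite /rint; apply: le_trans (cabsD _ _) _; rewrite cabsM.
have -> : cabs 'i%C = 1 :> R by rewrite /cabs /= expr0n /= add0r expr1n sqrtr1.
have := cabsD (cint (hline F y0) x0 x1) (- cint (hline F y1) x0 x1).
have := cabsD (cint (vline F x1) y0 y1) (- cint (vline F x0) y0 y1).
rewrite !cabsN mul1r; lra.
Qed.

Lemma hasD_ccont F z l : hasD F z l -> ccont F z.
Proof. exact: hasD_cont. Qed.

Lemma cintx (a b : R) : a <= b -> \int[mu]_(x in `[a, b]) x = (b ^+ 2 - a ^+ 2) / 2.
Proof.
move=> ab.
have dG (x : R) : is_derive x 1 (2^-1 \*: (@GRing.exp R ^~ 2%N)) x.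
  by apply: is_derive_eq; rewrite /GRing.scale /=; field.
rewrite (Rint_ftc ab dG) /=; last by move=> x; exact: cvg_id.
by rewrite /GRing.scale /=; field.
Qed.

Lemma cint1 (c a b : R) : a <= b -> \int[mu]_(x in `[a, b]) c = c * (b - a).
Proof.
move=> ab; have dG (x : R) : is_derive x 1 (c \*: (id : R -> R)) c.
  by apply: is_derive_eq; rewrite /GRing.scale /= mulr1.
by rewrite (Rint_ftc ab dG) /= ?mulrBr// => x; exact: cvg_cst.
Qed.

(** Explicit primitives settle this case of Cauchy's theorem; it lets Goursat's argument subtract
    the affine approximation at no cost. *)
Lemma rint_affine (c m : R[i]) x0 x1 y0 y1 : x0 <= x1 -> y0 <= y1 ->
  rint (fun z => c + m * z) x0 x1 y0 y1 = 0.
Proof.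
move=> x01 y01.
have cid z : ccont (fun z => z) z by exact: hasD_ccont (@hasD_id _ z).
have c1 z : ccont (fun=> (1 : R[i])) z by exact: hasD_ccont (@hasD_cst _ 1 z).
have bid := bdcont_ccont x01 y01 (fun z _ => cid z).
have b1 := bdcont_ccont x01 y01 (fun z _ => c1 z).
have -> : (fun z => c + m * z) = (fun z => c * 1 + m * z) by apply/funext => z; rewrite mulr1.
rewrite rintD ?rintZ//; [|exact: bdcontZ|exact: bdcontZ].
have -> : rint (fun=> 1) x0 x1 y0 y1 = 0 by rewrite /rint /hline /vline !subrr mulr0 addr0.
rewrite mulr0 add0r /rint /hline /vline /cint /= !cintx// !cint1//; simpc.
by rewrite (_ : Complex _ _ = 0) ?mulr0//; congr Complex; field.
Qed.

Lemma cabsD4 (a b c d : R[i]) (M : R) : cabs a <= M -> cabs b <= M ->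
  cabs c <= M -> cabs d <= M -> cabs (a + b + (c + d)) <= M + M + M + M.
Proof.
move=> aM bM cM dM; apply: le_trans (cabsD _ _) _; rewrite -[leRHS]addrA.
by apply: lerD; apply: le_trans (cabsD _ _) _; apply: lerD.
Qed.

Lemma rint_quarter F (x y u v : R) : 0 < u -> 0 < v ->
  (forall a b, x <= a <= x + u + u -> y <= b <= y + v + v -> ccont F (Complex a b)) ->
  rint F x (x + u + u) y (y + v + v) =
  rint F x (x + u) y (y + v) + rint F x (x + u) (y + v) (y + v + v) +
  (rint F (x + u) (x + u + u) y (y + v) + rint F (x + u) (x + u + u) (y + v) (y + v + v)).
Proof.
move=> u0 v0 cF.
have hx : x <= x + u <= x + u + u by rewrite !lerDl !ltW.
have hy : y <= y + v <= y + v + v by rewrite !lerDl !ltW.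
have [hx1 hx2] := andP hx; have [hy1 hy2] := andP hy.
have hx3 := le_trans hx1 hx2; have hy3 := le_trans hy1 hy2.
rewrite (rint_splitx hx); last 2 first.
- by apply: ccont_hline => t tab; apply: cF => //; rewrite lexx.
- by apply: ccont_hline => t tab; apply: cF => //; rewrite lexx hy3.
rewrite (rint_splity hy); last 2 first.
- by apply: ccont_vline => t tab; apply: cF => //; rewrite lexx.
- by apply: ccont_vline => t tab; apply: cF => //.
rewrite (rint_splity hy) //.
- by apply: ccont_vline => t tab; apply: cF => //.
- by apply: ccont_vline => t tab; apply: cF => //; rewrite lexx hx3.
Qed.

(** The bound [e * s ^+ 2] is additive over quarters, since four times (s/2)^2 is s^2. On small
    rectangles it holds because [F] differs from its affine approximation by o(s) on a boundary of
    length O(s). *)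
Lemma goursat F (X Y w h : R) : 0 < w -> 0 < h ->
  (forall x y, X <= x <= X + w -> Y <= y <= Y + h -> exists l, hasD F (Complex x y) l) ->
  rint F X (X + w) Y (Y + h) = 0.
Proof.
move=> w0 h0 dF; apply/eqP; rewrite -cabs_eq0 eq_le cabs_ge0 andbT.
apply/ler_addgt0Pr => e e0; rewrite add0r.
have cF x y : X <= x <= X + w -> Y <= y <= Y + h -> ccont F (Complex x y).
  by move=> hx hy; have [l /hasD_ccont] := dF x y hx hy.
(* Containment in the original rectangle is made part of [P], since the bisection principle does not
   carry it along. *)
pose P x y s := X <= x -> x + s * w <= X + w -> Y <= y -> y + s * h <= Y + h ->
   cabs (rint F x (x + s * w) y (y + s * h)) <= e * s ^+ 2.
have : P X Y 1; last first.
  by rewrite /P !mul1r expr1n mulr1; apply.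
apply: (@rectangle_bisection _ X Y w h P); rewrite ?ltW//.
  move=> x y s s0 p1 p2 p3 p4; rewrite /P.
  have : 0 < s / 2 * w by rewrite mulr_gt0// divr_gt0.
  have : 0 < s / 2 * h by rewrite mulr_gt0// divr_gt0.
  have : s * w = s / 2 * w + s / 2 * w by field.
  have : s * h = s / 2 * h + s / 2 * h by field.
  move: p1 p2 p3 p4; rewrite /P.
  set u := s / 2 * w; set v := s / 2 * h => p1 p2 p3 p4 -> -> v0 u0.
  rewrite !(addrA x) !(addrA y) => xX xw yY yh.
  have E4 : e * s ^+ 2 = e * (s / 2) ^+ 2 + e * (s / 2) ^+ 2 + e * (s / 2) ^+ 2 + e * (s / 2) ^+ 2.
    by field.
  have u1 : x <= x + u by rewrite lerDl ltW.
  have v1 : y <= y + v by rewrite lerDl ltW.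
  have u2 : x + u <= X + w by apply: le_trans xw; rewrite lerDl ltW.
  have v2 : y + v <= Y + h by apply: le_trans yh; rewrite lerDl ltW.
  have u3 := le_trans xX u1; have v3 := le_trans yY v1.
  rewrite E4 rint_quarter//; first by apply: cabsD4; [exact: p1|exact: p3|exact: p2|exact: p4].
  move=> a b /andP[a1 a2] /andP[b1 b2]; apply: cF.
    by rewrite (le_trans xX a1) (le_trans a2 xw).
  by rewrite (le_trans yY b1) (le_trans b2 yh).
move=> x y xX yY; have [l dl] := dF x y xX yY.
have wh : 0 < w + h by rewrite addr_gt0.
(* Chosen so that [rint_bound], with integrand at most [e' * (s * (w + h))] and half-perimeter
   [s * (w + h)], gives exactly [e * s ^+ 2]. *)
pose e' := e / (4 * (w + h) ^+ 2).
have e'0 : 0 < e' by rewrite divr_gt0// mulr_gt0// exprn_gt0.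
have [d d0 Hd] := dl _ e'0.
exists (d / (w + h)); first by rewrite divr_gt0.
move=> x' y' s /andP[s0 sd] /andP[xx1 xx2] /andP[yy1 yy2] xX' xw' yY' yh'.
have sw : 0 < s * w by rewrite mulr_gt0.
have sh : 0 < s * h by rewrite mulr_gt0.
pose A := fun z : R[i] => (F (Complex x y) - l * Complex x y) + l * z.
have dA z : hasD A z (0 + (0 * z + l * 1)).
  by apply: hasDD; [exact: hasD_cst | apply: hasDM; [exact: hasD_cst | exact: hasD_id]].
have bA : bdcont A x' (x' + s * w) y' (y' + s * h).
  by apply: bdcont_ccont; [lra|lra|move=> z _; apply: hasD_ccont (dA z)].
have bF : bdcont F x' (x' + s * w) y' (y' + s * h).
  apply: bdcont_ccont; [lra|lra|move=> [a b] /and3P[/= ha hb _]].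
  by apply: cF; lra.
have : rint (fun z => F z - A z) x' (x' + s * w) y' (y' + s * h) = rint F x' (x' + s * w) y' (y' + s * h).
  by rewrite rintB// rint_affine ?subr0//; lra.
move=> <-.
apply: le_trans (_ : 4 * (e' * (s * (w + h))) * ((x' + s * w - x') + (y' + s * h - y')) <= _).
  apply: rint_bound; [lra|lra| |move=> [a b] /and3P[/= ha hb _]].
    have -> : (fun z => F z - A z) = (fun z => F z + (-1) * A z).
      by apply/funext => z; rewrite mulN1r.
    by apply: bdcontD => //; exact: bdcontZ.
  have nb : cabs (Complex a b - Complex x y) <= s * (w + h).
    apply: le_trans (cabs_le_ReIm _) _; simpc; rewrite /= mulrDr.
    by apply: lerD; rewrite ler_norml; lra.
  have := Hd (Complex a b - Complex x y).
  rewrite (addrC (Complex x y)) subrK => Hab.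
  have -> : F (Complex a b) - A (Complex a b) =
     F (Complex a b) - F (Complex x y) - (Complex a b - Complex x y) * l by rewrite /A; ring.
  apply: le_trans (Hab _) _.
    by apply: le_lt_trans nb _; rewrite -ltr_pdivlMr.
  by rewrite ler_wpM2l// ltW.
have -> : e * s ^+ 2 = 4 * (e' * (s * (w + h))) * (x' + s * w - x' + (y' + s * h - y')).
  by rewrite /e'; field; rewrite gt_eqF.
exact: lexx.
Qed.

End Rectangle.

(** * Cauchy's integral formula *)

Section Cauchy.
Variable R : realType.
Notation mu := (@lebesgue_measure R).
Implicit Types (f F G : R[i] -> R[i]).

Lemma hasDV (z : R[i]) : z != 0 -> hasD (fun w => w^-1) z (- z ^- 2).
Proof.
move=> z0; have az : 0 < cabs z by rewrite cabs_gt0.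
apply: (@hasD_sq _ _ _ _ (2 / cabs z ^+ 3) (cabs z / 2)); first by rewrite divr_gt0.
move=> h hz; have zh : cabs z / 2 <= cabs (z + h).
  by apply: le_trans (cabsDl _ _); rewrite {2}[cabs z]splitr; lra.
have zh0 : z + h != 0.
  by rewrite -cabs_gt0; apply: lt_le_trans zh; rewrite divr_gt0.
have -> : (z + h)^-1 - z^-1 - h * - z ^- 2 = h ^+ 2 / (z ^+ 2 * (z + h)).
  by field; rewrite z0 zh0.
rewrite cabsM cabsX cabsV cabsM cabsX mulrC ler_wpM2r ?exprn_ge0 ?cabs_ge0//.
have -> : 2 / cabs z ^+ 3 = (cabs z ^+ 2 * (cabs z / 2))^-1.
  by field; rewrite gt_eqF.
rewrite lef_pV2 ?posrE ?mulr_gt0 ?exprn_gt0 ?divr_gt0// ?(lt_le_trans _ zh) ?divr_gt0//.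
by rewrite ler_pM2l// exprn_gt0.
Qed.

Lemma hasD_inv_sub (a z : R[i]) : z != a -> hasD (fun w => (w - a)^-1) z (- (z - a) ^- 2).
Proof.
move=> za; have za' : z - a != 0 by rewrite subr_eq0.
have := @hasD_comp _ (fun w => w^-1) (fun w => w - a) z _ _ (hasDV za')
   (hasDB (@hasD_id _ z) (@hasD_cst _ a z)).
by rewrite subr0 mul1r.
Qed.

Lemma goursat2 F (x0 x1 y0 y1 : R) : x0 < x1 -> y0 < y1 ->
  (forall x y, x0 <= x <= x1 -> y0 <= y <= y1 -> exists l, hasD F (Complex x y) l) ->
  rint F x0 x1 y0 y1 = 0.
Proof.
move=> x01 y01 dF; have := @goursat _ F x0 y0 (x1 - x0) (y1 - y0).
rewrite (addrC x0) (addrC y0) !subrK !subr_gt0; exact.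
Qed.

(** The frame between the two rectangles is cut into two strips of full height and the two pieces
    below and above the inner rectangle; [goursat2] makes all four integrals vanish. *)
Lemma rint_strips F (x0 x1 y0 y1 p0 p1 q0 q1 : R) :
  x0 < p0 -> p0 < p1 -> p1 < x1 -> y0 < q0 -> q0 < q1 -> q1 < y1 ->
  (forall x y, x0 <= x <= x1 -> y0 <= y <= y1 ->
     [|| x <= p0, p1 <= x, y <= q0 | q1 <= y] -> exists l, hasD F (Complex x y) l) ->
  rint F x0 x1 y0 y1 = rint F p0 p1 q0 q1.
Proof.
move=> xp p01 px yq q01 qy dF.
have cF x y : x0 <= x <= x1 -> y0 <= y <= y1 ->
     [|| x <= p0, p1 <= x, y <= q0 | q1 <= y] -> ccont F (Complex x y).
  by move=> hx hy n; have [l /hasD_ccont] := dF x y hx hy n.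
have p0x : p0 < x1 by apply: lt_trans px.
have xp1 : x0 < p1 by apply: lt_trans p01.
have q0y : q0 < y1 by apply: lt_trans qy.
have yq1 : y0 < q1 by apply: lt_trans q01.
have xx : x0 < x1 by apply: lt_trans px.
have yy : y0 < y1 by apply: lt_trans qy.
have E1 : rint F x0 x1 y0 y1 = rint F x0 p0 y0 y1 + rint F p0 x1 y0 y1.
  apply: rint_splitx; first by rewrite !ltW.
  - by apply: ccont_hline => t tab; apply: cF; rewrite ?lexx ?(ltW yy) ?(ltW yq) ?orbT.
  - by apply: ccont_hline => t tab; apply: cF; rewrite ?lexx ?(ltW yy) ?(ltW qy) ?orbT.
have E2 : rint F p0 x1 y0 y1 = rint F p0 p1 y0 y1 + rint F p1 x1 y0 y1.
  apply: rint_splitx; first by rewrite !ltW.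
  - apply: ccont_hline => t /andP[t1 t2]; apply: cF; rewrite ?(le_trans (ltW xp) t1)//.
      by rewrite lexx ltW.
    by rewrite (ltW yq) !orbT.
  - apply: ccont_hline => t /andP[t1 t2]; apply: cF; rewrite ?(le_trans (ltW xp) t1)//.
      by rewrite lexx ltW.
    by rewrite (ltW qy) !orbT.
have E3 : rint F p0 p1 y0 y1 = rint F p0 p1 y0 q0 + rint F p0 p1 q0 y1.
  apply: rint_splity; first by rewrite !ltW.
  - by apply: ccont_vline => t tab; apply: cF => //; rewrite ?lexx// (ltW xp) (ltW p0x).
  - by apply: ccont_vline => t tab; apply: cF => //; rewrite ?lexx ?orbT// (ltW xp1) (ltW px).
have E4 : rint F p0 p1 q0 y1 = rint F p0 p1 q0 q1 + rint F p0 p1 q1 y1.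
  apply: rint_splity; first by rewrite !ltW.
  - apply: ccont_vline => t /andP[t1 t2]; apply: cF; rewrite ?lexx ?orbT//; first by rewrite !ltW.
    by rewrite (le_trans (ltW yq) t1).
  - apply: ccont_vline => t /andP[t1 t2]; apply: cF; rewrite ?lexx ?orbT//; first by rewrite !ltW.
    by rewrite (le_trans (ltW yq) t1).
rewrite E1 E2 E3 E4.
rewrite (goursat2 xp yy) ?(goursat2 px yy) ?(goursat2 p01 yq) ?(goursat2 p01 qy) ?add0r ?addr0//.
- move=> x y /andP[a b] /andP[c d]; apply: dF.
  + by rewrite (le_trans (ltW xp) a) (le_trans b (ltW px)).
  + by rewrite (le_trans (ltW yq1) c) d.
  + by rewrite c ?orbT.
- move=> x y /andP[a b] /andP[c d]; apply: dF.
  + by rewrite (le_trans (ltW xp) a) (le_trans b (ltW px)).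
  + by rewrite c (le_trans d (ltW q0y)).
  + by rewrite d ?orbT.
- move=> x y /andP[a b] /andP[c d]; apply: dF.
  + by rewrite (le_trans (ltW xp1) a) b.
  + by rewrite c d.
  + by rewrite a ?orbT.
- move=> x y /andP[a b] /andP[c d]; apply: dF.
  + by rewrite a (le_trans b (ltW p0x)).
  + by rewrite c d.
  + by rewrite b ?orbT.
Qed.

Lemma int_ratln (c v a b : R) : v != 0 -> a <= b ->
  \int[mu]_(x in `[a, b]) ((x - c) / ((x - c) ^+ 2 + v ^+ 2)) =
  2^-1 * ln ((b - c) ^+ 2 + v ^+ 2) - 2^-1 * ln ((a - c) ^+ 2 + v ^+ 2).
Proof.
move=> v0 ab.
have p0 (x : R) : 0 < (x - c) ^+ 2 + v ^+ 2 by rewrite ltr_wpDl ?sqr_ge0// exprn_even_gt0.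
have dG (x : R) : is_derive x 1 (fun x => 2^-1 * ln ((x - c) ^+ 2 + v ^+ 2))
   ((x - c) / ((x - c) ^+ 2 + v ^+ 2)).
  have d1 : is_derive x 1 (fun x : R => (x - c) ^+ 2 + v ^+ 2) ((x - c) *+ 2).
    by apply: is_derive_eq; rewrite /GRing.scale /=; ring.
  have d2 := @is_derive1_comp _ (@ln R) (fun x : R => (x - c) ^+ 2 + v ^+ 2) x _ _ (is_derive1_ln (p0 x)) d1.
  have := @is_deriveZ _ _ _ _ (2^-1) x 1 _ d2.
  move=> d3; apply: is_derive_eq; rewrite /GRing.scale /=; field; exact: lt0r_neq0.
apply: (Rint_ftc ab dG) => x.
apply: cvgM; first by apply: cvgB; [exact: cvg_id|exact: cvg_cst].
apply: cvgV; first exact: lt0r_neq0.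
apply: cvgD; last exact: cvg_cst.
by apply: cvgM; (apply: cvgB; [exact: cvg_id|exact: cvg_cst]).
Qed.

Lemma int_ratatan (c v a b : R) : v != 0 -> a <= b ->
  \int[mu]_(x in `[a, b]) (v / ((x - c) ^+ 2 + v ^+ 2)) =
  atan ((b - c) / v) - atan ((a - c) / v).
Proof.
move=> v0 ab.
have p0 (x : R) : 0 < (x - c) ^+ 2 + v ^+ 2 by rewrite ltr_wpDl ?sqr_ge0// exprn_even_gt0.
have dG (x : R) : is_derive x 1 (fun x => atan ((x - c) / v))
   (v / ((x - c) ^+ 2 + v ^+ 2)).
  have d1 : is_derive x 1 (fun x : R => (x - c) / v) v^-1.
    by apply: is_derive_eq; rewrite /GRing.scale /=; ring.
  have d2 := @is_derive1_comp _ (@atan R) (fun x : R => (x - c) / v) x _ _ (is_derive1_atan _) d1.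
  apply: is_derive_eq; field.
  by rewrite v0 andbT gt_eqF.
apply: (Rint_ftc ab dG) => x.
apply: cvgM; first exact: cvg_cst.
apply: cvgV; first exact: lt0r_neq0.
apply: cvgD; last exact: cvg_cst.
by apply: cvgM; (apply: cvgB; [exact: cvg_id|exact: cvg_cst]).
Qed.

(** These are the acute angles of a right triangle with legs [u] and [v]. In [rint_inv] every corner
    of the rectangle produces one such pair. *)
Lemma atanV2 (u v : R) : 0 < u -> 0 < v -> atan (u / v) + atan (v / u) = pi / 2.
Proof.
move=> u0 v0.
suff -> : atan (v / u) = pi / 2 - atan (u / v) by rewrite addrC subrK.
have uv0 : 0 < u / v by rewrite divr_gt0.
have a0 : 0 < atan (u / v) by rewrite -atan0 lt_atan.
have a1 := atan_ltpi2 (u / v).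
rewrite -[RHS]tanK; last by rewrite in_itv /=; apply/andP; split; lra.
congr atan; rewrite /tan.
rewrite sinB cosB sin_pihalf cos_pihalf !mul1r !mul0r subr0 add0r.
have := atanK (u / v); rewrite /tan => E.
have -> : v / u = (u / v)^-1 by rewrite invf_div.
by rewrite -[X in X^-1 = _]E invf_div.
Qed.

Definition twopii : R[i] := Complex 0 (2 * pi).

(** On each side the two parts of 1/(z - a) have a logarithm and an arctangent as primitives. The
    logarithms cancel at the corners, and the arctangents combine to pi/2 at each of the four
    corners. *)
Lemma rint_inv (a : R[i]) (x0 x1 y0 y1 : R) :
  x0 < complex.Re a < x1 -> y0 < complex.Im a < y1 ->
  rint (fun z => (z - a)^-1) x0 x1 y0 y1 = twopii.
Proof.
case: a => ax ay /= /andP[xa ax1] /andP[ya ay1].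
have xx := ltW (lt_trans xa ax1); have yy := ltW (lt_trans ya ay1).
have n1 : y0 - ay != 0 by rewrite subr_eq0 lt_eqF.
have n2 : y1 - ay != 0 by rewrite subr_eq0 gt_eqF.
have n3 : x0 - ax != 0 by rewrite subr_eq0 lt_eqF.
have n4 : x1 - ax != 0 by rewrite subr_eq0 gt_eqF.
have E1 v : v != 0 -> \int[mu]_(x in `[x0, x1]) complex.Re ((Complex x (v + ay) - Complex ax ay)^-1) =
   2^-1 * ln ((x1 - ax) ^+ 2 + v ^+ 2) - 2^-1 * ln ((x0 - ax) ^+ 2 + v ^+ 2).
  move=> v0; rewrite -int_ratln//; apply: eq_Rintegral => x _ /=.
  by rewrite addrK.
have E2 v : v != 0 -> \int[mu]_(x in `[x0, x1]) complex.Im ((Complex x (v + ay) - Complex ax ay)^-1) =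
   atan ((x1 - ax) / - v) - atan ((x0 - ax) / - v).
  move=> v0; rewrite -int_ratatan ?oppr_eq0//; apply: eq_Rintegral => x _ /=.
  by rewrite addrK sqrrN mulNr.
have E3 v : v != 0 -> \int[mu]_(y in `[y0, y1]) complex.Re ((Complex (v + ax) y - Complex ax ay)^-1) =
   atan ((y1 - ay) / v) - atan ((y0 - ay) / v).
  move=> v0; rewrite -int_ratatan//; apply: eq_Rintegral => x _ /=.
  by rewrite addrK addrC.
have E4 v : v != 0 -> \int[mu]_(y in `[y0, y1]) complex.Im ((Complex (v + ax) y - Complex ax ay)^-1) =
   - (2^-1 * ln ((y1 - ay) ^+ 2 + v ^+ 2) - 2^-1 * ln ((y0 - ay) ^+ 2 + v ^+ 2)).
  move=> v0; rewrite -int_ratln//.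
  transitivity (\int[mu]_(y in `[y0, y1]) (-1 * ((y - ay) / ((y - ay) ^+ 2 + v ^+ 2)))).
    by apply: eq_Rintegral => x _ /=; rewrite addrK mulN1r (addrC (v ^+ 2)).
  rewrite RintegralZl ?mulN1r//.
  apply: continuous_compact_integrable; first exact: segment_compact.
  apply: continuous_subspaceT => x.
  apply: cvgM; first by apply: cvgB; [exact: cvg_id|exact: cvg_cst].
  apply: cvgV; first by rewrite gt_eqF// ltr_wpDl ?sqr_ge0// exprn_even_gt0.
  apply: cvgD; last exact: cvg_cst.
  by apply: cvgM; (apply: cvgB; [exact: cvg_id|exact: cvg_cst]).
have := E1 _ n1; have := E1 _ n2; have := E2 _ n1; have := E2 _ n2.
have := E3 _ n3; have := E3 _ n4; have := E4 _ n3; have := E4 _ n4.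
rewrite !subrK /rint /cint /hline /vline => -> -> -> -> -> -> -> ->.
have at1 (u v : R) : 0 < u -> 0 < v -> atan (u / v) = pi / 2 - atan (v / u).
  by move=> u0 v0; rewrite -(atanV2 u0 v0) addrK.
have m1 : ay - y0 != 0 by rewrite subr_eq0 gt_eqF.
have m3 : ax - x0 != 0 by rewrite subr_eq0 gt_eqF.
have s1 : atan ((x1 - ax) / - (y0 - ay)) = pi / 2 + atan ((y0 - ay) / (x1 - ax)).
  by rewrite opprB at1 ?subr_gt0// -atanN; congr (_ + atan _); field.
have s2 : atan ((x0 - ax) / - (y0 - ay)) = - (pi / 2 - atan ((y0 - ay) / (x0 - ax))).
  rewrite (_ : (y0 - ay) / (x0 - ax) = (ay - y0) / (ax - x0)); last by field; rewrite m3.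
  rewrite -at1 ?subr_gt0// -atanN; congr atan; by field; rewrite m1.
have s3 : atan ((x1 - ax) / - (y1 - ay)) = - (pi / 2 - atan ((y1 - ay) / (x1 - ax))).
  by rewrite -at1 ?subr_gt0// -atanN; congr atan; field.
have s4 : atan ((x0 - ax) / - (y1 - ay)) = pi / 2 + atan ((y1 - ay) / (x0 - ax)).
  rewrite (_ : (x0 - ax) / - (y1 - ay) = (ax - x0) / (y1 - ay)); last by field.
  rewrite at1 ?subr_gt0// -atanN; congr (_ + atan _); by field; rewrite ?m3 ?n3.
rewrite s1 s2 s3 s4 /twopii; simpc.
rewrite !(addrC ((y0 - ay) ^+ 2)) !(addrC ((y1 - ay) ^+ 2)).
by congr Complex; field.
Qed.

(** [rint_strips] replaces the contour by a square of half-side [t] around [a], where a bounded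
    integrand contributes O(t). *)
Lemma rint_bounded_pole F a (x0 x1 y0 y1 d M : R) : 0 < d ->
  x0 < complex.Re a < x1 -> y0 < complex.Im a < y1 ->
  (forall x y, x0 <= x <= x1 -> y0 <= y <= y1 -> Complex x y != a -> exists l, hasD F (Complex x y) l) ->
  (forall z, cabs (z - a) < d -> cabs (F z) <= M) ->
  rint F x0 x1 y0 y1 = 0.
Proof.
case: a => ax ay /= d0 /andP[xa ax1] /andP[ya ay1] dF FM.
have M0 : 0 <= M by apply: le_trans (FM (Complex ax ay) _); rewrite ?cabs_ge0// subrr cabs0.
apply/eqP; rewrite -cabs_eq0 eq_le cabs_ge0 andbT.
apply/ler_addgt0Pr => e e0; rewrite add0r.
(* The distances to the sides keep the small square inside the rectangle, [d] keeps it where [F] is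
   bounded, and the last entry brings the final estimate below [e]. *)
pose m := Num.min (Num.min (ax - x0) (x1 - ax)) (Num.min (Num.min (ay - y0) (y1 - ay))
   (Num.min d (e / (16 * (M + 1))))).
have M1 : 0 < 16 * (M + 1) by rewrite mulr_gt0// ltr_wpDl.
have m0 : 0 < m by rewrite !lt_min !subr_gt0 xa ax1 ya ay1 d0 divr_gt0.
pose t := m / 2 / 2; have t0 : 0 < t by rewrite !divr_gt0.
have tm : t + t < m by rewrite /t -splitr ltr_pdivrMr// mulrDr mulr1 ltrDl.
have tm' : t < m by apply: lt_trans tm; rewrite ltrDl.
have := tm'; rewrite !lt_min -!andbA => /andP[t1 /andP[t2 /andP[t3 /andP[t4 _]]]].
have := tm; rewrite !lt_min -!andbA => /andP[_ /andP[_ /andP[_ /andP[_ /andP[td te]]]]].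
rewrite (@rint_strips F x0 x1 y0 y1 (ax - t) (ax + t) (ay - t) (ay + t)); [|lra|lra|lra|lra|lra|lra|]; last first.
  move=> x y hx hy n; apply: dF => //.
  by apply: contraTneq n => -[-> ->]; apply/negP => /or4P[]; lra.
apply: le_trans (_ : 4 * M * ((ax + t - (ax - t)) + (ay + t - (ay - t))) <= _).
  apply: rint_bound; [lra|lra| |].
    apply: bdcont_ccont; [lra|lra|] => -[x y] /and3P[/= hx hy hb].
    have [|||l /hasD_ccont //] := dF x y; [lra|lra|].
    apply/negP => /eqP [e1 e2]; move: hb; rewrite e1 e2 => /or4P[]/eqP; lra.
  move=> [x y] /and3P[/= hx hy hb]; apply: FM.
  apply: le_lt_trans td; apply: le_trans (cabs_le_ReIm _) _; simpc => /=.
  by apply: lerD; rewrite ler_norml; lra.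
have -> : 4 * M * (ax + t - (ax - t) + (ay + t - (ay - t))) = 8 * M * (t + t) by ring.
apply: le_trans (_ : 16 * (M + 1) * (t + t) <= _).
  by rewrite ler_wpM2r ?addr_ge0 ?ltW//; lra.
by rewrite mulrC -ler_pdivlMr// ltW.
Qed.

(** Once [f a] times [rint_inv] is subtracted, the integrand (f z - f a)/(z - a) is bounded near [a]
    by differentiability, so [rint_bounded_pole] applies. *)
Lemma cauchy_formula f a (x0 x1 y0 y1 : R) :
  x0 < complex.Re a < x1 -> y0 < complex.Im a < y1 ->
  (forall x y, x0 <= x <= x1 -> y0 <= y <= y1 -> exists l, hasD f (Complex x y) l) ->
  rint (fun z => f z * (z - a)^-1) x0 x1 y0 y1 = twopii * f a.
Proof.
move=> ha hb df.
have [xx yy] : x0 <= x1 /\ y0 <= y1 by lra.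
have pole : forall z, onbd x0 x1 y0 y1 z -> z != a.
  move=> z /and3P[/= _ _ hz]; apply: contraTneq hz => ->.
  by apply/negP => /or4P[]/eqP; lra.
have bi : bdcont (fun z => (z - a)^-1) x0 x1 y0 y1.
  by apply: bdcont_ccont => // z /pole za; exact: hasD_ccont (hasD_inv_sub za).
have bf : bdcont (fun z => f z * (z - a)^-1) x0 x1 y0 y1.
  apply: bdcont_ccont => // -[x y] zb; have /and3P[/= hx hy _] := zb.
  have [l dl] := df x y hx hy.
  exact: hasD_ccont (hasDM dl (hasD_inv_sub (pole _ zb))).
have -> : twopii * f a = rint (fun z => f a * (z - a)^-1) x0 x1 y0 y1.
  by rewrite rintZ// rint_inv// mulrC.
apply/eqP; rewrite -subr_eq0 -rintB//; last exact: bdcontZ.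
have [l dl] : exists l, hasD f a l.
  by case: a ha hb {pole bi bf} => ax ay /= ha hb; apply: df; lra.
have [d d0 Hd] := dl 1 ltr01.
apply/eqP; apply: (@rint_bounded_pole _ a _ _ _ _ d (1 + cabs l)) => //.
  move=> x y hx hy za; have [m dm] := df x y hx hy.
  eexists; apply: hasDB; first exact: (hasDM dm (hasD_inv_sub za)).
  exact: (hasDM (@hasD_cst _ (f a) _) (hasD_inv_sub za)).
move=> z zd; have [->|za] := eqVneq z a.
  by rewrite !subrr cabs0 addr_ge0 ?cabs_ge0.
have za' : 0 < cabs (z - a) by rewrite cabs_gt0 subr_eq0.
rewrite -mulrBl cabsM cabsV ler_pdivrMr//.
have := Hd _ zd; rewrite (addrC a) subrK => H.
rewrite -[f z - f a](subrK ((z - a) * l)); apply: le_trans (cabsD _ _) _.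
by rewrite [leRHS]mulrDl; apply: lerD => //; rewrite cabsM mulrC.
Qed.

End Cauchy.

(** * Taylor remainders from Cauchy's formula on squares *)

Section Estimates.
Variable R : realType.
Implicit Types (f F G : R[i] -> R[i]) (a b z h : R[i]).

Lemma twopii_ge4 : 4 <= cabs (twopii R).
Proof.
rewrite /twopii /cabs /= expr0n /= add0r sqrtr_sqr ger0_norm ?mulr_ge0 ?pi_ge0//.
have := @pi_ge2 R; lra.
Qed.

Lemma twopii_neq0 : twopii R != 0.
Proof. by rewrite -cabs_gt0; apply: lt_le_trans twopii_ge4. Qed.

Lemma onbd_dist a (d : R) z :
  onbd (complex.Re a - d) (complex.Re a + d) (complex.Im a - d) (complex.Im a + d) z ->
  d <= cabs (z - a) <= 2 * d.
Proof.
case: a z => ax ay [x y] /and3P[/= hx hy hb]; apply/andP; split.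
  have h1 := cabs_Re (Complex x y - Complex ax ay).
  have h2 := cabs_Im (Complex x y - Complex ax ay).
  case/or4P: hb => /eqP e; [apply: le_trans h1|apply: le_trans h1|apply: le_trans h2|apply: le_trans h2];
    rewrite /= e ler_normr; apply/orP; [right|left|right|left]; lra.
apply: (le_trans (cabs_le_ReIm (Complex x y - Complex ax ay))); rewrite mulr_natl mulr2n /=.
by apply: lerD; rewrite ler_norml; lra.
Qed.

Definition sqint f a (d : R) :=
  rint f (complex.Re a - d) (complex.Re a + d) (complex.Im a - d) (complex.Im a + d).

Lemma sqint_bound f a (d B : R) : 0 < d ->
  (forall z, d <= cabs (z - a) <= 2 * d -> ccont f z) ->
  (forall z, d <= cabs (z - a) <= 2 * d -> cabs (f z) <= B) ->
  cabs ((twopii R)^-1 * sqint f a d) <= 4 * B * d.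
Proof.
move=> d0 cf fB.
have x01 : complex.Re a - d <= complex.Re a + d by lra.
have y01 : complex.Im a - d <= complex.Im a + d by lra.
have bf : bdcont f (complex.Re a - d) (complex.Re a + d) (complex.Im a - d) (complex.Im a + d).
  by apply: bdcont_ccont => // z /onbd_dist; exact: cf.
have : cabs (sqint f a d) <= 4 * B * (complex.Re a + d - (complex.Re a - d) + (complex.Im a + d - (complex.Im a - d))).
  by apply: rint_bound => // z /onbd_dist; exact: fB.
have -> : complex.Re a + d - (complex.Re a - d) + (complex.Im a + d - (complex.Im a - d)) = 4 * d by ring.
move=> H; rewrite cabsM cabsV mulrC ler_pdivrMr; last by rewrite cabs_gt0 twopii_neq0.
apply: le_trans H _.
have B0 : 0 <= B.
  apply: le_trans (cabs_ge0 (f (a + d%:C%C))) (fB _ _).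
  by rewrite addrC addKr cabs_real gtr0_norm// lexx /=; lra.
have -> : 4 * B * (4 * d) = 4 * B * d * 4 by ring.
by rewrite ler_wpM2l ?twopii_ge4// mulr_ge0 ?mulr_ge0// ltW.
Qed.

Variables (f : R[i] -> R[i]) (a : R[i]) (d M : R).
Hypothesis d0 : 0 < d.
Hypothesis df : forall z, cabs (z - a) <= 2 * d -> exists l, hasD f z l.
Hypothesis fM : forall z, cabs (z - a) <= 2 * d -> cabs (f z) <= M.

Let pole b z : cabs (b - a) <= 3 / 4 * d -> d <= cabs (z - a) -> d / 4 <= cabs (z - b).
Proof. move=> bd zd; have := cabs_subD z b a; move: (d0); lra. Qed.

Let M0 : 0 <= M.
Proof. by apply: le_trans (cabs_ge0 _) (fM (z := a) _); rewrite subrr cabs0 mulr_ge0// ltW. Qed.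

(** Cauchy's integral with kernel (z - b)^-k. For k = 1, 2, 3 it turns out to be f(b), f'(b) and
    f''(b)/2: the index is one more than the order of the Taylor coefficient. The contour stays
    centred at [a] while [b] varies. *)
Definition ccoef (k : nat) b := (twopii R)^-1 * sqint (fun z => f z * (z - b) ^- k) a d.

Lemma hasD_invX b z (k : nat) : z != b -> exists l, hasD (fun w => (w - b) ^- k) z l.
Proof.
move=> zb; elim: k => [|k [l IH]].
  by exists 0 => e e0; exists 1 => // h _; rewrite !expr0 subrr mulr0 subr0 cabs0 mulr_ge0 ?cabs_ge0 ?ltW.
have := hasDM (hasD_inv_sub zb) IH.
have -> : (fun w => (w - b)^-1 * (w - b) ^- k) = (fun w => (w - b) ^- k.+1).
  by apply/funext => w; rewrite exprS invfM.
by move=> H; eexists; exact: H.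
Qed.

Let neb b z : cabs (b - a) <= 3 / 4 * d -> d <= cabs (z - a) -> z != b.
Proof.
move=> bd zd; rewrite -subr_eq0 -cabs_gt0; apply: lt_le_trans (pole bd zd).
by rewrite divr_gt0.
Qed.

Let cf k b z : cabs (b - a) <= 3 / 4 * d -> d <= cabs (z - a) <= 2 * d ->
  ccont (fun z => f z * (z - b) ^- k) z.
Proof.
move=> bd /andP[zd zd2]; have [l dl] := df zd2.
have [m dm] := hasD_invX k (neb bd zd); exact: hasD_ccont (hasDM dl dm).
Qed.

Let bcf k b : cabs (b - a) <= 3 / 4 * d ->
  bdcont (fun z => f z * (z - b) ^- k) (complex.Re a - d) (complex.Re a + d)
   (complex.Im a - d) (complex.Im a + d).
Proof.
move=> bd; apply: bdcont_ccont; [(move: (d0); lra)|(move: (d0); lra)|].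
by move=> z /onbd_dist; exact: cf.
Qed.

Lemma ccoef1 b : cabs (b - a) <= 3 / 4 * d -> f b = ccoef 1 b.
Proof.
move=> bd; rewrite /ccoef /sqint.
have := cabs_Re (b - a); have := cabs_Im (b - a).
have -> : complex.Re (b - a) = complex.Re b - complex.Re a by case: (a); case: (b).
have -> : complex.Im (b - a) = complex.Im b - complex.Im a by case: (a); case: (b).
rewrite !ler_norml => hi hr.
rewrite (_ : (fun z => f z * (z - b) ^- 1) = (fun z => f z * (z - b)^-1)); last first.
  by apply/funext => z; rewrite expr1.
rewrite cauchy_formula ?mulKf ?twopii_neq0//; [(move: (d0); lra)|(move: (d0); lra)|].
move=> x y hx hy; apply: df; apply: le_trans (cabs_le_ReIm _) _.
case: (a) hx hy => ax ay /= hx hy; rewrite mulr_natl mulr2n.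
by apply: lerD; rewrite ler_norml; (move: (d0); lra).
Qed.

Lemma ccoef_bound k b : cabs (b - a) <= 3 / 4 * d ->
  cabs (ccoef k b) <= 4 * (M * (4 / d) ^+ k) * d.
Proof.
move=> bd; apply: sqint_bound => //; first by move=> z; exact: cf.
move=> z /andP[zd zd2]; rewrite cabsM; apply: ler_pM; rewrite ?cabs_ge0 ?fM//.
rewrite cabsV cabsX -exprVn lerXn2r ?nnegrE ?invr_ge0 ?cabs_ge0//.
  by rewrite divr_ge0// ltW.
have := pole bd zd => H.
rewrite -[4 / d]invf_div lef_pV2 ?posrE ?divr_gt0//.
by apply: lt_le_trans H; rewrite divr_gt0.
Qed.

(** A Taylor remainder of a Cauchy integral is the integral of [f] against the remainder of the
    kernel; with u = z - b, [g] is that remainder. The contour is at distance at least [d] from [a]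
    and both [b] and [b + h] are within 3d/4, which explains the d/4. *)
Lemma cauchy_bound3 (g : R[i] -> R[i]) b h (k0 k1 k2 : nat) (c1 c2 : R[i]) (B : R) :
  cabs (b - a) <= d / 2 -> cabs h <= d / 4 ->
  (forall u, u != 0 -> u - h != 0 -> (u - h) ^- k0 - c1 * u ^- k1 - c2 * u ^- k2 = g u) ->
  (forall u, d / 4 <= cabs u -> d / 4 <= cabs (u - h) -> cabs (g u) <= B) ->
  cabs (ccoef k0 (b + h) - c1 * ccoef k1 b - c2 * ccoef k2 b) <= 4 * (M * B) * d.
Proof.
move=> bd hd gE gB.
have bd' : cabs (b - a) <= 3 / 4 * d by (move: (d0); lra).
have bhd : cabs (b + h - a) <= 3 / 4 * d.
  by rewrite addrAC; apply: le_trans (cabsD _ _) _; (move: (d0); lra).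
set K := fun z => f z * (z - (b + h)) ^- k0 - c1 * (f z * (z - b) ^- k1) - c2 * (f z * (z - b) ^- k2).
have -> : ccoef k0 (b + h) - c1 * ccoef k1 b - c2 * ccoef k2 b = (twopii R)^-1 * sqint K a d.
  rewrite /sqint /K rintB ?rintB ?rintZ //; try exact: bdcontZ (bcf _ bd'); try exact: bcf.
    by rewrite /ccoef /sqint; ring.
  have -> : (fun z => f z * (z - (b + h)) ^- k0 - c1 * (f z * (z - b) ^- k1)) =
      (fun z => f z * (z - (b + h)) ^- k0 + (- c1) * (f z * (z - b) ^- k1)).
    by apply/funext => z; rewrite mulNr.
  by apply: bdcontD; [exact: bcf|exact: bdcontZ (bcf _ bd')].
have KE z : d <= cabs (z - a) -> K z = f z * g (z - b).
  move=> zd; rewrite /K -gE ?subr_eq0 ?(neb bd' zd)//; last first.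
    by rewrite subr_eq (addrC h) (neb bhd zd).
  by rewrite opprD addrA; ring.
apply: sqint_bound => //.
  move=> z zd; rewrite /K.
  have c1' := cf k0 bhd zd; have c2' := cf k1 bd' zd; have c3' := cf k2 bd' zd.
  have /andP[zd1 zd2] := zd; have [l dl] := df zd2.
  have [m0 dm0] := hasD_invX k0 (neb bhd zd1).
  have [m1 dm1] := hasD_invX k1 (neb bd' zd1).
  have [m2 dm2] := hasD_invX k2 (neb bd' zd1).
  apply: hasD_ccont; apply: hasDB; first apply: hasDB.
  - exact: (hasDM dl dm0).
  - exact: (hasDM (@hasD_cst _ c1 z) (hasDM dl dm1)).
  - exact: (hasDM (@hasD_cst _ c2 z) (hasDM dl dm2)).
move=> z /andP[zd1 zd2]; rewrite KE// cabsM; apply: ler_pM; rewrite ?cabs_ge0 ?fM//.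
apply: gB; first exact: pole.
by rewrite -addrA -opprD; exact: pole.
Qed.

Lemma invr_bound (u : R[i]) : d / 4 <= cabs u -> cabs u^-1 <= 4 / d.
Proof.
move=> ud; rewrite cabsV -[4 / d]invf_div lef_pV2 ?posrE ?divr_gt0//.
by apply: lt_le_trans ud; rewrite divr_gt0.
Qed.

Lemma taylor2 b h : cabs (b - a) <= d / 2 -> cabs h <= d / 4 ->
  cabs (f (b + h) - f b - h * ccoef 2 b) <= 256 * M * cabs h ^+ 2 / d ^+ 2.
Proof.
move=> bd hd.
have bd' : cabs (b - a) <= 3 / 4 * d by (move: (d0); lra).
have bhd : cabs (b + h - a) <= 3 / 4 * d.
  by rewrite addrAC; apply: le_trans (cabsD _ _) _; lra.
rewrite (ccoef1 bd') (ccoef1 bhd).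
(* 1/(u - h) - 1/u - h/u^2 = h^2 / (u^2 (u - h)). Three factors of modulus at most 4/d, together
   with the 4 of [sqint_bound], give 256. *)
have := @cauchy_bound3 (fun u => h ^+ 2 * (u^-1 ^+ 2 * (u - h)^-1)) b h 1 1 2 1 h (cabs h ^+ 2 * ((4 / d) ^+ 2 * (4 / d))) bd hd.
rewrite mul1r => H; apply: le_trans (H _ _) _.
- by move=> u u0 uh; field; rewrite u0 uh.
- move=> u ud uhd; rewrite cabsM cabsX ler_wpM2l ?exprn_ge0 ?cabs_ge0// cabsM cabsX.
  apply: ler_pM; rewrite ?exprn_ge0 ?cabs_ge0 ?invr_bound//.
  by rewrite lerXn2r ?nnegrE ?cabs_ge0 ?invr_bound// divr_ge0// ltW.
- by apply: eqW; field; rewrite gt_eqF.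
Qed.

Lemma hasD_ccoef b : cabs (b - a) <= d / 2 -> hasD f b (ccoef 2 b).
Proof.
move=> bd; apply: (@hasD_sq _ _ _ _ (256 * M / d ^+ 2) (d / 4)); first by rewrite divr_gt0.
move=> h /ltW hd; apply: le_trans (taylor2 bd hd) _.
by rewrite mulrAC.
Qed.

Lemma hasD_ccoef2 b : cabs (b - a) <= d / 2 -> hasD (ccoef 2) b (2 * ccoef 3 b).
Proof.
move=> bd.
apply: (@hasD_sq _ _ _ _ (4 * (M * (3 * (4 / d) ^+ 4 + d / 4 * (4 / d) ^+ 5)) * d) (d / 4)); first by rewrite divr_gt0.
move=> h /ltW hd.
(* The remainder of (u - h)^-2 is h^2 (3u - 2h) / (u^3 (u - h)^2); writing 3u - 2h as 3(u - h) + h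
   gives the two summands. *)
have := @cauchy_bound3 (fun u => h ^+ 2 * (3 * (u^-1 ^+ 3 * (u - h)^-1) + h * (u^-1 ^+ 3 * (u - h)^-1 ^+ 2)))
   b h 2 2 3 1 (2 * h) (cabs h ^+ 2 * (3 * (4 / d) ^+ 4 + d / 4 * (4 / d) ^+ 5)) bd hd.
rewrite mul1r (_ : h * (2 * ccoef 3 b) = 2 * h * ccoef 3 b); last by ring.
move=> H; apply: le_trans (H _ _) _.
- by move=> u u0 uh; field; rewrite u0 uh.
- move=> u ud uhd; rewrite !(cabsM, cabsX) ler_wpM2l ?exprn_ge0 ?cabs_ge0//.
  have q0 : 0 <= 4 / d by rewrite divr_ge0// ltW.
  have P (x y : R[i]) k l : d / 4 <= cabs x -> d / 4 <= cabs y ->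
     cabs (x^-1 ^+ k * y^-1 ^+ l) <= (4 / d) ^+ (k + l).
    move=> xd yd; rewrite cabsM !cabsX exprD; apply: ler_pM; rewrite ?exprn_ge0 ?cabs_ge0//;
      by rewrite lerXn2r ?nnegrE ?cabs_ge0 ?invr_bound.
  apply: le_trans (cabsD _ _) _; rewrite !(cabsM 3, cabsM h).
  have -> : cabs 3 = 3 :> R.
    by rewrite -[3 in LHS](rmorph_nat (real_complex R)) cabs_real ger0_norm.
  apply: lerD; first by rewrite ler_wpM2l//; exact: (P _ _ 3 1)%N.
  by apply: ler_pM; rewrite ?cabs_ge0//; exact: (P _ _ 3 2)%N.
- by apply: eqW; ring.
Qed.

End Estimates.

(** * Cauchy estimates and mean value inequalities on the disk *)

Section Disk.
Variable R : realType.
Implicit Types (f g : R[i] -> R[i]) (a b z h v : R[i]).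

Lemma disk_ball a z : cabs (z - a) < 1 - cabs a -> disk z.
Proof. by rewrite /disk /=; have := cabsD (z - a) a; rewrite subrK; lra. Qed.

(** Near each point [cD f] coincides with the Cauchy integral [ccoef f a d 2], whose derivative is
    known. Continuity of [f] at [a] supplies the local bound on which the estimates rest. *)
Lemma holo_cD f : holo f -> holo (cD f).
Proof.
move=> fh a da.
have [e e0 He] := hasD_cont (holo_hasD fh da) ltr01.
have da' : 0 < 1 - cabs a by move: da; rewrite /disk /=; lra.
pose d := Num.min e (1 - cabs a) / 4.
have m0 : 0 < Num.min e (1 - cabs a) by rewrite lt_min e0.
have d0 : 0 < d by rewrite divr_gt0.
have dm : 2 * d < Num.min e (1 - cabs a) by rewrite /d; lra.
move: dm; rewrite lt_min => /andP[de dd].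
have din z : cabs (z - a) <= 2 * d -> disk z by move=> zd; apply: (@disk_ball a); lra.
have df z : cabs (z - a) <= 2 * d -> exists l, hasD f z l.
  by move=> /din dz; exists (cD f z); exact: holo_hasD.
have fM z : cabs (z - a) <= 2 * d -> cabs (f z) <= 1 + cabs (f a).
  move=> zd; have ze : cabs (z - a) < e by lra.
  have := He _ ze; have := cabsD (f z - f a) (f a); rewrite subrK; lra.
have a0 : cabs (a - a) <= d / 2 by rewrite subrr cabs0 divr_ge0// ltW.
have [] // := hasD_deriv (f := cD f) (z := a) (l := 2 * ccoef f a d 3 a).
apply: (hasD_local (r := d / 2) _ _ (hasD_ccoef2 d0 df fM a0)); first by rewrite divr_gt0.
move=> w /ltW wd; apply/esym/hasD_cD; exact: (hasD_ccoef d0 df fM wd).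
Qed.

(** The constants are 64 = 4 * 4^2 and 256 = 4 * 4^3, from kernels of order 2 and 3. In the
    Lipschitz bound |h| <= d/4 turns the quadratic term into another 64, whence 128. *)
Lemma cauchy_estimates f a (d M : R) : holo f -> 0 < d -> 2 * d < 1 - cabs a ->
  (forall z, cabs (z - a) <= 2 * d -> cabs (f z) <= M) ->
  [/\ cabs (cD f a) <= 64 * M / d,
      (forall h, cabs h <= d / 4 -> cabs (f (a + h) - f a) <= 128 * M * cabs h / d) &
      forall h, cabs h <= d / 4 ->
        cabs (f (a + h) - f a - h * cD f a) <= 256 * M * cabs h ^+ 2 / d ^+ 2].
Proof.
move=> fh d0 dd fM.
have df z : cabs (z - a) <= 2 * d -> exists l, hasD f z l.
  move=> zd; have dz : disk z by apply: (@disk_ball a); lra.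
  by exists (cD f z); exact: holo_hasD.
have a0 : cabs (a - a) <= d / 2 by rewrite subrr cabs0 divr_ge0// ltW.
have a1 : cabs (a - a) <= 3 / 4 * d by rewrite subrr cabs0 mulr_ge0// ltW.
have E := hasD_cD (hasD_ccoef d0 df fM a0).
have B := ccoef_bound d0 df fM 2 a1; rewrite -E in B.
have M0 : 0 <= M by apply: le_trans (cabs_ge0 _) (fM a _); rewrite subrr cabs0; lra.
have B' : cabs (cD f a) <= 64 * M / d.
  apply: le_trans B _; apply: eqW; field.
  by rewrite gt_eqF.
have T h : cabs h <= d / 4 ->
        cabs (f (a + h) - f a - h * cD f a) <= 256 * M * cabs h ^+ 2 / d ^+ 2.
  by move=> hd; rewrite E; exact: taylor2.
split => // h hd.
rewrite -[f (a + h) - f a](subrK (h * cD f a)); apply: le_trans (cabsD _ _) _.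
rewrite cabsM; apply: le_trans (lerD (T _ hd) (ler_wpM2l (cabs_ge0 h) B')) _.
have -> : 128 * M * cabs h / d = 256 * M * (cabs h * (d / 4)) / d ^+ 2 + cabs h * (64 * M / d).
  by field; rewrite gt_eqF.
rewrite lerD2r ler_wpM2r ?invr_ge0 ?exprn_ge0 ?(ltW d0)// ler_wpM2l ?mulr_ge0//.
by rewrite expr2 ler_wpM2l ?cabs_ge0.
Qed.

Lemma is_derive_eps (F : R -> R) (x l : R) :
  (forall e : R, 0 < e -> exists2 d : R, 0 < d &
    forall h : R, `|h| < d -> `|F (x + h) - F x - h * l| <= e * `|h|) ->
  is_derive x 1 F l.
Proof.
move=> Fl.
have H : (fun h : R => h^-1 *: ((F \o shift x) (h *: (1 : R)) - F x)) @ (0 : R)^' --> (l : R).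
  apply/cvgrPdist_le => e e0; have [d d0 Fd] := Fl e e0.
  rewrite near_withinE; apply: filterS (nbhsx_ballx 0 d d0) => h.
  rewrite /ball /= sub0r normrN => hd h0; have := Fd _ hd.
  rewrite /= /shift /= /GRing.scale /= mulr1 (addrC h) -ler_pdivrMr ?normr_gt0//.
  rewrite -normfV -normrM distrC; congr (_ <= _); congr Num.norm; field; exact: h0.
apply: DeriveDef; first by apply/cvg_ex; exists l; exact: H.
by apply: (@cvg_lim R); [exact: norm_hausdorff|exact: H].
Qed.

(** [p] stands for a real-linear functional: in use, plus or minus the real or imaginary part. *)
Lemma seg_derive (p : R[i] -> R) f a v l (t : R) :
  (forall z w, p (z + w) = p z + p w) -> (forall (s : R) z, p (s%:C%C * z) = s * p z) ->
  (forall z, `|p z| <= cabs z) ->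
  hasD f (a + t%:C%C * v) l ->
  is_derive t 1 (fun t : R => p (f (a + t%:C%C * v))) (p (v * l)).
Proof.
move=> pD pZ pb fl; apply: is_derive_eps => e e0.
have v0 : 0 < cabs v + 1 by rewrite ltr_wpDl ?cabs_ge0.
have [d d0 H] := fl (e / (cabs v + 1)) (divr_gt0 e0 v0).
exists (d / (cabs v + 1)); first by rewrite divr_gt0.
move=> h hd.
have hvd : cabs (h%:C%C * v) < d.
  rewrite cabsM cabs_real; move: hd; rewrite ltr_pdivlMr// => /(le_lt_trans _); apply.
  by rewrite ler_wpM2l// lerDl.
have pB z w : p (z - w) = p z - p w.
  rewrite pD; congr (_ + _); rewrite (_ : - w = (-1)%:C%C * w); first by rewrite pZ mulN1r.
  by rewrite rmorphN rmorph1 mulN1r.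
have := H _ hvd; rewrite (_ : a + t%:C%C * v + h%:C%C * v = a + (t + h)%:C%C * v); last first.
  by rewrite rmorphD mulrDl addrA.
move=> Hh.
rewrite -pZ -pB -pB mulrA; apply: le_trans (pb _) _; apply: le_trans Hh _.
rewrite cabsM cabs_real (_ : _ * _ = e * `|h| * (cabs v / (cabs v + 1))); last by ring.
rewrite ler_piMr ?mulr_ge0 ?(ltW e0)// ler_pdivrMr// mul1r lerDl//.
Qed.

(** The mean value theorem is real, so it is applied to plus and minus the real and imaginary parts
    of [f] minus the majorant [m], which costs a factor 2. A varying [m] accommodates derivative
    bounds that degenerate along the segment, as in [bloch_of_deriv2]. *)
Lemma cmvt f (f' : R[i] -> R[i]) a v (m m' : R -> R) :
  (forall t : R, 0 <= t <= 1 -> hasD f (a + t%:C%C * v) (f' (a + t%:C%C * v))) ->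
  (forall t : R, 0 <= t <= 1 -> is_derive t 1 m (m' t)) ->
  (forall t : R, 0 <= t <= 1 -> cabs (v * f' (a + t%:C%C * v)) <= m' t) ->
  cabs (f (a + v) - f a) <= 2 * (m 1 - m 0).
Proof.
move=> fd md fm.
have key (p : R[i] -> R) : (forall z w, p (z + w) = p z + p w) ->
    (forall (s : R) z, p (s%:C%C * z) = s * p z) -> (forall z, `|p z| <= cabs z) ->
    p (f (a + v)) - p (f a) <= m 1 - m 0.
  move=> pD pZ pb.
  pose G (t : R) := p (f (a + t%:C%C * v)) - m t.
  have dG (t : R) : 0 <= t <= 1 -> is_derive t 1 G (p (v * f' (a + t%:C%C * v)) - m' t).
    move=> t01; have h1 := seg_derive pD pZ pb (fd t t01); have h2 := md t t01.
    exact: is_deriveB.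
  have cG : {within `[0, 1], continuous G}.
    apply: derivable_within_continuous => t; rewrite in_itv/= => t01.
    by have [] := dG t t01.
  have [|c c01] := @MVT_segment _ G (fun t => p (v * f' (a + t%:C%C * v)) - m' t) 0 1 ler01 _ cG.
    by move=> t; rewrite in_itv/= => /andP[t0 t1]; apply: dG; rewrite !ltW.
  move: c01; rewrite in_itv/= => c01.
  rewrite subr0 mulr1 /G rmorph1 mul1r rmorph0 mul0r addr0 => E.
  have : p (v * f' (a + c%:C%C * v)) <= m' c.
    by apply: le_trans (ler_norm _) _; apply: le_trans (pb _) _; exact: fm.
  lra.
have k1 := key (fun z => complex.Re z).
have k2 := key (fun z => - complex.Re z).
have k3 := key (fun z => complex.Im z).
have k4 := key (fun z => - complex.Im z).
apply: le_trans (cabs_le_ReIm _) _.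
have -> : complex.Re (f (a + v) - f a) = complex.Re (f (a + v)) - complex.Re (f a).
  by case: (f (a + v)) => ? ?; case: (f a).
have -> : complex.Im (f (a + v) - f a) = complex.Im (f (a + v)) - complex.Im (f a).
  by case: (f (a + v)) => ? ?; case: (f a).
rewrite mulr_natl mulr2n; apply: lerD; rewrite ler_norml.
  have := k1 _ _ (@cabs_Re R).
  have := k2 _ _ _.
  move=> h2 h1; have {}h1 : complex.Re (f (a + v)) - complex.Re (f a) <= m 1 - m 0.
    by apply: h1; [case=> ? ? [? ?]//|move=> s [? ?] /=; rewrite mul0r subr0].
  have {}h2 : - complex.Re (f (a + v)) - - complex.Re (f a) <= m 1 - m 0.
    apply: h2; [case=> ? ? [? ?] /=; exact: opprD|move=> s [? ?] /=; by rewrite mul0r subr0 mulrN|].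
    by move=> z; rewrite normrN; exact: cabs_Re.
  lra.
have := k3 _ _ (@cabs_Im R).
have := k4 _ _ _.
move=> h2 h1; have {}h1 : complex.Im (f (a + v)) - complex.Im (f a) <= m 1 - m 0.
  by apply: h1; [case=> ? ? [? ?]//|move=> s [? ?] /=; rewrite mul0r addr0].
have {}h2 : - complex.Im (f (a + v)) - - complex.Im (f a) <= m 1 - m 0.
  apply: h2; [case=> ? ? [? ?] /=; exact: opprD|move=> s [? ?] /=; by rewrite mul0r addr0 mulrN|].
  by move=> z; rewrite normrN; exact: cabs_Im.
lra.
Qed.

Lemma cmvt_const f a v (B : R) : holo f ->
  (forall t : R, 0 <= t <= 1 -> disk (a + t%:C%C * v)) ->
  (forall t : R, 0 <= t <= 1 -> cabs (cD f (a + t%:C%C * v)) <= B) ->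
  cabs (f (a + v) - f a) <= 2 * B * cabs v.
Proof.
move=> fh dt fB.
have := @cmvt f (cD f) a v (fun t => (cabs v * B) * t) (fun=> cabs v * B).
rewrite mulr1 mulr0 subr0 (mulrC (cabs v)) mulrA; apply.
- by move=> t t01; apply: holo_hasD => //; exact: dt.
- move=> t _; rewrite (_ : (fun t : R => B * cabs v * t) = ((B * cabs v) \*: (id : R -> R)))//.
  by apply: is_derive_eq; rewrite /GRing.scale /= mulr1.
- by move=> t t01; rewrite cabsM [leLHS]mulrC; apply: ler_wpM2r; rewrite ?cabs_ge0 ?fB.
Qed.

End Disk.

(* Any large enough constant would do. *)
HB.lock Definition cK (R : realType) : R := 4096.

(** * Bloch functions *)

Section Bloch.
Variable R : realType.
Notation cK := (cK R).
Implicit Types (f g : R[i] -> R[i]) (a b z w h v : R[i]) (C : R).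

Lemma cK_ge : 64 <= cK.
Proof. by rewrite cK.unlock ler_nat. Qed.

Lemma cK_lin : 2 * cK + 4 <= 7 * cK / 3.
Proof. have := cK_ge; lra. Qed.

Lemma cK_ge0 : 0 <= cK.
Proof. exact: le_trans cK_ge. Qed.

Lemma cabs_sub_conj a b : 1 - cabs b * cabs a <= cabs (1 - Num.conj b * a).
Proof.
by have := cabsDl 1 (- (Num.conj b * a)); rewrite cabs1 cabsN cabsM cabs_conj.
Qed.

(** Equivalently [rho a b] is at least |a - b| / (2(1 - |b|) + |a - b|): this is how Euclidean
    estimates are turned into estimates by [rho]. *)
Lemma sub_conj_le a b : disk b ->
  cabs (1 - Num.conj b * a) <= 2 * (1 - cabs b) + cabs (a - b).
Proof.
rewrite /disk /= => b1.
have -> : 1 - Num.conj b * a = (1 - cabs b ^+ 2)%:C%C - Num.conj b * (a - b).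
  by rewrite rmorphB rmorph1 /= -mul_conj; ring.
apply: le_trans (cabsD _ _) _; rewrite cabsN cabsM cabs_conj cabs_real.
have b0 := cabs_ge0 b; have ab0 := cabs_ge0 (a - b).
rewrite ger0_norm ?subr_ge0 ?expr_le1 ?(ltW b1)//.
apply: lerD; last by rewrite ler_piMl// ltW.
rewrite (_ : 1 - cabs b ^+ 2 = (1 + cabs b) * (1 - cabs b)); last by ring.
by rewrite ler_wpM2r; lra.
Qed.

Lemma sub_conj_gt0 a b : disk a -> disk b -> 0 < cabs (1 - Num.conj b * a).
Proof.
rewrite /disk /= => a1 b1; apply: lt_le_trans (cabs_sub_conj _ _).
rewrite subr_gt0; apply: le_lt_trans a1.
by rewrite ler_piMl ?cabs_ge0// ltW.
Qed.

Lemma rhoE a b : rho a b = cabs (a - b) / cabs (1 - Num.conj b * a).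
Proof. by rewrite /rho cabsM cabsV. Qed.

Lemma rho_ge0 a b : 0 <= rho a b.
Proof. exact: cabs_ge0. Qed.

Definition blochC C f := holo f /\ forall z, disk z -> cabs (cD f z) * (1 - cabs z ^+ 2) <= C.

Lemma disk_sq z : disk z -> 0 < 1 - cabs z ^+ 2.
Proof. by rewrite /disk /= => z1; rewrite subr_gt0 expr_lt1 ?cabs_ge0. Qed.

Lemma disk_sq_ge z : disk z -> 1 - cabs z <= 1 - cabs z ^+ 2.
Proof.
rewrite /disk /= => z1; have z0 := cabs_ge0 z.
by rewrite lerD2l lerN2 expr2 ler_piMl// ltW.
Qed.

Lemma disk_sq_le z : disk z -> 1 - cabs z ^+ 2 <= 2 * (1 - cabs z).
Proof.
rewrite /disk /= => z1; have z0 := cabs_ge0 z.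
rewrite (_ : 1 - cabs z ^+ 2 = (1 + cabs z) * (1 - cabs z)); last by ring.
by rewrite ler_wpM2r; lra.
Qed.

Lemma disk0 : disk (0 : R[i]).
Proof. by rewrite /disk /mkset cabs0 ltr01. Qed.

Lemma blochC_ge0 C f : blochC C f -> 0 <= C.
Proof.
move=> [_ H]; apply: le_trans (H 0 _); last exact: disk0.
by rewrite mulr_ge0 ?cabs_ge0// cabs0 expr0n /= subr0.
Qed.

Lemma blochC_le C f z : blochC C f -> disk z -> cabs (cD f z) <= C / (1 - cabs z).
Proof.
move=> fC dz; rewrite ler_pdivlMr; last by move: dz; rewrite /disk /=; lra.
by apply: le_trans (fC.2 z dz); rewrite ler_wpM2l ?cabs_ge0 ?disk_sq_ge.
Qed.

Lemma blochC_near C f b z : blochC C f -> disk b -> cabs (z - b) <= (1 - cabs b) / 8 ->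
  cabs (cD f z) <= 2 * C / (1 - cabs b).
Proof.
move=> fC db zb; have C0 := blochC_ge0 fC.
have b1 : 0 < 1 - cabs b by move: db; rewrite /disk /=; lra.
have := cabsD (z - b) b; rewrite subrK => zz.
have dz : disk z by rewrite /disk /=; lra.
apply: le_trans (blochC_le fC dz) _.
rewrite ler_pdivrMr; last by move: dz; rewrite /disk /=; lra.
rewrite (_ : 2 * C / (1 - cabs b) * (1 - cabs z) = C * (2 * (1 - cabs z) / (1 - cabs b))); last by ring.
rewrite ler_peMr// ler_pdivlMr// mul1r; lra.
Qed.

Lemma blochC_deriv_lip C f b h : blochC C f -> disk b -> cabs h <= (1 - cabs b) / 64 ->
  cabs (cD f (b + h) - cD f b) <= cK * C * cabs h / (1 - cabs b) ^+ 2.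
Proof.
move=> fC db hb.
have b1 : 0 < 1 - cabs b by move: db; rewrite /disk /=; lra.
have [] := @cauchy_estimates _ (cD f) b ((1 - cabs b) / 16) (2 * C / (1 - cabs b)) (holo_cD fC.1).
- by rewrite divr_gt0.
- lra.
- by move=> z zb; apply: blochC_near; [exact: fC|exact: db|lra].
move=> _ H _; apply: le_trans (H _ _) _; first by lra.
(* 128 * 2 * 16 = 4096: this is the constraint that fixes the value of [cK]. *)
rewrite cK.unlock; by apply: eqW; field; rewrite gt_eqF.
Qed.

Lemma blochC_lip C f b z : blochC C f -> disk b -> cabs (z - b) <= (1 - cabs b) / 8 ->
  cabs (f z - f b) <= 4 * C / (1 - cabs b) * cabs (z - b).
Proof.
move=> fC db zb.
have b1 : 0 < 1 - cabs b by move: db; rewrite /disk /=; lra.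
have seg (t : R) : 0 <= t <= 1 -> cabs (b + t%:C%C * (z - b) - b) <= (1 - cabs b) / 8.
  move=> /andP[t0 t1]; rewrite addrC addKr cabsM cabs_real ger0_norm//.
  by apply: le_trans zb; rewrite ler_piMl ?cabs_ge0.
have := @cmvt_const _ f b (z - b) (2 * C / (1 - cabs b)) fC.1.
rewrite (addrC b) subrK => H; apply: le_trans (H _ _) _.
- by move=> t /seg h; apply: (@disk_ball _ b); lra.
- by move=> t /seg h; exact: blochC_near.
- by apply: eqW; ring.
Qed.

(** Subtracting [f b] leaves a function of size at most C/2 on a ball of radius comparable to 1 -
    |b|, so the remainder depends on [C] but not on the size of [f]. Montel's theorem uses this
    uniformity. *)
Lemma blochC_taylor C f b h : blochC C f -> disk b -> cabs h <= (1 - cabs b) / 64 ->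
  cabs (f (b + h) - f b - h * cD f b) <= 16 * cK * C * cabs h ^+ 2 / (1 - cabs b) ^+ 2.
Proof.
move=> fC db hb.
have b1 : 0 < 1 - cabs b by move: db; rewrite /disk /=; lra.
pose g := fun z => f z - f b.
have gh : holo g.
  apply: (@hasD_holo _ _ (fun z => cD f z - 0)) => z dz; apply: hasDB; last exact: hasD_cst.
  exact: holo_hasD fC.1 dz.
have E : cD g b = cD f b.
  rewrite (hasD_cD (hasDB (holo_hasD fC.1 db) (hasD_cst (f b) b))) subr0//.
have [] := @cauchy_estimates _ g b ((1 - cabs b) / 16) (C / 2) gh.
- by rewrite divr_gt0.
- lra.
- move=> z zb; have zb' : cabs (z - b) <= (1 - cabs b) / 8 by lra.
  apply: le_trans (blochC_lip fC db zb') _.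
  apply: le_trans (ler_wpM2l _ zb') _; first by rewrite mulr_ge0 ?mulr_ge0 ?invr_ge0 ?(blochC_ge0 fC)// ltW.
  by apply: eqW; field; rewrite gt_eqF.
move=> _ _ H; have := H h ltac:(lra); rewrite /g E subrr subr0 => H'.
apply: le_trans H' _.
have q0 : 0 <= C * cabs h ^+ 2 / (1 - cabs b) ^+ 2.
  by rewrite divr_ge0 ?exprn_ge0 ?(ltW b1)// mulr_ge0 ?(blochC_ge0 fC)// exprn_ge0 ?cabs_ge0.
rewrite [leLHS](_ : _ = 128 * 256 * (C * cabs h ^+ 2 / (1 - cabs b) ^+ 2)); last by field; rewrite gt_eqF.
rewrite [leRHS](_ : _ = 16 * cK * (C * cabs h ^+ 2 / (1 - cabs b) ^+ 2)); last by ring.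
by apply: ler_wpM2r => //; rewrite cK.unlock -!natrM ler_nat.
Qed.

(** When |a - b| is large compared with 1 - |b|, [rho a b] is bounded below and the trivial bound 2C
    suffices. Otherwise [rho a b] is comparable to |a - b| / (1 - |b|), and the difference splits
    into one of derivatives, bounded by [blochC_deriv_lip], and one of weights. *)
Lemma blochC_rho C f a b : blochC C f -> disk a -> disk b ->
  cabs ((1 - cabs a ^+ 2)%:C%C * cD f a - (1 - cabs b ^+ 2)%:C%C * cD f b)
   <= 7 * cK * C * rho a b.
Proof.
move=> fC da db.
have C0 := blochC_ge0 fC.
have b1 : 0 < 1 - cabs b by move: db; rewrite /disk /=; lra.
have D0 := sub_conj_gt0 da db; have D1 := sub_conj_le a db.
have r0 := cabs_ge0 (a - b).
rewrite rhoE; set D := cabs (1 - _) in D0 D1 *; set r := cabs (a - b) in D1 r0 *.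
have ab a' : disk a' -> cabs ((1 - cabs a' ^+ 2)%:C%C * cD f a') <= C.
  move=> da'; rewrite cabsM cabs_real mulrC gtr0_norm ?disk_sq//; exact: fC.2.
have [rd|rd] := leP r ((1 - cabs b) / 64); last first.
  apply: le_trans (cabsD _ _) _; rewrite cabsN.
  apply: le_trans (lerD (ab _ da) (ab _ db)) _.
  rewrite mulrA ler_pdivlMr//.
  (* Here 1 - |b| < 64 r, hence D <= 2(1 - |b|) + r <= 129 r and [rho] is at least 1/129. *)
  have : D <= 129 * r by lra.
  move=> /(ler_wpM2l C0); have := mulr_ge0 C0 r0; have := cK_ge; nra.
pose d1 := 1 - cabs b.
have q0 : 0 <= r / d1 by rewrite divr_ge0// ltW.
(* In the near case D <= 3 d1, so [rho] is at least r / (3 d1). In the constant, 2 cK comes from the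
   derivatives and 4 from the weights. *)
apply: (@le_trans _ _ ((2 * cK + 4) * C * (r / d1))); last first.
  apply: (@le_trans _ _ (7 * cK * C * (r / (3 * d1)))).
    rewrite (_ : r / (3 * d1) = r / d1 / 3); last by field; rewrite gt_eqF.
    rewrite [leRHS](_ : _ = 7 * cK / 3 * (C * (r / d1))); last by ring.
    rewrite -[leLHS]mulrA; apply: ler_wpM2r; first exact: mulr_ge0.
    exact: cK_lin.
  apply: ler_wpM2l; first by rewrite !mulr_ge0 ?cK_ge0.
  apply: ler_wpM2l => //; rewrite lef_pV2 ?posrE//; last by rewrite mulr_gt0.
  by rewrite /d1; lra.
have -> : (1 - cabs a ^+ 2)%:C%C * cD f a - (1 - cabs b ^+ 2)%:C%C * cD f b =
  (1 - cabs b ^+ 2)%:C%C * (cD f a - cD f b) + (cabs b ^+ 2 - cabs a ^+ 2)%:C%C * cD f a.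
  have -> : (cabs b ^+ 2 - cabs a ^+ 2)%:C%C = (1 - cabs a ^+ 2)%:C%C - (1 - cabs b ^+ 2)%:C%C.
    by rewrite -rmorphB; congr (_%:C%C); ring.
  move: (1 - cabs a ^+ 2)%:C%C (1 - cabs b ^+ 2)%:C%C => A B; ring.
apply: le_trans (cabsD _ _) _; rewrite !cabsM !cabs_real.
have L := blochC_deriv_lip fC db rd.
rewrite (addrC b) subrK -/r in L.
have N := @blochC_near C f b a fC db.
have {}N : cabs (cD f a) <= 2 * C / d1 by apply: N; rewrite -/r; lra.
have -> : (2 * cK + 4) * C * (r / d1) = 2 * d1 * (cK * C * r / d1 ^+ 2) + 2 * r * (2 * C / d1).
  by field; rewrite gt_eqF.
apply: lerD; apply: ler_pM; rewrite ?cabs_ge0//.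
  by rewrite gtr0_norm ?disk_sq// disk_sq_le.
rewrite subr_sqr normrM mulrC; apply: ler_pM => //.
  rewrite ger0_norm ?addr_ge0 ?cabs_ge0//.
  by move: da db; rewrite /disk /=; lra.
rewrite ler_norml; have := cabsD (a - b) b; have := cabsD (b - a) a.
by rewrite !subrK (cabsB b a) -/r; lra.
Qed.

(** The true growth is logarithmic; bounding f' on the whole radius by its worst value is cruder but
    gives the local boundedness that Montel's theorem requires. *)
Lemma blochC_growth C f z : blochC C f -> disk z ->
  cabs (f z) <= cabs (f 0) + 2 * C / (1 - cabs z).
Proof.
move=> fC dz; have z1 : 0 < 1 - cabs z by move: dz; rewrite /disk /=; lra.
have seg (t : R) : 0 <= t <= 1 -> cabs (0 + t%:C%C * z) <= cabs z.
  by move=> /andP[t0 t1]; rewrite add0r cabsM cabs_real ger0_norm// ler_piMl ?cabs_ge0.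
have C0 := blochC_ge0 fC.
have sd (t : R) : 0 <= t <= 1 -> disk (0 + t%:C%C * z).
  by move=> /seg h; move: dz; rewrite /disk /=; exact: le_lt_trans.
have := @cmvt_const _ f 0 z (C / (1 - cabs z)) fC.1 sd.
rewrite add0r => H.
rewrite -[f z](subrK (f 0)) addrC; apply: le_trans (cabsD _ _) _; rewrite lerD2l.
apply: le_trans (H _) _.
  move=> t t01; apply: le_trans (blochC_le fC (sd t t01)) _.
  rewrite ler_wpM2l// lef_pV2 ?posrE//; first by have := seg t t01; lra.
  by have := seg t t01; lra.
rewrite -[leRHS]mulr1 -(mulrA 2) -(mulrA 2) -(mulrA 2) ler_pM2l// ler_wpM2l//; last lra.
  by rewrite divr_ge0// ltW.
Qed.

(** The bound on f'' is integrated along the radius, where C / (1 - t|z|) is a primitive of the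
    majorant. The resulting constant involves |f'(0)|. *)
Lemma bloch_of_deriv2 C f : holo f -> 0 <= C ->
  (forall z, disk z -> cabs (cD (cD f) z) <= C / (1 - cabs z) ^+ 2) ->
  exists C', blochC C' f.
Proof.
move=> fh C0 f2; have f'h := holo_cD fh.
exists (2 * (cabs (cD f 0) + 2 * C)); split => // z dz.
have z1 : 0 < 1 - cabs z by move: dz; rewrite /disk /=; lra.
have z0 := cabs_ge0 z.
have seg (t : R) : 0 <= t <= 1 -> cabs (0 + t%:C%C * z) = t * cabs z.
  by move=> /andP[t0 t1]; rewrite add0r cabsM cabs_real ger0_norm.
have tz (t : R) : 0 <= t <= 1 -> t * cabs z <= cabs z.
  by move=> /andP[t0 t1]; rewrite ler_piMl.
have dt (t : R) : 0 <= t <= 1 -> 0 < 1 - t * cabs z by move=> /tz; lra.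
have := @cmvt _ (cD f) (cD (cD f)) 0 z (fun t => C / (1 - t * cabs z))
  (fun t => C * cabs z / (1 - t * cabs z) ^+ 2).
rewrite add0r mul0r mul1r subr0 divr1 => H.
have {}H : cabs (cD f z - cD f 0) <= 2 * (C / (1 - cabs z) - C).
  apply: H.
  - move=> t t01; apply: holo_hasD => //.
    by rewrite /disk /= seg//; have := dt t t01; lra.
  - move=> t t01; have d0 : 1 - t * cabs z != 0 by rewrite gt_eqF// dt.
    have d1 : is_derive t 1 (fun t : R => 1 - t * cabs z) (- cabs z).
      by apply: is_derive_eq; rewrite /GRing.scale /=; ring.
    have d2 := @is_deriveV _ (fun t : R => 1 - t * cabs z) t _ _ d0 d1.
    have d3 := @is_deriveZ _ _ _ _ C t 1 _ d2.
    by apply: is_derive_eq; rewrite /GRing.scale /=; field.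
  - move=> t t01; rewrite cabsM mulrC mulrAC; apply: ler_wpM2r => //.
    apply: le_trans (f2 _ _) _; last by rewrite seg.
    by rewrite /disk /= seg//; have := dt t t01; lra.
have : cabs (cD f z) <= cabs (cD f 0) + 2 * (C / (1 - cabs z)).
  have := cabsD (cD f z - cD f 0) (cD f 0); rewrite subrK; lra.
move=> H1; apply: le_trans (ler_pM (cabs_ge0 _) (ltW (disk_sq dz)) H1 (disk_sq_le dz)) _.
have -> : (cabs (cD f 0) + 2 * (C / (1 - cabs z))) * (2 * (1 - cabs z)) =
  2 * (cabs (cD f 0) * (1 - cabs z) + 2 * C) by field; rewrite gt_eqF.
rewrite ler_wpM2l// lerD2r ler_piMr ?cabs_ge0//; lra.
Qed.

(** A Schwarz-Pick bound with a crude constant: Cauchy's estimate on a square of size comparable to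
    1 - |z|. *)
Lemma blochC_bounded M f : holo f -> (forall z, disk z -> cabs (f z) <= M) -> blochC (cK * M) f.
Proof.
move=> fh fM; split => // z dz.
have M0 : 0 <= M by apply: le_trans (cabs_ge0 _) (fM z dz).
have z1 : 0 < 1 - cabs z by move: dz; rewrite /disk /=; lra.
have [] := @cauchy_estimates _ f z ((1 - cabs z) / 4) M fh.
- by rewrite divr_gt0.
- lra.
- by move=> w wz; apply: fM; apply: (@disk_ball _ z); lra.
move=> H _ _; apply: le_trans (ler_pM (cabs_ge0 _) (ltW (disk_sq dz)) H (disk_sq_le dz)) _.
rewrite [leLHS](_ : _ = 512 * M); last by field; rewrite gt_eqF.
by apply: ler_wpM2r => //; rewrite cK.unlock ler_nat.
Qed.

End Bloch.

(** * Montel's theorem *)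

Section Montel.
Variable R : realType.
Implicit Types (f g : R[i] -> R[i]) (z w h v : R[i]) (C : R).

(** By Tychonoff the sequence has a cluster point in the product of the intervals [-B i, B i]; basic
    neighbourhoods there constrain finitely many coordinates. The index set may be uncountable, so
    pointwise limits are obtained on the whole disk at once. *)
Lemma seq_cluster (I : eqType) (w : nat -> I -> R) (B : I -> R) :
  (forall n i, `|w n i| <= B i) ->
  exists c : I -> R, forall (s : seq I) (e : R) (N : nat), 0 < e ->
    exists2 n, (N <= n)%N & forall i, i \in s -> `|w n i - c i| < e.
Proof.
move=> wB.
pose T := prod_topology (fun _ : I => R : topologicalType).
have cpt : compact [set f : T | forall i, `[- B i, B i]%classic (f i)].
  have := @tychonoff I (fun _ : I => R : topologicalType) (fun i => `[- B i, B i]%classic).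
  by apply => i; exact: segment_compact.
have [|c [_ clc]] := cpt ((w : nat -> T) @ \oo) _.
  by exists 0%N => // n _ i /=; rewrite in_itv /= -ler_norml.
exists c => s e N e0.
have nb : nbhs (c : T) [set g : T | forall i, i \in s -> `|g i - c i| < e].
  elim: s => [|i s IH]; first by apply: filterS filterT.
  have pi : nbhs (c : T) [set g : T | `|g i - c i| < e].
    have := @proj_continuous I (fun _ : I => R : topologicalType) i c.
    move=> /(_ [set x : R | `|x - c i| < e]); apply.
    by apply: filterS (nbhsx_ballx (c i : R) e e0) => x; rewrite /ball /= distrC.
  apply: filterS (filterI pi IH) => g [gi gs] j; rewrite inE => /predU1P[->//|]; exact: gs.
have [] := clc [set g : T | exists2 n, (N <= n)%N & g = w n] _ _ nb.
  by exists N => // n /= Nn; exists n.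
by move=> g [[n Nn ->] H]; exists n.
Qed.

(** Both sequences are coded as one real family indexed by a point and two booleans (which part,
    which sequence), so that a single [n] serves [u] and [v]. Outside the disk the coordinates are
    set to 0. *)
Lemma complex_cluster (u v : nat -> R[i] -> R[i]) (B : R[i] -> R) :
  (forall n z, disk z -> cabs (u n z) <= B z /\ cabs (v n z) <= B z) ->
  exists F G : R[i] -> R[i], forall (s : seq R[i]) (e : R) (N : nat), 0 < e ->
    exists2 n, (N <= n)%N & forall z, z \in s -> disk z ->
      cabs (u n z - F z) < e /\ cabs (v n z - G z) < e.
Proof.
move=> uvB.
pose part (b : bool) (z : R[i]) : R := if b then complex.Re z else complex.Im z.
have partl b z : `|part b z| <= cabs z by case: b; [exact: cabs_Re|exact: cabs_Im].
pose w n (i : R[i] * (bool * bool)) :=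
  if cabs i.1 < 1 then part i.2.1 ((if i.2.2 then u else v) n i.1) else 0.
have [|c Hc] := @seq_cluster _ w (fun i => Num.max (B i.1) 0).
  move=> n [z [b1 b2]]; rewrite /w /=; case: ifPn => [z1|_]; last by rewrite normr0 le_max lexx orbT.
  rewrite le_max; apply/orP; left; apply: le_trans (partl _ _) _.
  by case: b2; have [] := uvB n z z1.
exists (fun z => Complex (c (z, (true, true))) (c (z, (false, true)))).
exists (fun z => Complex (c (z, (true, false))) (c (z, (false, false)))).
move=> s e N e0; have e2 : 0 < e / 2 by rewrite divr_gt0.
pose s' := [seq (z, b) | z <- s, b <- [:: (true, true); (false, true); (true, false); (false, false)]].
have [n Nn H] := Hc s' _ N e2; exists n => // z zs dz.
have H' b : `|w n (z, b) - c (z, b)| < e / 2.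
  by apply: H; apply: allpairs_f => //; case: b => [] [] [].
have q x y x' y' : `|x - x'| < e / 2 -> `|y - y'| < e / 2 ->
    cabs (Complex x y - Complex x' y') < e.
  by move=> h1 h2; apply: le_lt_trans (cabs_le_ReIm _) _; rewrite [e]splitr /= ltrD.
have := H' (true, true); have := H' (false, true).
have := H' (true, false); have := H' (false, false).
rewrite /w /= !ifT//; move: (u n z) (v n z) => [a1 a2] [a3 a4] h1 h2 h3 h4.
by split; apply: q.
Qed.

Definition grid (m : nat) : seq R[i] :=
  [seq Complex (i%:R / m%:R - 1) (j%:R / m%:R - 1) | i <- iota 0 (2 * m), j <- iota 0 (2 * m)].

Lemma grid_near m z : (0 < m)%N -> disk z -> exists2 g, g \in grid m & cabs (g - z) <= 2 / m%:R.
Proof.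
move=> m0; case: z => x y dz.
have mR : 0 < m%:R :> R by rewrite ltr0n.
have key (t : R) : `|t| < 1 -> exists2 i, i \in iota 0 (2 * m) & `|i%:R / m%:R - 1 - t| <= m%:R^-1.
  rewrite ltr_norml => /andP[t1 t2].
  have p0 : 0 <= (t + 1) * m%:R by rewrite mulr_ge0 ?ler0n//; lra.
  have /andP[h1 h2] := truncn_itv p0; set i := Num.truncn _ in h1 h2.
  exists i.
    rewrite mem_iota add0n /= -(ltr_nat R); apply: le_lt_trans h1 _.
    by rewrite natrM ltr_pM2r//; lra.
  rewrite (_ : i%:R / m%:R - 1 - t = (i%:R - (t + 1) * m%:R) / m%:R); last by field; rewrite gt_eqF.
  rewrite normrM [`|_^-1|]gtr0_norm ?invr_gt0// ler_piMl ?invr_ge0 ?ltW//.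
  by move: h2; rewrite -natr1 ltr_norml; lra.
have [i ii hi] := key x (le_lt_trans (cabs_Re (Complex x y)) dz).
have [j jj hj] := key y (le_lt_trans (cabs_Im (Complex x y)) dz).
exists (Complex (i%:R / m%:R - 1) (j%:R / m%:R - 1)).
  by apply/allpairsP; exists (i, j).
by apply: le_trans (cabs_le_ReIm _) _; rewrite [leRHS]mulr_natl mulr2n /=; apply: lerD.
Qed.

(** A common cluster point of the functions and their derivatives is taken pointwise. Closeness on
    finite grids then becomes uniform on |z| <= r, because all functions of Bloch constant [C] share
    the same Lipschitz constants there, for themselves and for their derivatives. *)
Lemma montel (u : nat -> R[i] -> R[i]) C M :
  (forall n, blochC C (u n)) -> (forall n, cabs (u n 0) <= M) ->
  exists (s : nat -> nat) (f : R[i] -> R[i]),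
    [/\ forall m n, (m < n)%N -> (s m < s n)%N, blochC C f &
     forall (r e : R), r < 1 -> 0 < e -> exists N, forall n z, (N <= n)%N -> cabs z <= r ->
      cabs (u (s n) z - f z) < e /\ cabs (cD (u (s n)) z - cD f z) < e].
Proof.
move=> uC uM; have C0 := blochC_ge0 (uC 0%N).
have dsub z : disk z -> 0 < 1 - cabs z by rewrite /disk /=; lra.
have [|F [G FG]] := @complex_cluster u (fun n => cD (u n)) (fun z => M + 2 * C / (1 - cabs z)).
  move=> n z dz; have z1 := dsub z dz; split.
    by apply: le_trans (blochC_growth (uC n) dz) _; rewrite lerD2r.
  apply: le_trans (blochC_le (uC n) dz) _.
  have M0 := le_trans (cabs_ge0 _) (uM 0%N).
  have : 0 <= C / (1 - cabs z) by rewrite divr_ge0// ltW.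
  by rewrite -mulrA; lra.
(* The Taylor bound with uniform constant survives the limit, and shows that the limit of the
   derivatives is the derivative of the limit. *)
have taylor z h : disk z -> cabs h <= (1 - cabs z) / 64 ->
   cabs (F (z + h) - F z - h * G z) <= 16 * cK R * C * cabs h ^+ 2 / (1 - cabs z) ^+ 2.
  move=> dz hz; have z1 := dsub z dz; apply/ler_addgt0Pr => e e0.
  have z0 := cabs_ge0 z; have h0 := cabs_ge0 h.
  have [n _ H] := FG [:: z; z + h] (e / 3) 0%N (divr_gt0 e0 (ltr0Sn _ 2)).
  have dzh : disk (z + h) by apply: (@disk_ball _ z); rewrite addrC addKr; lra.
  have [a1 a2] := H z (mem_head _ _) dz.
  have [|a3 _] := H (z + h) _ dzh; first by rewrite !inE eqxx orbT.
  have T := blochC_taylor (uC n) dz hz.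
  rewrite (_ : F (z + h) - F z - h * G z = (u n (z + h) - u n z - h * cD (u n) z)
    - (u n (z + h) - F (z + h)) + (u n z - F z) + h * (cD (u n) z - G z)); last by ring.
  apply: le_trans (cabsD _ _) _.
  apply: le_trans (lerD (cabsD _ _) (lexx _)) _.
  apply: le_trans (lerD (lerD (cabsD _ _) (lexx _)) (lexx _)) _.
  rewrite cabsN cabsM.
  have : cabs h * cabs (cD (u n) z - G z) <= 1 * (e / 3).
    by apply: ler_pM; rewrite ?cabs_ge0 ?(ltW a2)//; lra.
  move=> hG; rewrite (_ : e = e / 3 + e / 3 + 1 * (e / 3)); last by field.
  rewrite !addrA; apply: lerD => //; apply: lerD; last exact: ltW.
  by apply: lerD => //; exact: ltW.
have FisG z : disk z -> hasD F z (G z).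
  move=> dz; have z1 := dsub z dz.
  apply: (@hasD_sq _ _ _ _ (16 * cK R * C / (1 - cabs z) ^+ 2) ((1 - cabs z) / 64)).
    by rewrite divr_gt0.
  by move=> h /ltW hz; rewrite [leRHS]mulrAC; exact: taylor.
have FC : blochC C F.
  split; first exact: hasD_holo FisG.
  move=> z dz; rewrite (hasD_cD (FisG z dz)); apply/ler_addgt0Pr => e e0.
  have [n _ H] := FG [:: z] e 0%N e0.
  have [_ a2] := H z (mem_head _ _) dz.
  have s0 := disk_sq dz; have s1 : 1 - cabs z ^+ 2 <= 1 by rewrite gerBl sqr_ge0.
  have := (uC n).2 z dz.
  have gz : cabs (G z) <= cabs (cD (u n) z) + e.
    by have := cabs_subD (G z) (cD (u n) z) 0; rewrite !subr0 (cabsB (G z)); lra.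
  move=> h; apply: le_trans (ler_wpM2r (ltW s0) gz) _; rewrite mulrDl; apply: lerD => //.
  by rewrite ler_piMr// ltW.
have pick (p : nat * nat) : exists n, (p.1 <= n)%N /\ forall z, z \in grid p.2.+1 -> disk z ->
      cabs (u n z - F z) < p.2.+1%:R^-1 /\ cabs (cD (u n) z - G z) < p.2.+1%:R^-1.
  have [|n h1 h2] := FG (grid p.2.+1) (p.2.+1%:R^-1) p.1; first by rewrite invr_gt0 ltr0n.
  by exists n.
have [h hP] := choice pick.
(* The first component passed to [h] is a lower bound for the new index, which makes [s] increasing;
   the second is the fineness of the grid. *)
pose s := fix s (k : nat) := if k is k'.+1 then h ((s k').+1, k) else h (0%N, 0%N).
have sS k : (s k < s k.+1)%N by have [] := hP ((s k).+1, k.+1).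
exists s, F; split => //.
  by move=> m n; apply: (homo_ltn (@ltn_trans) sS).
have sP k z : z \in grid k.+1 -> disk z ->
      cabs (u (s k) z - F z) < k.+1%:R^-1 /\ cabs (cD (u (s k)) z - G z) < k.+1%:R^-1.
  by case: k => [|k]; [exact: (hP (0%N, 0%N)).2|exact: (hP ((s k).+1, k.+1)).2].
move=> r e r1 e0.
pose d := 1 - r; have d0 : 0 < d by rewrite /d; lra.
pose L := cK R * C / d ^+ 2 + 4 * C / d.
have L0 : 0 <= L.
  by rewrite addr_ge0 ?divr_ge0 ?exprn_ge0 ?mulr_ge0 ?cK_ge0// ltW.
(* With mesh error at most [2 * m], the first entry keeps the grid point within the range of the
   Lipschitz bounds; the second pays for two Lipschitz errors [L * (2 * m)] and the gap at the grid
   point. *)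
pose eta := Num.min (d / 128) (e / (4 * L + 2)).
have eta0 : 0 < eta by rewrite lt_min !divr_gt0//; lra.
have [N _ HN] := near_infty_natSinv_lt (PosNum eta0).
exists N => n z Nn zr; have := HN n Nn; rewrite /= lt_min => /andP[n1 n2].
have dz : disk z by rewrite /disk /=; lra.
have [g gg gz] := grid_near (ltn0Sn n) dz.
set m := n.+1%:R^-1 in n1 n2 gz.
have zd : d <= 1 - cabs z by rewrite /d; lra.
have z1 : 0 < 1 - cabs z by lra.
have gz1 : cabs (g - z) <= (1 - cabs z) / 64 by lra.
have gz2 : cabs (g - z) <= (1 - cabs z) / 8 by lra.
have dg : disk g by apply: (@disk_ball _ z); lra.
have [k1 k2] := sP n g gg dg; rewrite -/m in k1 k2.
have i1 : (1 - cabs z)^-1 <= d^-1 by rewrite lef_pV2.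
have i2 : ((1 - cabs z) ^+ 2)^-1 <= (d ^+ 2)^-1.
  by rewrite lef_pV2 ?posrE ?exprn_gt0// lerXn2r ?nnegrE// ltW.
have lip1 f : blochC C f -> cabs (f g - f z) <= L * (2 * m).
  move=> fC; apply: le_trans (blochC_lip fC dz gz2) _.
  apply: ler_pM (gz); [by rewrite divr_ge0 ?mulr_ge0 // ltW|exact: cabs_ge0|].
  apply: le_trans (_ : 4 * C / d <= _); first by rewrite ler_wpM2l ?mulr_ge0.
  by rewrite lerDr divr_ge0 ?exprn_ge0 ?mulr_ge0 ?cK_ge0// ltW.
have lip2 f : blochC C f -> cabs (cD f g - cD f z) <= L * (2 * m).
  move=> fC; have := blochC_deriv_lip fC dz gz1; rewrite (addrC z) subrK => H.
  apply: le_trans H _; rewrite mulrAC.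
  apply: ler_pM (gz); [by rewrite divr_ge0 ?exprn_ge0 ?mulr_ge0 ?cK_ge0 // ltW|exact: cabs_ge0|].
  apply: le_trans (_ : cK R * C / d ^+ 2 <= _); first by rewrite ler_wpM2l ?mulr_ge0 ?cK_ge0.
  by rewrite lerDl divr_ge0 ?mulr_ge0// ltW.
have fin (x y x' y' : R[i]) : cabs (x' - x) <= L * (2 * m) -> cabs (y' - y) <= L * (2 * m) ->
   cabs (x' - y') < m -> cabs (x - y) < e.
  move=> h1 h2 h3; have := cabs_subD x x' y; have := cabs_subD x' y' y; rewrite (cabsB x x').
  have : m * (4 * L + 2) < e by rewrite -ltr_pdivlMr//; lra.
  have m0 : 0 <= m by rewrite invr_ge0 ler0n.
  have -> : m * (4 * L + 2) = L * (2 * m) + L * (2 * m) + (m + m) by ring.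
  lra.
split; first exact: fin (lip1 _ (uC _)) (lip1 _ FC) k1.
by apply: fin (lip2 _ (uC _)) (lip2 _ FC) _; rewrite (hasD_cD (FisG g dg)).
Qed.

End Montel.

(** * Sufficiency *)

Section Sufficiency.
Variable R : realType.
Implicit Types (f g : R[i] -> R[i]) (z w h v : R[i]) (C : R).

Lemma cDfE : @cD R = @cderiv R.
Proof. by apply/funext => f; apply/funext => z; rewrite cDE. Qed.

(** Compactness of the closed disk of radius [r], by contradiction: points where [p] exceeds [n]
    cluster, by [seq_cluster] on two coordinates, at a point near which [p] is bounded. *)
Lemma disk_compact_bound (p : R[i] -> R) (r : R) :
  (forall z, disk z -> exists d B : R, 0 < d /\
     forall w, disk w -> cabs (w - z) < d -> p w <= B) ->
  r < 1 -> exists B : R, forall z, cabs z <= r -> p z <= B.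
Proof.
move=> pB r1; apply: contrapT => /forallNP nB.
have nB' (n : nat) : exists z, cabs z <= r /\ n%:R < p z.
  have /existsNP[z] := nB n%:R; move=> /not_implyP[zr /negP]; rewrite -ltNge => h.
  by exists z.
have [zs zsP] := choice nB'.
pose part (b : bool) (z : R[i]) : R := if b then complex.Re z else complex.Im z.
have [|c Hc] := @seq_cluster R bool (fun n b => part b (zs n)) (fun=> r).
  move=> n b; apply: le_trans (zsP n).1.
  by case: b; [exact: cabs_Re|exact: cabs_Im].
pose z0 : R[i] := Complex (c true) (c false).
have near (e : R) (N : nat) : 0 < e -> exists2 n, (N <= n)%N & cabs (zs n - z0) < e.
  move=> e0; have e2 : 0 < e / 2 by rewrite divr_gt0.
  have [n Nn H] := Hc [:: true; false] _ N e2; exists n => //.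
  have := H true isT; have := H false isT; rewrite /part /z0.
  case: (zs n) => x y h1 h2; apply: le_lt_trans (cabs_le_ReIm _) _.
  by rewrite [e]splitr /= ltrD.
have z0r : cabs z0 <= r.
  apply/ler_addgt0Pr => e e0; have [n _ h] := near e 0%N e0.
  have := cabsD (z0 - zs n) (zs n); rewrite subrK (cabsB z0); have := (zsP n).1; lra.
have [|d [B [d0 H]]] := pB z0; first exact: le_lt_trans z0r r1.
have [n Nn h] := near d (Num.truncn B).+1 d0.
have := H (zs n) _ h; rewrite /disk /= => /(_ (le_lt_trans (zsP n).1 r1)).
have := (zsP n).2; have BN := truncnS_gt B.
have : (Num.truncn B).+1%:R <= n%:R :> R by rewrite ler_nat.
lra.
Qed.

Variables (nu : R[i] -> R) (phi psi : R[i] -> R[i]).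
Hypothesis nu0 : forall z, disk z -> 0 < nu z.
Hypothesis nuC : {within (@disk R : set R[i]^o), continuous (nu : R[i]^o -> R)}.

Lemma nu_bounded (r : R) : r < 1 -> exists B : R, forall z, cabs z <= r -> nu z <= B.
Proof.
apply: disk_compact_bound => z dz.
have /(@subspace_continuousP (R[i]^o)) /(_ z dz) := nuC.
move=> /cvgrPdist_lt /(_ 1 ltr01); rewrite near_withinE => /(nbhs_cabs z) [d d0 H].
exists d, (nu z + 1); split => // w dw wd.
have h : `|nu z - nu w| < 1 := H w wd dw.
by move: h; rewrite ltr_norml; lra.
Qed.

Lemma selfmap_inner (f : R[i] -> R[i]) (r : R) : selfmap f -> r < 1 ->
  exists K r' : R, [/\ 0 <= K, r' < 1 &
    forall z, cabs z <= r -> nu z * cabs (cD f z) <= K /\ cabs (f z) <= r'].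
Proof.
move=> [fh fd] r1.
have [B nB] := nu_bounded r1.
(* A bound for 1 / (1 - |f|) on |z| <= r is what keeps the image in a smaller disk, of radius 1 -
   1/B1. *)
have [|B' fB] := @disk_compact_bound (fun z => (1 - cabs (f z))^-1) r _ r1.
  move=> z dz; have fz : 0 < 1 - cabs (f z) by have := fd z dz; rewrite /disk /=; lra.
  have [d d0 H] := hasD_cont (holo_hasD fh dz) (divr_gt0 fz (ltr0Sn _ 1)).
  exists d, (((1 - cabs (f z)) / 2)^-1); split => // w dw wd.
  have := H w wd; have := cabsD (f w - f z) (f z); rewrite subrK => h1 h2.
  rewrite lef_pV2 ?posrE ?divr_gt0//; last by have := fd w dw; rewrite /disk /= subr_gt0.
  lra.
pose B1 := Num.max B' 1; have B10 : 0 < B1 by rewrite lt_max ltr01 orbT.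
pose B2 := Num.max B 0; have B20 : 0 <= B2 by rewrite le_max lexx orbT.
exists (B2 * (cK R * 1 / (1 - r))), (1 - B1^-1); split.
- by rewrite mulr_ge0// divr_ge0 ?mulr_ge0 ?cK_ge0// ltW// subr_gt0.
- by rewrite gtrBl invr_gt0.
move=> z zr; have dz : disk z by rewrite /disk /=; lra.
have fz : 0 < 1 - cabs (f z) by have := fd z dz; rewrite /disk /=; lra.
split.
  apply: ler_pM; [exact/ltW/nu0|exact: cabs_ge0|by rewrite le_max nB|].
  have bf : blochC (cK R * 1) f.
    by apply: blochC_bounded => // w dw; apply: ltW; exact: fd.
  apply: le_trans (blochC_le bf dz) _; rewrite ler_wpM2l ?mulr_ge0 ?cK_ge0// lef_pV2 ?posrE; lra.
have := fB z zr; rewrite lerBrDl -lerBrDr => h.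
rewrite -[leRHS]invrK lef_pV2 ?posrE ?invr_gt0//.
by apply: le_trans h _; rewrite le_max lexx.
Qed.

Hypotheses (phis : selfmap phi) (psis : selfmap psi).

Lemma comp_diff_hasD f z : holo f -> disk z ->
  hasD (comp_diff phi psi f) z (cD phi z * cD f (phi z) - cD psi z * cD f (psi z)).
Proof.
move=> fh dz; apply: hasDB.
  apply: (@hasD_comp _ f phi); first exact: holo_hasD fh (phis.2 z dz).
  exact: holo_hasD phis.1 dz.
apply: (@hasD_comp _ f psi); first exact: holo_hasD fh (psis.2 z dz).
exact: holo_hasD psis.1 dz.
Qed.

Let T := comp_diff phi psi.

Definition aterm z := Num.max (cabs (cD phi z) / (1 - cabs (phi z) ^+ 2))
              (cabs (cD psi z) / (1 - cabs (psi z) ^+ 2)) * nu z * rho (phi z) (psi z).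

Definition bterm z := cabs ((nu z)%:C%C * cD phi z / (1 - cabs (phi z) ^+ 2)%:C%C
            - (nu z)%:C%C * cD psi z / (1 - cabs (psi z) ^+ 2)%:C%C).

Lemma aterm_ge0 z : disk z -> 0 <= aterm z.
Proof.
move=> dz; rewrite !mulr_ge0 ?rho_ge0 ?(ltW (nu0 dz))//.
by rewrite le_max divr_ge0 ?cabs_ge0// ltW// disk_sq//; exact: phis.2.
Qed.

(** Factoring out the weights at phi z and psi z, the difference of products splits into the
    difference of coefficients, which is [bterm], times a quantity bounded by [C], plus the psi
    coefficient times a difference controlled by [blochC_rho]. *)
Lemma comp_diff_bound C f z : blochC C f -> disk z ->
  nu z * cabs (cD (T f) z) <= C * bterm z + 7 * cK R * C * aterm z.
Proof.
move=> fC dz; have C0 := blochC_ge0 fC.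
have dphi := phis.2 z dz; have dpsi := psis.2 z dz.
have p1 := disk_sq dphi; have p2 := disk_sq dpsi.
have c1 : (1 - cabs (phi z) ^+ 2)%:C%C != 0 :> R[i].
  by apply/eqP => /(@complexI R)/eqP; rewrite gt_eqF.
have c2 : (1 - cabs (psi z) ^+ 2)%:C%C != 0 :> R[i].
  by apply/eqP => /(@complexI R)/eqP; rewrite gt_eqF.
rewrite (hasD_cD (comp_diff_hasD fC.1 dz)).
have key := blochC_rho fC dphi dpsi.
have X := fC.2 _ dphi.
rewrite -[nu z](gtr0_norm (nu0 dz)) -cabs_real -cabsM.
have E (N x1 y1 x2 y2 q1 q2 : R[i]) : q1 != 0 -> q2 != 0 ->
   N * (x1 * y1 - x2 * y2) = (N * x1 / q1 - N * x2 / q2) * (q1 * y1) + N * x2 / q2 * (q1 * y1 - q2 * y2).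
  by move=> h1 h2; field; rewrite h1 h2.
rewrite (E _ _ _ _ _ _ _ c1 c2).
apply: le_trans (cabsD _ _) _; apply: lerD.
  rewrite cabsM mulrC ler_wpM2r ?cabs_ge0// cabsM cabs_real mulrC gtr0_norm//.
rewrite cabsM.
have -> : 7 * cK R * C * aterm z = (Num.max (cabs (cD phi z) / (1 - cabs (phi z) ^+ 2))
              (cabs (cD psi z) / (1 - cabs (psi z) ^+ 2)) * nu z) * (7 * cK R * C * rho (phi z) (psi z)).
  by rewrite /aterm; ring.
apply: ler_pM; rewrite ?cabs_ge0// !cabsM cabsV !cabs_real.
rewrite (gtr0_norm (nu0 dz)) (gtr0_norm p2) -mulrA mulrC ler_wpM2r ?(ltW (nu0 dz))//.
by rewrite le_max lexx orbT.
Qed.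

Hypothesis Ha : lim_bdry0 aterm.
Hypothesis Hb : lim_bdry0 bterm.

Lemma comp_diff_bdry C (e : R) : 0 <= C -> 0 < e -> exists r : R, r < 1 /\
  forall f z, blochC C f -> r < cabs z -> cabs z < 1 -> nu z * cabs (cD (T f) z) < e.
Proof.
move=> C0 e0.
have k0 : 0 < C + 1 by rewrite ltr_wpDl.
have k1 : 0 < 7 * cK R * C + 1 by rewrite ltr_wpDl// !mulr_ge0 ?cK_ge0.
have [ra [ra1 ra2]] := Ha (divr_gt0 e0 (mulr_gt0 (ltr0Sn _ 1) k1)).
have [rb [rb1 rb2]] := Hb (divr_gt0 e0 (mulr_gt0 (ltr0Sn _ 1) k0)).
exists (Num.max ra rb); split; first by rewrite gt_max ra1.
move=> f z fC; rewrite gt_max => /andP[za zb] z1.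
apply: le_lt_trans (comp_diff_bound fC z1) _.
have := ra2 z za z1; rewrite ger0_norm ?aterm_ge0// => ha.
have := rb2 z zb z1; rewrite ger0_norm ?cabs_ge0// => hb.
have a0 := aterm_ge0 z1; have b0 : 0 <= bterm z by exact: cabs_ge0.
rewrite [e]splitr; apply: ler_ltD.
  move: hb; rewrite ltr_pdivlMr ?mulr_gt0// => hb; nra.
move: ha; rewrite ltr_pdivlMr ?mulr_gt0// => ha; nra.
Qed.

Lemma bloch_sup_le f (M : R) : (forall z, disk z -> nu z * cabs (cD f z) <= M) ->
  (bloch_sup nu f <= M%:E)%E.
Proof.
move=> fM; apply: ge_ereal_sup => _ [z dz <-].
by rewrite lee_fin -cDfE; exact: fM.
Qed.

(** Away from the circle the images under phi and psi stay in a fixed compact disk. Since [K] and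
    [r'] do not depend on [f], the bound serves both for finiteness and for convergence. *)
Lemma comp_diff_inner (r : R) : r < 1 -> exists K r' : R, [/\ 0 <= K, r' < 1 &
  forall f z, holo f -> cabs z <= r -> exists w1 w2, [/\ cabs w1 <= r', cabs w2 <= r' &
    nu z * cabs (cD (T f) z) <= K * (cabs (cD f w1) + cabs (cD f w2))]].
Proof.
move=> r1; have [K1 [r1' [K10 r11 H1]]] := selfmap_inner phis r1.
have [K2 [r2' [K20 r21 H2]]] := selfmap_inner psis r1.
exists (Num.max K1 K2), (Num.max r1' r2'); split; rewrite ?le_max ?K10// ?gt_max ?r11//.
move=> f z fh zr; have dz : disk z by rewrite /disk /=; lra.
have [a1 a2] := H1 z zr; have [b1 b2] := H2 z zr.
exists (phi z), (psi z); split; rewrite ?le_max ?a2 ?b2 ?orbT//.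
rewrite (hasD_cD (comp_diff_hasD fh dz)).
apply: le_trans (ler_wpM2l (ltW (nu0 dz)) (cabsD _ _)) _.
rewrite cabsN !cabsM !mulrDr !mulrA; apply: lerD; apply: ler_wpM2r; rewrite ?cabs_ge0// le_max.
  by rewrite a1.
by rewrite b1 orbT.
Qed.

Lemma blochC_little C f : blochC C f -> little_bloch nu (T f).
Proof.
move=> fC; have C0 := blochC_ge0 fC.
have Th : holo (T f) by apply: hasD_holo => z dz; exact: comp_diff_hasD fC.1 dz.
split; last first.
  move=> e e0; have [r [r1 H]] := comp_diff_bdry C0 e0.
  exists r; split => // z zr z1; rewrite -cDfE ger0_norm; first exact: H fC zr z1.
  by rewrite mulr_ge0 ?cabs_ge0// ltW// nu0.
split => //.
have [r [r1 H]] := comp_diff_bdry C0 ltr01.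
have [K [r' [K0 r'1 HK]]] := comp_diff_inner r1.
apply: (@le_lt_trans _ _ (Num.max 1 (K * (C / (1 - r') + C / (1 - r'))))%:E); last exact: ltry.
apply: bloch_sup_le => z dz; rewrite le_max.
have [zr|zr] := leP (cabs z) r; last by apply/orP; left; apply/ltW/(H f z fC zr dz).
apply/orP; right; have [w1 [w2 [h1 h2 h3]]] := HK f z fC.1 zr.
apply: le_trans h3 _; apply: ler_wpM2l => //.
have q w : cabs w <= r' -> cabs (cD f w) <= C / (1 - r').
  move=> wr; have dw : disk w by rewrite /disk /=; lra.
  apply: le_trans (blochC_le fC dw) _.
  by rewrite ler_wpM2l// lef_pV2 ?posrE; lra.
by apply: lerD; exact: q.
Qed.

Lemma cvge0_le (x : nat -> \bar R) : (forall n, (0 <= x n)%E) ->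
  (forall e : R, 0 < e -> exists N, forall n, (N <= n)%N -> (x n <= e%:E)%E) ->
  x @ \oo --> 0%E.
Proof.
move=> x0 xe; apply/fine_cvgP; split.
  have [N HN] := xe 1 ltr01; exists N => // n Nn.
  by rewrite ge0_fin_numE//; apply: le_lt_trans (HN n Nn) _; exact: ltry.
apply/cvgrPdist_le => e e0; have [N HN] := xe e e0; exists N => // n Nn /=.
rewrite sub0r normrN ger0_norm; last exact: fine_ge0.
have h := HN n Nn; rewrite -lee_fin fineK// ge0_fin_numE//.
by apply: le_lt_trans h _; exact: ltry.
Qed.

(** The limit is [T f], with [f] given by Montel's theorem. Near the circle the terms of [u (s n)]
    and of [f] are each small, uniformly in [n]; on the remaining compact disk the derivatives
    converge uniformly. *)
Lemma blochC_compact (u : nat -> R[i] -> R[i]) C M :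
  (forall n, blochC C (u n)) -> (forall n, cabs (u n 0) <= M) ->
  exists (s : nat -> nat) (g : R[i] -> R[i]),
    (forall m n, (m < n)%N -> (s m < s n)%N) /\
    little_bloch nu g /\
    (fun n => bloch_norm nu (fun z => T (u (s n)) z - g z)) @ \oo --> 0%E.
Proof.
move=> uC uM; have C0 := blochC_ge0 (uC 0%N).
have [s [f [s1 fC H]]] := montel uC uM.
exists s, (T f); split => //; split; first exact: blochC_little fC.
have d0 := @disk0 R.
have sup0 g : (0 <= bloch_sup nu g)%E.
  apply: (@le_trans _ _ (nu 0 * cabs (cderiv g 0))%:E).
    by rewrite lee_fin mulr_ge0 ?cabs_ge0// ltW// nu0.
  by apply: ereal_sup_ubound; exists 0.
apply: cvge0_le.
  by move=> n; rewrite adde_ge0// lee_fin cabs_ge0.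
move=> e e0; have e4 : 0 < e / 4 by rewrite divr_gt0.
have [r [r1 Hr]] := comp_diff_bdry C0 e4.
have [K [r' [K0 r'1 HK]]] := comp_diff_inner r1.
(* Uniform convergence must also reach phi 0 and psi 0, for the value at 0 in the Bloch norm. *)
pose r2 := Num.max r' (Num.max (cabs (phi 0)) (cabs (psi 0))).
have r21 : r2 < 1 by rewrite !gt_max r'1 /= (phis.2 0 d0) (psis.2 0 d0).
have K1 : 0 < 8 * (K + 1) by rewrite mulr_gt0// ltr_wpDl.
have [N HN] := H r2 (e / (8 * (K + 1))) r21 (divr_gt0 e0 K1).
exists N => n Nn.
have e8 : e / (8 * (K + 1)) <= e / 8.
  by rewrite ler_wpM2l ?(ltW e0)// lef_pV2 ?posrE//; lra.
have h1 : cabs (T (u (s n)) 0 - T f 0) <= e / 2.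
  have [|a1 _] := HN n (phi 0) Nn; first by rewrite !le_max lexx !orbT.
  have [|a2 _] := HN n (psi 0) Nn; first by rewrite !le_max lexx !orbT.
  rewrite /T /comp_diff opprB addrACA [X in cabs X](_ : _ =
    (u (s n) (phi 0) - f (phi 0)) - (u (s n) (psi 0) - f (psi 0))); last by ring.
  by apply: le_trans (cabsD _ _) _; rewrite cabsN; lra.
rewrite [e in leRHS]splitr EFinD; apply: leeD; first by rewrite lee_fin.
apply: bloch_sup_le => z dz.
pose D := fun w => u (s n) w - f w.
have dD w : disk w -> hasD D w (cD (u (s n)) w - cD f w).
  by move=> dw; apply: hasDB; apply: holo_hasD => //; [exact: (uC _).1|exact: fC.1].
have Dh : holo D by apply: hasD_holo dD.
have TD : (fun w => T (u (s n)) w - T f w) = T D.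
  by apply/funext => w; rewrite /T /comp_diff /D; ring.
have [zr|zr] := leP (cabs z) r.
  rewrite TD; have [w1 [w2 [g1 g2 g3]]] := HK D z Dh zr.
  apply: le_trans g3 _.
  have q w : cabs w <= r' -> cabs (cD D w) <= e / (8 * (K + 1)).
    move=> wr; have dw : disk w by rewrite /disk /=; lra.
    rewrite (hasD_cD (dD w dw)); apply: ltW.
    by apply: (HN n w Nn _).2; rewrite le_max wr.
  apply: le_trans (ler_wpM2l K0 (lerD (q _ g1) (q _ g2))) _.
  have -> : K * (e / (8 * (K + 1)) + e / (8 * (K + 1))) = e / 4 * (K / (K + 1)).
    by field; lra.
  rewrite (_ : e / 2 = e / 4 * 2); last by field.
  apply: ler_wpM2l; first exact: ltW.
  by rewrite ler_pdivrMr; lra.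
have Th g : holo g -> holo (T g).
  by move=> gh; apply: hasD_holo => w dw; exact: comp_diff_hasD gh dw.
rewrite (hasD_cD (hasDB (holo_hasD (Th _ (uC (s n)).1) dz) (holo_hasD (Th _ fC.1) dz))).
apply: le_trans (ler_wpM2l (ltW (nu0 dz)) (cabsD _ _)) _.
rewrite cabsN mulrDr.
have := Hr _ z (uC (s n)) zr dz; have := Hr _ z fC zr dz; lra.
Qed.

End Sufficiency.

(** * Area integrals *)

Section Plane.
Variable R : realType.
Notation mu := (@lebesgue_measure R).
Notation RR := (measurableTypeR R * measurableTypeR R)%type.
Notation mu2 := (mu \x mu)%E.

Definition near2 (e : R) (p q : RR) := `|q.1 - p.1| < e /\ `|q.2 - p.2| < e.

Definition open2 (V : set RR) := forall p, V p -> exists2 e : R, 0 < e &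
  forall q, near2 e p q -> V q.

Definition box2 (a b c d : R) : set RR := (`]a, b[%classic `*` `]c, d[%classic).

(** The set is a countable union of boxes with rational corners. Each [B a b c d] is the whole box
    if that lies in [V] and empty otherwise, so the union may run over all rational quadruples. *)
Lemma open2_measurable (V : set RR) : open2 V -> measurable V.
Proof.
move=> oV.
pose B (a b c d : rat) : set RR := [set p | box2 (ratr a) (ratr b) (ratr c) (ratr d) p /\
  box2 (ratr a) (ratr b) (ratr c) (ratr d) `<=` V].
have -> : V = \bigcup_a \bigcup_b \bigcup_c \bigcup_d B a b c d.
  apply/seteqP; split; last first.
    by move=> p [a _ [b _ [c _ [d _ [pB BV]]]]]; exact: BV.
  move=> [x y] /oV /= [e e0 He].
  have rt (t : R) : exists a b : rat, [/\ t - e < ratr a, ratr a < t, t < ratr b & ratr b < t + e].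
    have [|a] := @rat_in_itvoo R (t - e) t; first by rewrite gtrBl.
    rewrite in_itv /= => /andP[a1 a2].
    have [|b] := @rat_in_itvoo R t (t + e); first by rewrite ltrDl.
    by rewrite in_itv /= => /andP[b1 b2]; exists a, b.
  have [a [b [a1 a2 b1 b2]]] := rt x; have [c [d [c1 c2 d1 d2]]] := rt y.
  exists a => //; exists b => //; exists c => //; exists d => //; split.
    by rewrite /box2 /=; split; rewrite in_itv /=; apply/andP.
  move=> [x' y'] [/=]; rewrite !in_itv /= => /andP[h1 h2] /andP[h3 h4].
  by apply: He; split => /=; rewrite ltr_norml; lra.
apply: bigcupT_measurable_rat => a; apply: bigcupT_measurable_rat => b.
apply: bigcupT_measurable_rat => c; apply: bigcupT_measurable_rat => d.
have [h|h] := pselect (box2 (ratr a) (ratr b) (ratr c) (ratr d) `<=` V).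
  rewrite (_ : B a b c d = box2 (ratr a) (ratr b) (ratr c) (ratr d)).
    by apply: measurableX; exact: measurable_itv.
  by apply/seteqP; split => p; [case|].
rewrite (_ : B a b c d = set0); first exact: measurable0.
by apply/seteqP; split => p //; case.
Qed.

Lemma cont2_measurable (U : set RR) (f : RR -> R) : open2 U ->
  (forall p, U p -> forall e : R, 0 < e -> exists2 d : R, 0 < d &
     forall q, near2 d p q -> `|f q - f p| < e) ->
  measurable_fun U f.
Proof.
move=> oU cf _; have mU := open2_measurable oU.
have : measurable_fun U f; last by move=> H; exact: H.
apply: (measurability _ (RGenOInfty.measurableE R)) => //.
move=> _ [_ [a ->] <-]; apply: open2_measurable => p [Up /=].
rewrite in_itv /= andbT => ap.
have [e e0 He] := oU p Up; have [d d0 Hd] := cf p Up (f p - a) ltac:(by rewrite subr_gt0).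
exists (Num.min e d) => [|q [q1 q2]]; first by rewrite lt_min e0.
move: q1 q2; rewrite !lt_min => /andP[q1 q1'] /andP[q2 q2']; split; first exact: He.
have : `|f q - f p| < f p - a by exact: Hd.
by rewrite /= in_itv /= andbT ltr_norml; lra.
Qed.

Definition disk2 : set RR := [set xy : RR | (xy.1 ^+ 2 + xy.2 ^+ 2 < 1)%R].

Lemma disk2P (p : RR) : disk2 p <-> disk (Complex p.1 p.2).
Proof.
rewrite /disk2 /disk /mkset /cabs /=; set s := (_ + _).
have s0 : 0 <= s by rewrite addr_ge0 ?sqr_ge0.
have E : (Num.sqrt s < Num.sqrt 1) = (s < 1) by apply: ltr_sqrt.
by move: E; rewrite sqrtr1 => <-.
Qed.

Lemma near2_cabs (e : R) (p q : RR) : near2 (e / 2) p q ->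
  cabs (Complex q.1 q.2 - Complex p.1 p.2) < e.
Proof.
move=> [h1 h2]; apply: le_lt_trans (cabs_le_ReIm _) _.
by rewrite [e]splitr /= ltrD.
Qed.

Lemma disk2_open : open2 disk2.
Proof.
move=> p /disk2P dp; exists ((1 - cabs (Complex p.1 p.2)) / 2).
  by rewrite divr_gt0// subr_gt0.
move=> q /near2_cabs h; apply/disk2P; exact: disk_ball h.
Qed.

Lemma disk2_measurable : measurable disk2.
Proof. apply: open2_measurable; exact: disk2_open. Qed.

Lemma ccont_measurable (F : R[i] -> R[i]) : (forall z, disk z -> ccont F z) ->
  measurable_fun disk2 (fun p : RR => cabs (F (Complex p.1 p.2))).
Proof.
move=> cF; apply: cont2_measurable; first exact: disk2_open.
move=> p /disk2P dp e e0; have [d d0 H] := cF _ dp e e0.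
exists (d / 2); first by rewrite divr_gt0.
move=> q /near2_cabs h; have {}h := H _ h; apply: le_lt_trans h.
have := cabsD (F (Complex q.1 q.2) - F (Complex p.1 p.2)) (F (Complex p.1 p.2)).
have := cabsD (F (Complex p.1 p.2) - F (Complex q.1 q.2)) (F (Complex q.1 q.2)).
by rewrite !subrK (cabsB (F (Complex p.1 p.2))) ler_norml; lra.
Qed.

Lemma pigeonhole (h : R -> \bar R) (p q c : R) : p < q -> 0 < c ->
  measurable_fun setT (h : measurableTypeR R -> \bar R) -> (forall x, (0 <= h x)%E) ->
  (\int[mu]_x h x < (c * (q - p))%:E)%E ->
  exists2 x, p <= x <= q & (h x < c%:E)%E.
Proof.
move=> pq c0 mh h0 hI; apply: contrapT => /forall2NP H.
have : ((c * (q - p))%:E <= \int[mu]_x h x)%E; last by rewrite leNgt hI.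
have mI : measurable (`[p, q]%classic : set (measurableTypeR R)) by exact: measurable_itv.
apply: (@le_trans _ _ (\int[mu]_(x in `[p, q]) h x)%E); last first.
  by apply: ge0_subset_integral.
have -> : ((c * (q - p))%:E = \int[mu]_(x in `[p, q]) cst c%:E x)%E.
  rewrite integral_cst// EFinM; congr (_ * _)%E.
  transitivity (lebesgue_measure [set` `[p, q]%R]) => //.
  by rewrite lebesgue_measure_itv /= lte_fin pq -EFinD.
apply: ge0_le_integral => //.
- by move=> x _; rewrite lee_fin ltW.
- exact: measurable_funS mh.
- move=> x /=; rewrite in_itv /= => xpq; case: (H x) => // /negP.
  by rewrite -leNgt.
Qed.

(** The rectangle selected in [area_mean] has sides shorter than those of the square on which
    Tonelli's theorem controls the integral, hence the two intervals. [K] accounts for the Cauchy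
    kernel. *)
Lemma cint_le_int (g : R -> R[i]) (m : R -> R) (a b A B K c : R) :
  A <= a -> a <= b -> b <= B -> contw g a b -> 0 <= K ->
  (forall x, a <= x <= b -> cabs (g x) <= K * m x) -> (forall x, 0 <= m x) ->
  measurable_fun `[A, B] (m : measurableTypeR R -> R) ->
  (\int[mu]_(x in `[A, B]) (m x)%:E <= c%:E)%E -> cabs (cint g a b) <= 2 * (K * c).
Proof.
move=> Aa ab bB cg K0 gm m0 mm mI.
have mab : measurable (`[a, b]%classic : set (measurableTypeR R)) by exact: measurable_itv.
have mAB : measurable (`[A, B]%classic : set (measurableTypeR R)) by exact: measurable_itv.
have sub : `[a, b] `<=` `[A, B].
  by move=> x /=; rewrite !in_itv /= => /andP[h1 h2]; rewrite (le_trans Aa h1) (le_trans h2 bB).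
have mm' : measurable_fun (`[a, b] : set (measurableTypeR R)) m by exact: measurable_funS mm.
have P (p : R[i] -> R) : (forall z w, `|p z - p w| <= cabs (z - w)) ->
    (forall z, `|p z| <= cabs z) -> `|\int[mu]_(x in `[a, b]) p (g x)| <= K * c.
  move=> pL pb; have pi := contw_int pL cg.
  have mp : measurable_fun `[a, b] ((fun x => p (g x)) : measurableTypeR R -> R).
    by have := measurable_int mu pi; move/measurable_EFinP.
  rewrite -lee_fin; apply: le_trans (_ : (\int[mu]_(x in `[a, b]) (`|p (g x)|)%:E <= _)%E).
    rewrite EFin_normr_Rintegral//; apply: le_abse_integral => //.
    by apply/measurable_EFinP.
  apply: (@le_trans _ _ (\int[mu]_(x in `[a, b]) (K%:E * (m x)%:E))%E).
    apply: ge0_le_integral => //.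
    - by apply/measurable_EFinP; exact: measurableT_comp.
    - by apply: measurable_funeM; apply/measurable_EFinP.
    - move=> x /=; rewrite in_itv /= => xab; rewrite -EFinM lee_fin.
      by apply: le_trans (pb _) _; exact: gm.
  rewrite ge0_integralZl//; last 2 first.
  - by apply/measurable_EFinP.
  - by move=> x _; rewrite lee_fin.
  rewrite EFinM; apply: lee_wpmul2l; first by rewrite lee_fin.
  apply: le_trans mI; apply: ge0_subset_integral => //.
  - by apply/measurable_EFinP.
  - by move=> x _; rewrite lee_fin.
apply: le_trans (cabs_le_ReIm _) _; rewrite mulr_natl mulr2n /=.
by apply: lerD; apply: P; by [exact: Re_lip|exact: Im_lip|exact: cabs_Re|exact: cabs_Im].
Qed.

End Plane.

Section AreaMean.
Variable R : realType.
Notation mu := (@lebesgue_measure R).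
Notation RR := (measurableTypeR R * measurableTypeR R)%type.
Notation mu2 := (mu \x mu)%E.

Lemma cabs_lip (z w : R[i]) : `|cabs z - cabs w| <= cabs (z - w).
Proof.
have := cabsD (z - w) w; have := cabsD (w - z) z.
by rewrite !subrK (cabsB w) ler_norml; lra.
Qed.

Definition square2 (a : R[i]) (d : R) : set RR :=
  `[complex.Re a - d, complex.Re a + d]%classic `*` `[complex.Im a - d, complex.Im a + d]%classic.

Lemma square2_measurable a d : measurable (square2 a d).
Proof. by apply: measurableX; exact: measurable_itv. Qed.

Lemma square2_near a d (p : RR) : square2 a d p -> cabs (Complex p.1 p.2 - a) <= 2 * d.
Proof.
case: a => ax ay; case: p => x y [/=]; rewrite !in_itv /= => hx hy.
apply: (le_trans (cabs_le_ReIm (Complex x y - Complex ax ay))).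
by rewrite mulr_natl mulr2n /=; apply: lerD; rewrite ler_norml; lra.
Qed.

Lemma square2_sub a d : 2 * d < 1 - cabs a -> square2 a d `<=` @disk2 R.
Proof.
move=> dd p /square2_near h; apply/disk2P; apply: (@disk_ball _ a).
exact: le_lt_trans h dd.
Qed.

Lemma square2_mu a (d : R) : 0 < d -> mu2 (square2 a d) = (4 * d ^+ 2)%:E.
Proof.
move=> d0; rewrite product_measure1E; [|exact: measurable_itv|exact: measurable_itv].
have E (t : R) : mu `[t - d, t + d]%classic = (2 * d)%:E.
  transitivity (lebesgue_measure [set` `[t - d, t + d]%R]) => //.
  rewrite lebesgue_measure_itv /= lte_fin ifT; last by lra.
  by rewrite -EFinD; congr (_%:E); ring.
transitivity ((2 * d)%:E * (2 * d)%:E)%E; first by congr (_ * _)%E; exact: E.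
by rewrite -EFinM; congr (_%:E); ring.
Qed.

(* By Tonelli and the pigeonhole principle some rectangle around [a] has an
   integral of [|g|] of order [r / d] on each side; Cauchy's formula on it
   bounds [g a]. *)
Lemma area_mean (g : R[i] -> R[i]) (a : R[i]) (d r : R) : holo g -> 0 < d -> 2 * d < 1 - cabs a ->
  (\int[mu2]_(p in square2 a d) (cabs (g (Complex p.1 p.2)))%:E <= r%:E)%E ->
  cabs (g a) <= 8 * r / d ^+ 2.
Proof.
move=> gh d0 dd gr.
have mS := square2_measurable a d.
pose f0 := fun p : RR => (cabs (g (Complex p.1 p.2)))%:E.
pose f := f0 \_ (square2 a d).
have cg z : disk z -> ccont g z by move=> dz; exact: hasD_ccont (holo_hasD gh dz).
have mf : measurable_fun setT f.
  apply/(measurable_restrictT _ mS); apply: measurable_funS (square2_sub dd) _.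
    exact: disk2_measurable.
  by apply/measurable_EFinP; exact: ccont_measurable.
have f_ge0 p : (0 <= f p)%E by apply: erestrict_ge0 => q _; rewrite lee_fin cabs_ge0.
have If : (\int[mu2]_p f p <= r%:E)%E by rewrite -integral_mkcond.
have r0 : 0 <= r.
  by rewrite -lee_fin; apply: le_trans If; apply: integral_ge0 => p _.
set ax := complex.Re a; set ay := complex.Im a.
have inS x y : ax - d <= x <= ax + d -> ay - d <= y <= ay + d -> disk (Complex x y).
  by move=> hx hy; apply/(@disk2P _ (x, y))/(square2_sub dd); split; rewrite /= in_itv.
have sx x : ax - d <= x <= ax + d ->
    (fubini_F mu f x = \int[mu]_(y in `[(ay - d)%R, (ay + d)%R]) (cabs (vline g x y))%:E)%E.
  move=> hx; rewrite /fubini_F [RHS]integral_mkcond; apply: eq_integral => y _.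
  rewrite /f !patchE; congr (if _ then _ else _).
  by rewrite /square2; apply/idP/idP; rewrite !inE /= !in_itv /= => -[]// _ ->.
have sy y : ay - d <= y <= ay + d ->
    (fubini_G mu f y = \int[mu]_(x in `[(ax - d)%R, (ax + d)%R]) (cabs (hline g y x))%:E)%E.
  move=> hy; rewrite /fubini_G [RHS]integral_mkcond; apply: eq_integral => x _.
  rewrite /f !patchE; congr (if _ then _ else _).
  by rewrite /square2; apply/idP/idP; rewrite !inE /= !in_itv /= => -[]// -> _.
have F1 := fubini_tonelli1 f mf f_ge0.
have F2 := fubini_tonelli2 f mf f_ge0.
have mF : measurable_fun setT (fubini_F mu f) by apply: measurable_fun_fubini_tonelli_F.
have mG : measurable_fun setT (fubini_G mu f) by apply: measurable_fun_fubini_tonelli_G.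
apply/ler_addgt0Pr => e e0.
(* Each side is sought in a slab of width d/2, and c * (d/2) exceeds [r] strictly, as the pigeonhole
   principle demands. The final bound is 4c/d = 8r/d^2 + e. *)
pose c := 2 * r / d + d * e / 4.
have c0 : 0 < c by rewrite ltr_wpDl ?divr_ge0 ?mulr_ge0 ?mulr_gt0 ?divr_gt0// ltW.
have cI (I : \bar R) : (I <= r%:E)%E -> (I < (c * (d / 2))%:E)%E.
  move=> Ir; apply: le_lt_trans Ir _; rewrite lte_fin /c.
  rewrite (_ : (2 * r / d + d * e / 4) * (d / 2) = r + d ^+ 2 * e / 8); last by field; rewrite gt_eqF.
  by rewrite ltrDl divr_gt0// mulr_gt0// exprn_gt0.
have d2 : 0 < d / 2 by rewrite divr_gt0.
have pg (h : R -> \bar R) (p : R) : measurable_fun setT (h : measurableTypeR R -> \bar R) ->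
    (forall x, (0 <= h x)%E) -> (\int[mu]_x h x <= r%:E)%E ->
    exists2 x, p <= x <= p + d / 2 & (h x < c%:E)%E.
  move=> mh h0 /cI hI; apply: pigeonhole => //; first by rewrite ltrDl.
  by rewrite addrAC subrr add0r.
have F0 x : (0 <= fubini_F mu f x)%E by apply: integral_ge0 => y _.
have G0 x : (0 <= fubini_G mu f x)%E by apply: integral_ge0 => y _.
have IF : (\int[mu]_x fubini_F mu f x <= r%:E)%E by rewrite -F1.
have IG : (\int[mu]_x fubini_G mu f x <= r%:E)%E by rewrite -F2.
(* The four slabs are the outer halves on each side of [a], so every side of the rectangle is at
   distance at least d/2 from [a], and the kernel is at most 2/d there. *)
have [x0 hx0 cx0] := pg _ (ax - d) mF F0 IF.
have [x1 hx1 cx1] := pg _ (ax + d / 2) mF F0 IF.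
have [y0 hy0 cy0] := pg _ (ay - d) mG G0 IG.
have [y1 hy1 cy1] := pg _ (ay + d / 2) mG G0 IG.
have bx0 : ax - d <= x0 <= ax + d by clear -hx0 d2; lra.
have bx1 : ax - d <= x1 <= ax + d by clear -hx1 d2; lra.
have by0 : ay - d <= y0 <= ay + d by clear -hy0 d2; lra.
have by1 : ay - d <= y1 <= ay + d by clear -hy1 d2; lra.
rewrite (sx _ bx0) in cx0; rewrite (sx _ bx1) in cx1.
rewrite (sy _ by0) in cy0; rewrite (sy _ by1) in cy1.
have lx t : x0 <= t <= x1 -> ax - d <= t <= ax + d by clear -bx0 bx1; lra.
have ly t : y0 <= t <= y1 -> ay - d <= t <= ay + d by clear -by0 by1; lra.
have hxa : x0 < complex.Re a < x1 by rewrite -/ax; clear -hx0 hx1 d2; lra.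
have hya : y0 < complex.Im a < y1 by rewrite -/ay; clear -hy0 hy1 d2; lra.
have [x01 y01] : x0 <= x1 /\ y0 <= y1 by clear -hx0 hx1 hy0 hy1 d2; lra.
have CF : rint (fun z => g z * (z - a)^-1) x0 x1 y0 y1 = twopii R * g a.
  apply: cauchy_formula => // x y hx hy; exists (cD g (Complex x y)).
  by apply: holo_hasD => //; apply: inS; [exact: lx|exact: ly].
have far x y : d / 2 <= `|x - ax| \/ d / 2 <= `|y - ay| -> d / 2 <= cabs (Complex x y - a).
  have h1 := cabs_Re (Complex x y - a); have h2 := cabs_Im (Complex x y - a).
  by move: h1 h2; rewrite /ax /ay; case: (a) => ? ? /= h1 h2 [h|h]; [exact: le_trans h h1|exact: le_trans h h2].
have kb x y : d / 2 <= `|x - ax| \/ d / 2 <= `|y - ay| ->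
    cabs (g (Complex x y) * (Complex x y - a)^-1) <= 2 / d * cabs (g (Complex x y)).
  move=> /far h; rewrite cabsM mulrC ler_wpM2r ?cabs_ge0// cabsV -[2 / d]invf_div lef_pV2 ?posrE//.
  by apply: lt_le_trans h.
have ck x y : ax - d <= x <= ax + d -> ay - d <= y <= ay + d ->
    d / 2 <= `|x - ax| \/ d / 2 <= `|y - ay| ->
    ccont (fun z => g z * (z - a)^-1) (Complex x y).
  move=> hx hy /far h; apply: hasD_ccont.
  apply: (hasDM (holo_hasD gh (inS x y hx hy)) (hasD_inv_sub _)).
  by rewrite -subr_eq0 -cabs_gt0; apply: lt_le_trans h.
have farx0 : d / 2 <= `|x0 - ax| by rewrite ler_normr; apply/orP; right; clear -hx0 d2; lra.
have farx1 : d / 2 <= `|x1 - ax| by rewrite ler_normr; apply/orP; left; clear -hx1 d2; lra.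
have fary0 : d / 2 <= `|y0 - ay| by rewrite ler_normr; apply/orP; right; clear -hy0 d2; lra.
have fary1 : d / 2 <= `|y1 - ay| by rewrite ler_normr; apply/orP; left; clear -hy1 d2; lra.
have q0 : 0 <= 2 / d by rewrite divr_ge0// ltW.
have meas (h : R -> R[i]) A B : contw h A B ->
    measurable_fun `[A, B] ((fun x => cabs (h x)) : measurableTypeR R -> R).
  by move=> ch; have := measurable_int mu (contw_int cabs_lip ch); move/measurable_EFinP.
have B1 y : ay - d <= y <= ay + d -> d / 2 <= `|y - ay| ->
   (\int[mu]_(x in `[(ax - d)%R, (ax + d)%R]) (cabs (hline g y x))%:E < c%:E)%E ->
   cabs (cint (hline (fun z => g z * (z - a)^-1) y) x0 x1) <= 2 * (2 / d * c).
  move=> hy fy hI; apply: (@cint_le_int _ _ (fun x => cabs (hline g y x)) _ _ (ax - d) (ax + d)) => //; [by case/andP: bx0|by case/andP: bx1| | | | |].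
  - by apply: ccont_hline => x hx; apply: ck; [exact: lx|exact: hy|right].
  - by move=> x hx; apply: kb; right.
  - by move=> x; exact: cabs_ge0.
  - by apply: meas; apply: ccont_hline => x hx; apply: cg; exact: inS.
  - exact: ltW.
have B2 x : ax - d <= x <= ax + d -> d / 2 <= `|x - ax| ->
   (\int[mu]_(y in `[(ay - d)%R, (ay + d)%R]) (cabs (vline g x y))%:E < c%:E)%E ->
   cabs (cint (vline (fun z => g z * (z - a)^-1) x) y0 y1) <= 2 * (2 / d * c).
  move=> hy fy hI; apply: (@cint_le_int _ _ (fun y => cabs (vline g x y)) _ _ (ay - d) (ay + d)) => //; [by case/andP: by0|by case/andP: by1| | | | |].
  - by apply: ccont_vline => y hx; apply: ck; [exact: hy|exact: ly|left].
  - by move=> y hx; apply: kb; left.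
  - by move=> y; exact: cabs_ge0.
  - by apply: meas; apply: ccont_vline => y hx; apply: cg; exact: inS.
  - exact: ltW.
have t4 := twopii_ge4 R.
have : cabs (twopii R * g a) <= 4 * (2 * (2 / d * c)).
  rewrite -CF /rint; apply: le_trans (cabsD _ _) _; rewrite cabsM.
  have -> : cabs 'i%C = 1 :> R by rewrite /cabs /= expr0n /= add0r expr1n sqrtr1.
  rewrite mul1r; apply: le_trans (lerD (cabsD _ _) (cabsD _ _)) _; rewrite !cabsN.
  rewrite (_ : 4 * (2 * (2 / d * c)) = (2 * (2 / d * c)) + (2 * (2 / d * c)) + ((2 * (2 / d * c)) + (2 * (2 / d * c)))); last by ring.
  by apply: lerD; apply: lerD; [exact: B1|exact: B1|exact: B2|exact: B2].
rewrite cabsM => H.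
have : 4 * cabs (g a) <= 4 * (2 * (2 / d * c)).
  by apply: le_trans H; rewrite ler_wpM2r ?cabs_ge0.
rewrite ler_pM2l// => H'; apply: le_trans H' _.
by apply: eqW; rewrite /c; field; rewrite gt_eqF.
Qed.

End AreaMean.

(** * Bloch bounds for Besov functions *)

Section BesovToBloch.
Variable R : realType.
Notation mu := (@lebesgue_measure R).
Notation RR := (measurableTypeR R * measurableTypeR R)%type.
Notation mu2 := (mu \x mu)%E.

Lemma area_intP (F : R[i] -> \bar R) (M : R) :
  (area_int F <= M%:E)%E =
  (\int[mu2]_(p in @disk2 R) F (Complex p.1 p.2) <= (pi * M)%:E)%E.
Proof. by rewrite /area_int lee_pdivrMl ?pi_gt0// EFinM. Qed.

Lemma area_int_ge0 (F : R[i] -> \bar R) : (forall z, (0 <= F z)%E) -> (0 <= area_int F)%E.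
Proof.
move=> F0; rewrite /area_int mule_ge0//; last by apply: integral_ge0 => p _; exact: F0.
by rewrite lee_fin invr_ge0 pi_ge0.
Qed.

Lemma weight_measurable (s : R) :
  measurable_fun (@disk2 R) (fun q : RR => powR (1 - cabs (Complex q.1 q.2) ^+ 2) s).
Proof.
apply: (measurableT_comp (measurable_powR s)).
apply: measurable_funB; first exact: measurable_cst.
apply: measurable_funX; apply: (@ccont_measurable _ id) => z _; exact: hasD_ccont (@hasD_id _ z).
Qed.

Lemma besov_measurable (f : R[i] -> R[i]) (p : R) : holo f ->
  measurable_fun (@disk2 R)
   (fun q : RR => powR (cabs (cD f (Complex q.1 q.2))) p * powR (1 - cabs (Complex q.1 q.2) ^+ 2) (p - 2)).
Proof.
move=> fh; apply: measurable_funM; last exact: weight_measurable.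
apply: (measurableT_comp (measurable_powR p)).
by apply: ccont_measurable => z dz; exact: hasD_ccont (holo_hasD (holo_cD fh) dz).
Qed.

Lemma le1_powR (t p : R) : 0 <= t -> 1 <= p -> t <= 1 + powR t p.
Proof.
move=> t0 p1; have [t1|t1] := leP t 1; first by apply: le_trans t1 _; rewrite lerDl powR_ge0.
by apply: le_trans (le1r_powR (ltW t1) p1) _; rewrite lerDr.
Qed.

(** The exponent, p - 2 in use, may have either sign: for s >= 0 monotonicity gives constant 1, for
    s < 0 it gives K^(-s). Their sum covers both. *)
Lemma powR_comparable (d tau s K : R) : 0 < d -> d <= tau -> tau <= K * d -> 0 < K ->
  powR d s <= (1 + powR K (- s)) * powR tau s.
Proof.
move=> d0 dt tK K0; have t0 : 0 < tau by apply: lt_le_trans dt.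
rewrite mulrDl mul1r.
have [s0|s0] := leP 0 s.
  apply: le_trans (_ : powR tau s <= _); last by rewrite lerDl mulr_ge0 ?powR_ge0.
  by apply: ge0_ler_powR => //; rewrite nnegrE ltW.
apply: le_trans (_ : powR K (- s) * powR tau s <= _); last by rewrite lerDr powR_ge0.
have s1 : 0 <= - s by rewrite oppr_ge0 ltW.
have : powR tau (- s) <= powR (K * d) (- s).
  by apply: ge0_ler_powR => //; rewrite nnegrE ?ltW// mulr_gt0.
rewrite (powRM _ (ltW K0) (ltW d0)) (powRN d) (powRN tau).
have D0 := powR_gt0 s d0; have T0 := powR_gt0 s t0.
by rewrite ler_pdivlMr// mulrC ler_pdivrMr.
Qed.

(** In place of Holder's inequality, t <= 1 + t^p is applied to t = d|f'|, with d comparable to 1 -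
    |a|. As d^p = d^2 d^(p-2) and d^(p-2) is comparable to the weight on the square, the integral of
    |f'| there is O(d), and [area_mean] concludes. *)
Lemma besov_int_bloch (p M : R) : 1 <= p -> 0 <= M -> exists C : R, forall f : R[i] -> R[i],
  holo f -> (besov_int p f <= M%:E)%E -> blochC C f.
Proof.
move=> p1 M0; pose k := 1 + powR 12 (- (p - 2)).
have k0 : 0 <= k by rewrite addr_ge0// powR_ge0.
exists (64 * (4 + k * (pi * M))) => f fh.
rewrite /besov_int area_intP => fM; split=> // a da.
have a1 : 0 < 1 - cabs a by move: da; rewrite /disk /=; lra.
pose d := (1 - cabs a) / 4; have d0 : 0 < d by rewrite divr_gt0.
have dd : 2 * d < 1 - cabs a by rewrite /d; lra.
pose W := fun q : RR => powR (cabs (cD f (Complex q.1 q.2))) p * powR (1 - cabs (Complex q.1 q.2) ^+ 2) (p - 2).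
have W0 q : 0 <= W q by rewrite mulr_ge0 ?powR_ge0.
have mS := square2_measurable a d.
have sub := square2_sub dd.
have mW : measurable_fun (square2 a d) W.
  apply: measurable_funS (sub) _; first exact: disk2_measurable.
  exact: besov_measurable.
have WM : (\int[mu2]_(q in square2 a d) (W q)%:E <= (pi * M)%:E)%E.
  rewrite -cDfE in fM; apply: le_trans fM; apply: ge0_subset_integral => //.
  - exact: disk2_measurable.
  - by apply/measurable_EFinP; exact: besov_measurable.
  - by move=> q _; rewrite lee_fin; exact: W0.
have key q : square2 a d q -> cabs (cD f (Complex q.1 q.2)) <= d^-1 + d * k * W q.
  move=> Sq; have nq := square2_near Sq.
  have dq : disk (Complex q.1 q.2) by apply/disk2P; exact: sub.
  set z := Complex q.1 q.2 in nq dq *; set t := cabs (cD f z).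
  have t0 : 0 <= t by exact: cabs_ge0.
  have c1 := cabsD (z - a) a; have c2 := cabsD (a - z) z; rewrite !subrK (cabsB a z) in c1 c2.
  have w1 := disk_sq_ge dq; have w2 := disk_sq_le dq.
  have h1 : d <= 1 - cabs z ^+ 2 by rewrite /d in nq *; lra.
  (* On the square |z - a| <= 2d while 1 - |a| = 4d, so 1 - |z| is at most 6d. *)
  have h2 : 1 - cabs z ^+ 2 <= 12 * d by rewrite /d in nq *; lra.
  have P := @powR_comparable d (1 - cabs z ^+ 2) (p - 2) 12 d0 h1 h2 (ltr0Sn _ 11).
  have T := @le1_powR (d * t) p (mulr_ge0 (ltW d0) t0) p1.
  rewrite powRM ?(ltW d0)// in T.
  have E : powR d p = d ^+ 2 * powR d (p - 2).
    rewrite -powR_mulrn ?(ltW d0)// -powRD; last by rewrite (gt_eqF d0) implybT.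
    by congr powR; ring.
  rewrite E in T.
  have : d * t <= 1 + d ^+ 2 * k * W q.
    apply: le_trans T _; rewrite lerD2l /W -/z -/t.
    rewrite -[leLHS]mulrA -[leRHS]mulrA; apply: ler_wpM2l; first by rewrite exprn_ge0// ltW.
    rewrite [leLHS]mulrC mulrCA; apply: ler_wpM2l; first exact: powR_ge0.
    exact: P.
  move=> H; rewrite -(ler_pM2l d0); apply: le_trans H _.
  by apply: eqW; field; rewrite gt_eqF.
have dk0 : 0 <= d * k by rewrite mulr_ge0// ltW.
have I1 : (\int[mu2]_(q in square2 a d) (cabs (cD f (Complex q.1 q.2)))%:E
   <= (4 * d + d * k * (pi * M))%:E)%E.
  apply: (@le_trans _ _ (\int[mu2]_(q in square2 a d) ((d^-1)%:E + (d * k)%:E * (W q)%:E))%E).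
    apply: ge0_le_integral => //.
    - by move=> q _; rewrite lee_fin cabs_ge0.
    - apply/measurable_EFinP; apply: measurable_funS (sub) _; first exact: disk2_measurable.
      by apply: ccont_measurable => z dz; exact: hasD_ccont (holo_hasD (holo_cD fh) dz).
    - apply: emeasurable_funD; first exact: measurable_cst.
      by apply: measurable_funeM; exact/measurable_EFinP.
  rewrite ge0_integralD//; last 3 first.
  - by move=> q _; rewrite lee_fin invr_ge0 ltW.
  - by move=> q _; rewrite -EFinM lee_fin mulr_ge0.
  - by apply: measurable_funeM; exact/measurable_EFinP.
  rewrite ge0_integralZl//; last 2 first.
  - exact/measurable_EFinP.
  - by move=> q _; rewrite lee_fin.
  rewrite EFinD; apply: leeD.
    apply: (@le_trans _ _ ((d^-1)%:E * (4 * d ^+ 2)%:E)%E).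
      by apply: eqW; rewrite -(square2_mu a d0); exact: integral_cst.
    rewrite -EFinM lee_fin; apply: eqW; field; by rewrite gt_eqF.
  by rewrite [leRHS]EFinM; apply: lee_wpmul2l => //; rewrite lee_fin.
have := area_mean (holo_cD fh) d0 dd I1 => H.
apply: le_trans (ler_pM (cabs_ge0 _) (ltW (disk_sq da)) H (disk_sq_le da)) _.
rewrite (_ : 1 - cabs a = 4 * d); last by rewrite /d; field.
by apply: eqW; field; rewrite gt_eqF.
Qed.

(** The area mean of f'' at scale 1 - |a| is of order (1 - |a|)^-2, which [bloch_of_deriv2]
    integrates. The constant depends on [f]: enough for the mapping property, while the unit ball is
    treated through atoms. *)
Lemma besov1_int_bloch (f : R[i] -> R[i]) : holo f -> (besov1_int f < +oo)%E ->
  exists C, blochC C f.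
Proof.
move=> fh f1.
have f0 : (0 <= besov1_int f)%E by apply: area_int_ge0 => z; rewrite lee_fin cabs_ge0.
pose M := fine (besov1_int f).
have M0 : 0 <= M by apply: fine_ge0.
have : (besov1_int f <= M%:E)%E by rewrite /M fineK// ge0_fin_numE.
rewrite /besov1_int area_intP -!cDfE => fM.
apply: (@bloch_of_deriv2 _ (128 * (pi * M))) => //.
  by rewrite mulr_ge0// mulr_ge0// pi_ge0.
move=> a da; have a1 : 0 < 1 - cabs a by move: da; rewrite /disk /=; lra.
pose d := (1 - cabs a) / 4; have d0 : 0 < d by rewrite divr_gt0.
have dd : 2 * d < 1 - cabs a by rewrite /d; lra.
have I1 : (\int[mu2]_(q in square2 a d) (cabs (cD (cD f) (Complex q.1 q.2)))%:E <= (pi * M)%:E)%E.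
  apply: le_trans fM; apply: ge0_subset_integral => //.
  - exact: square2_measurable.
  - exact: disk2_measurable.
  - apply/measurable_EFinP; apply: ccont_measurable => z dz.
    exact: hasD_ccont (holo_hasD (holo_cD (holo_cD fh)) dz).
  - by move=> q _; rewrite lee_fin cabs_ge0.
  - exact: square2_sub.
apply: le_trans (area_mean (holo_cD (holo_cD fh)) d0 dd I1) _.
by rewrite /d; apply: eqW; field; rewrite gt_eqF.
Qed.

Lemma sub_conj_id (w z : R[i]) : cabs (1 - Num.conj w * z) ^+ 2 =
  cabs (w - z) ^+ 2 + (1 - cabs w ^+ 2) * (1 - cabs z ^+ 2).
Proof.
rewrite conjcE !cabs_sq; case: w => a b; case: z => c d /=; ring.
Qed.

Lemma cabs_moebius_le (w z : R[i]) : disk w -> disk z -> cabs (moebius w z) <= 1.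
Proof.
move=> dw dz; rewrite /moebius cabsM cabsV ler_pdivrMr ?sub_conj_gt0// mul1r.
rewrite -(@ler_pXn2r _ 2) ?nnegrE ?cabs_ge0// sub_conj_id lerDl.
by rewrite mulr_ge0 ?ltW// disk_sq.
Qed.

(** Each atom has modulus at most 1 on the disk, so partial sums are dominated by the sum of the
    coefficients. *)
Lemma B1_repr_bounded (f c : _) (S : R) : B1_repr f c ->
  (\sum_(0 <= j <oo) (cabs (c j : R[i]))%:E <= S%:E)%E ->
  forall z : R[i], disk z -> cabs (f z) <= S.
Proof.
move=> [w [dw [_ H]]] cS z dz; apply/ler_addgt0Pr => e e0.
have /cvg_cabs /(_ e e0) [N _ HN] := H z dz.
have := HN N.+1 (leqnSn N) => /=; set P := (\sum_(1 <= j < N.+1) _) => hP.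
have PS : cabs (c 0%N) + cabs P <= S.
  rewrite -lee_fin; apply: le_trans cS; apply: le_trans (nneseries_lim_ge N.+1 _); last first.
    by move=> n _ _; rewrite lee_fin cabs_ge0.
  rewrite sumEFin lee_fin big_nat_recl// lerD2l.
  apply: le_trans (cabs_sum _ _ _) _; rewrite big_add1 /=.
  apply: ler_sum => j _; rewrite cabsM ler_piMr ?cabs_ge0//.
  by apply: cabs_moebius_le.
have -> : f z = c 0%N + P - (P - (f z - c 0%N)) by ring.
apply: le_trans (cabsD _ _) _; rewrite cabsN; apply: lerD; last exact: ltW.
exact: le_trans (cabsD _ _) PS.
Qed.

Lemma besov_unit_ball (p : R) : 1 <= p -> exists C : R, forall f : R[i] -> R[i],
  besov p f -> (besov_norm p f <= 1)%E -> blochC C f /\ cabs (f 0) <= 2.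
Proof.
move=> p1; have [pE|pE] := eqVneq p 1.
  exists (cK R * 2) => f [fh _]; rewrite /besov_norm pE eqxx => f1.
  (* The infimum need not be attained; relaxing 1 to 2 yields an actual representation. *)
  have : (besov1_norm f < 2%:E)%E by apply: le_lt_trans f1 _; rewrite lte_fin ltr1n.
  move=> /ereal_inf_lt [_ [c fc <-]] cS.
  have fb := B1_repr_bounded fc (ltW cS).
  by split; [exact: blochC_bounded|exact: fb (@disk0 R)].
have [C HC] := @besov_int_bloch p 1 p1 ler01; exists C => f [fh].
rewrite /besov_norm (negbTE pE) => fI; rewrite lee_fin => fN.
have f0 : (0 <= besov_int p f)%E.
  by apply: area_int_ge0 => z; rewrite lee_fin mulr_ge0 ?powR_ge0.
have P0 := powR_ge0 (fine (besov_int p f)) p^-1.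
have c0 := cabs_ge0 (f 0).
split; last lra.
apply: HC => //; rewrite -[besov_int p f]fineK ?ge0_fin_numE// lee_fin leNgt.
apply/negP => I1.
have : 1 < powR (fine (besov_int p f)) p^-1; last lra.
have p0 : 0 < p^-1 by rewrite invr_gt0; lra.
have := @gt0_ltr_powR _ _ p0 1 (fine (besov_int p f)); rewrite powR1; apply; rewrite ?nnegrE//.
by rewrite ltW// (lt_trans ltr01).
Qed.

Lemma besov_bloch (p : R) f : 1 <= p -> besov p f -> exists C : R, blochC C f.
Proof.
move=> p1 [fh]; case: ifPn => [_ |_ fI]; first exact: besov1_int_bloch.
have f0 : (0 <= besov_int p f)%E.
  by apply: area_int_ge0 => z; rewrite lee_fin mulr_ge0 ?powR_ge0.
have [C HC] := @besov_int_bloch p (fine (besov_int p f)) p1 (fine_ge0 f0).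
by exists C; apply: HC => //; rewrite fineK// ge0_fin_numE.
Qed.

End BesovToBloch.

(** * One-variable integrals with explicit primitives *)

Section IntBounds.
Variable R : realType.
Notation mu := (@lebesgue_measure R).
Implicit Types (a b B : R).

(* [g] may be unbounded at the end points. *)
Lemma integral_oo_le (G g : R -> R) a b B :
  (forall x : R, a < x < b -> is_derive x 1 G (g x)) ->
  (forall x : R, a < x < b -> {for x, continuous g}) ->
  (forall x, a < x < b -> 0 <= g x) ->
  (forall x, a < x < b -> `|G x| <= B) ->
  0 <= B -> (\int[mu]_(x in `]a, b[) (g x)%:E <= (2 * B)%:E)%E.
Proof.
move=> dG cg g0 GB B0.
have [ab|ba] := ltP a b; last first.
  rewrite set_itv_ge ?integral_set0 ?lee_fin ?mulr_ge0//.
  by rewrite -leNgt bnd_simp.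
(* Exhaustion by closed intervals, on which the fundamental theorem applies; the 3 keeps all of them
   nondegenerate from n = 0 on. *)
pose e n : R := (b - a) / (n%:R + 3).
have d0 : 0 < b - a by rewrite subr_gt0.
have n0 n : 0 < n%:R + 3 :> R by rewrite ltr_wpDl.
have e0 n : 0 < e n by rewrite divr_gt0.
have eb n : 3 * e n <= b - a.
  rewrite /e mulrCA ler_piMr ?(ltW d0)// ler_pdivrMr// mul1r lerDr//.
have inn n x : a + e n <= x <= b - e n -> a < x < b.
  by have := e0 n => h /andP[h1 h2]; apply/andP; split; lra.
pose F n : set R := `[a + e n, b - e n].
have FE : \bigcup_n F n = `]a, b[.
  apply/seteqP; split=> x.
    by move=> [n _]; rewrite /F /= !in_itv /=; exact: inn.
  rewrite /= in_itv /= => /andP[ax xb].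
  pose m := Num.min (x - a) (b - x).
  have m0 : 0 < m by rewrite lt_min !subr_gt0 ax xb.
  have [k _ Hk] := near_infty_natSinv_lt (PosNum (divr_gt0 m0 d0)).
  exists k => //; rewrite /F /= in_itv /=.
  have km : e k <= m.
    have /= := Hk k (leqnn k); rewrite ltr_pdivlMr// => /ltW; apply: le_trans.
    rewrite /e mulrC ler_wpM2r ?(ltW d0)// lef_pV2 ?posrE//.
    by rewrite -natr1; lra.
  have : m <= x - a by rewrite ge_min lexx.
  have : m <= b - x by rewrite ge_min lexx orbT.
  by move=> h1 h2; apply/andP; split; lra.
have mg : measurable_fun `]a, b[ (EFin \o g).
  apply/measurable_EFinP; apply: open_continuous_measurable_fun => // x.
  by rewrite inE /= in_itv /=; exact: cg.
have sF n : F n `<=` `]a, b[ by move=> x; rewrite /F /= !in_itv /=; exact: inn.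
have mgF n : measurable_fun (F n) (EFin \o g) by apply: measurable_funS (sF n) mg.
have gF n x : F n x -> (0 <= (EFin \o g) x)%E.
  by rewrite /F /= in_itv /= lee_fin => /inn; exact: g0.
have ndF : nondecreasing_seq F.
  move=> m n mn; rewrite subsetEset => x; rewrite /F /= !in_itv /=.
  have : e n <= e m.
    by rewrite /e ler_wpM2l ?(ltW d0)// lef_pV2 ?posrE// lerD2r ler_nat.
  by move=> h /andP[h1 h2]; apply/andP; split; lra.
have C := @ge0_nondecreasing_set_cvg_integral _ (measurableTypeR R) R F (EFin \o g) mu ndF
  (fun n => measurable_itv _) mgF gF.
rewrite FE in C; rewrite -(cvg_lim _ C)//.
apply: lime_le; first by apply/cvg_ex; eexists; exact: C.
apply: nearW => n; rewrite /F.
have ln : a + e n < b - e n by have := eb n; have := e0 n; lra.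
rewrite (@continuous_FTC2 _ g G)//.
- have h1 := GB (b - e n) (inn n _ _); have h2 := GB (a + e n) (inn n _ _).
  rewrite -EFinB lee_fin.
  have := h1 _; have := h2 _; rewrite !lexx (ltW ln) /= => /(_ isT); rewrite ler_norml => /andP[h3 _].
  by move=> /(_ isT); rewrite ler_norml => /andP[_ h4]; lra.
- apply: continuous_in_subspaceT => x; rewrite inE /= in_itv /= => /inn; exact: cg.
- have cG x : a < x < b -> {for x, continuous G}.
    by move=> /dG[dx _]; apply: differentiable_continuous; apply/derivable1_diffP.
  split.
  + by move=> x; rewrite in_itv /= => /andP[/ltW h1 /ltW h2]; have [] := dG x (inn n x (introT andP (conj h1 h2))).
  + apply: cvg_at_right_filter; apply: cG; apply: (inn n); by rewrite lexx ltW.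
  + apply: cvg_at_left_filter; apply: cG; apply: (inn n); by rewrite lexx ltW.
- move=> x; rewrite in_itv /= derive1E => /andP[/ltW h1 /ltW h2].
  by have [_ ->] := dG x (inn n x (introT andP (conj h1 h2))).
Qed.

Lemma integral_oo_split (g : R -> R) a c b (M1 M2 : R) : a < c -> c < b ->
  measurable_fun `]a, b[ g -> (forall x, a < x < b -> 0 <= g x) ->
  (\int[mu]_(x in `]a, c[) (g x)%:E <= M1%:E)%E ->
  (\int[mu]_(x in `]c, b[) (g x)%:E <= M2%:E)%E ->
  (\int[mu]_(x in `]a, b[) (g x)%:E <= (M1 + M2)%:E)%E.
Proof.
move=> ac cb mg g0 I1 I2.
have s1 : `]a, c[ `<=` `]a, b[ by apply: subset_itvl; rewrite bnd_simp ltW.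
have s2 : `]c, b[ `<=` `]a, b[ by apply: subset_itvr; rewrite bnd_simp ltW.
have mE : measurable_fun `]a, b[ (EFin \o g) by exact/measurable_EFinP.
have Es : `]a, b[%classic `\ c = `]a, c[ `|` `]c, b[.
  apply/seteqP; split=> x /=; rewrite !in_itv /=.
    by move=> [/andP[-> ->] /eqP]; rewrite neq_lt => /orP[]->; [left|right].
  by move=> [] /andP[h1 h2]; split; [apply/andP; split; lra|move=> h; lra|apply/andP; split; lra|move=> h; lra].
have mD : measurable (`]a, b[%classic `\ c) by rewrite Es; exact: measurableU.
have mf : measurable_fun (`]a, b[%classic `\ c) (EFin \o g).
  by rewrite Es; apply: measurable_funS mE => // x [/s1|/s2].
rewrite -(@integral_setD1 _ (EFin \o g) c _ mD mf).
rewrite Es ge0_integral_setU//.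
- by rewrite EFinD; exact: leeD.
- by apply: measurable_funS mE => // x [/s1|/s2].
- by move=> x [/s1|/s2] /=; rewrite in_itv /= lee_fin; exact: g0.
- rewrite disj_set2E; apply/eqP/seteqP; split=> x //= -[]; rewrite !in_itv /=.
  by move=> /andP[_ h1] /andP[h2 _]; have := lt_trans h1 h2; rewrite ltxx.
Qed.

Lemma is_derive_powR (h : R -> R) (x dh a : R) : 0 < h x -> is_derive x 1 h dh ->
  is_derive x 1 (fun y => powR (h y) a) (a * powR (h x) (a - 1) * dh).
Proof.
move=> hx dhx.
exact: (@is_derive1_comp _ (fun y => powR y a) h x _ _ (is_derive1_powR a hx) dhx).
Qed.

Lemma is_derive_cont (h : R -> R) (x dh : R) : is_derive x 1 h dh -> {for x, continuous h}.
Proof. by case=> dx _; apply: differentiable_continuous; apply/derivable1_diffP. Qed.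

(** [s] is the constant sign, 1 or -1, of y - y0 on the interval: one computation serves both sides
    of [y0]. The same device is used in [radial_side]. *)
Lemma tail_side (d p y0 s a b : R) : 0 < d -> 1 < p -> s ^+ 2 = 1 ->
  (forall y, a < y < b -> 0 <= s * (y - y0)) ->
  (\int[mu]_(y in `]a, b[) (powR (d + `|y - y0|) (- p))%:E <= (2 * (powR d (1 - p) / (p - 1)))%:E)%E.
Proof.
move=> d0 p1 s1 H; have q0 : 0 < p - 1 by rewrite subr_gt0.
have Es y : a < y < b -> `|y - y0| = s * (y - y0).
  move=> /H h; apply/eqP; rewrite -(@eqrXn2 _ 2)//.
  by rewrite exprMn s1 mul1r real_normK// num_real.
pose h y := d + s * (y - y0).
have dh (y : R) : is_derive y 1 h s.
  by rewrite /h; apply: is_derive_eq; rewrite /GRing.scale /=; ring.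
have h0 y : a < y < b -> 0 < h y by move=> /H ?; rewrite /h ltr_pwDl.
pose G y := - (s / (p - 1)) * powR (h y) (1 - p).
pose g y := powR (h y) (- p).
rewrite (_ : (\int[mu]_(y in _) _)%E = (\int[mu]_(y in `]a, b[) (g y)%:E)%E); last first.
  by apply: eq_integral => y; rewrite inE /= in_itv /= => /Es; rewrite /g /h => ->.
apply: (@integral_oo_le G g a b _).
- move=> y yab; have dp := is_derive_powR (1 - p) (h0 y yab) (dh y).
  apply: is_derive_eq; rewrite /GRing.scale /= (_ : 1 - p - 1 = - p); last by ring.
  rewrite -/(g y); transitivity (s ^+ 2 * g y); last by rewrite s1 mul1r.
  by field; rewrite gt_eqF.
- by move=> y yab; exact: is_derive_cont (is_derive_powR (- p) (h0 y yab) (dh y)).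
- by move=> y _; exact: powR_ge0.
- move=> y yab; rewrite normrM normrN normrM (ger0_norm (powR_ge0 _ _)).
  have -> : `|s| = 1.
    by apply/eqP; rewrite -(@eqrXn2 _ 2)//; rewrite expr1n real_normK ?num_real// s1.
  rewrite gtr0_norm ?invr_gt0// mul1r [leRHS]mulrC ler_wpM2l ?invr_ge0 ?(ltW q0)//.
  have h1 := h0 y yab; rewrite (_ : 1 - p = - (p - 1)); last by ring.
  rewrite !powRN lef_pV2 ?posrE ?powR_gt0//.
  apply: ge0_ler_powR; rewrite ?nnegrE ?(ltW q0) ?(ltW d0) ?(ltW h1)//.
  by rewrite /h lerDl H.
- by rewrite divr_ge0 ?powR_ge0// ltW.
Qed.

Lemma tail_measurable (d p y0 : R) (D : set R) : measurable_fun D (fun y => powR (d + `|y - y0|) (- p)).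
Proof.
apply: measurable_funS (_ : measurable_fun setT _) => //.
apply: (measurableT_comp (measurable_powR (- p))).
apply: measurable_funD => //; apply: (measurableT_comp (@normr_measurable R setT)).
exact: measurable_funB.
Qed.

(** As |y0| <= 2, the point [y0] is interior to the interval and splits it; the interval also
    contains every coordinate of a point of the disk. *)
Lemma tail_bound (d p y0 : R) : 0 < d -> 1 < p -> `|y0| <= 2 ->
  (\int[mu]_(y in `](-3)%R, 3%R[) (powR (d + `|y - y0|) (- p))%:E <= (4 * (powR d (1 - p) / (p - 1)))%:E)%E.
Proof.
move=> d0 p1; rewrite ler_norml => /andP[y1 y2].
rewrite (_ : 4 * _ = 2 * (powR d (1 - p) / (p - 1)) + 2 * (powR d (1 - p) / (p - 1))); last by ring.
apply: (@integral_oo_split _ _ y0); [lra|lra|exact: tail_measurable|by move=> *; exact: powR_ge0| |].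
- apply: (@tail_side _ _ _ (-1)) => //; first by rewrite sqrrN expr1n.
  by move=> y /andP[_ h]; rewrite mulN1r; lra.
- apply: (@tail_side _ _ _ 1) => //; first by rewrite expr1n.
  by move=> y /andP[h _]; rewrite mul1r; lra.
Qed.

(* With [e = 1 - |z|^2], [d = 1 - |w|] and [D = |1 - conj w * z|], the Besov
   density of [alpha_w] is comparable to [d^p e^(p-2) / D^(2p)]. One factor
   [D^-p] is traded for [(d + e)^-p], which makes the radial part an exact
   derivative, and the other one for the decay [(d + |t - y0|)^-p] in a
   coordinate [t] of [z]. *)
Definition radial (d p e : R) := powR e (p - 2) * powR (d + e) (- p).

Lemma radial_ge0 d p e : 0 <= radial d p e.
Proof. by rewrite mulr_ge0 ?powR_ge0. Qed.

(** This is (e / (d + e))^(p-1) divided by d (p - 1); the derivative of e / (d + e) is d / (d +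
    e)^2. Since e / (d + e) is below 1, the bound is uniform in [e]. *)
Definition radial_prim (d p e : R) := powR e (p - 1) * powR (d + e) (1 - p) / (d * (p - 1)).

Lemma is_derive_radial (d p e : R) : 0 < d -> 1 < p -> 0 < e ->
  is_derive e 1 (radial_prim d p) (radial d p e).
Proof.
move=> d0 p1 e0; have q0 : 0 < p - 1 by rewrite subr_gt0.
have de : 0 < d + e by rewrite addr_gt0.
have dh : is_derive e 1 (fun e : R => d + e) 1.
  by have := is_deriveD (is_derive_cst d e 1) (is_derive_id e 1); rewrite add0r.
have d1 := is_derive_powR (p - 1) e0 (is_derive_id e 1).
have d2 := is_derive_powR (1 - p) de dh.
rewrite /radial_prim; apply: is_derive_eq; rewrite /GRing.scale /= /radial.
rewrite (_ : p - 1 - 1 = p - 2); last by ring.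
rewrite (_ : 1 - p - 1 = - p); last by ring.
have -> : powR e (p - 1) = e * powR e (p - 2).
  rewrite -{2}(powRr1 (ltW e0)) -powRD; last by rewrite (gt_eqF e0) implybT.
  by congr powR; ring.
have -> : powR (d + e) (1 - p) = (d + e) * powR (d + e) (- p).
  rewrite -{2}(powRr1 (ltW de)) -powRD; last by rewrite (gt_eqF de) implybT.
  by congr powR; ring.
by field; rewrite !gt_eqF.
Qed.

Lemma radial_prim_le (d p e : R) : 0 < d -> 1 < p -> 0 < e ->
  `|radial_prim d p e| <= (d * (p - 1))^-1.
Proof.
move=> d0 p1 e0; have q0 : 0 < p - 1 by rewrite subr_gt0.
have de : 0 < d + e by rewrite addr_gt0.
have D0 : 0 < (d * (p - 1))^-1 by rewrite invr_gt0 mulr_gt0.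
rewrite ger0_norm; last by rewrite mulr_ge0 ?mulr_ge0 ?powR_ge0// ltW.
rewrite ler_piMl ?(ltW D0)// (_ : 1 - p = - (p - 1)); last by ring.
rewrite powRN ler_pdivrMr ?powR_gt0// mul1r.
by apply: ge0_ler_powR; rewrite ?nnegrE ?(ltW q0) ?(ltW e0) ?(ltW de)// lerDr ltW.
Qed.

Lemma radial_side (d p T s a b : R) : 0 < d -> 1 < p -> s ^+ 2 = 1 ->
  (forall x, a < x < b -> 0 <= s * x /\ x ^+ 2 < T) ->
  (\int[mu]_(x in `]a, b[) (`|x| * radial d p (T - x ^+ 2))%:E <= ((d * (p - 1))^-1)%:E)%E.
Proof.
move=> d0 p1 s1 H; have q0 : 0 < p - 1 by rewrite subr_gt0.
have D0 : 0 < (d * (p - 1))^-1 by rewrite invr_gt0 mulr_gt0.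
have Es x : a < x < b -> `|x| = s * x.
  move=> /H[h _]; apply/eqP; rewrite -(@eqrXn2 _ 2)//.
  by rewrite exprMn s1 mul1r real_normK// num_real.
pose h (x : R) := T - x ^+ 2.
have dh (x : R) : is_derive x 1 h (- (2 * x)).
  by rewrite /h; apply: is_derive_eq; rewrite /GRing.scale /=; ring.
have h0 x : a < x < b -> 0 < h x by move=> /H[_ ?]; rewrite /h subr_gt0.
pose G x := - (s / 2) * radial_prim d p (h x).
pose g x := s * x * radial d p (h x).
rewrite (_ : (\int[mu]_(y in _) _)%E = (\int[mu]_(y in `]a, b[) (g y)%:E)%E); last first.
  by apply: eq_integral => y; rewrite inE /= in_itv /= => /Es; rewrite /g /h => ->.
rewrite (_ : (d * (p - 1))^-1 = 2 * (2^-1 * (d * (p - 1))^-1)); last by rewrite mulrA divff ?mul1r.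
apply: (@integral_oo_le G g a b _).
- move=> y yab.
  have dp := @is_derive1_comp _ (radial_prim d p) h y _ _ (is_derive_radial d0 p1 (h0 y yab)) (dh y).
  have dp' : is_derive y 1 (fun y => radial_prim d p (h y)) (radial d p (h y) * - (2 * y)) by exact: dp.
  apply: is_derive_eq; rewrite /GRing.scale /= /g; by field.
- move=> y yab; have hy := h0 y yab; rewrite /g /radial.
  apply: (@continuousM _ _ (fun y => s * y)); first by apply: continuousM; [exact: cst_continuous|].
  have dk : is_derive y 1 (fun y => d + h y) (- (2 * y)).
    by have := is_deriveD (is_derive_cst d y 1) (dh y); rewrite add0r.
  apply: continuousM; first exact: is_derive_cont (is_derive_powR _ hy (dh y)).
  have hk : 0 < (fun y => d + h y) y by rewrite addr_gt0.
  exact: is_derive_cont (@is_derive_powR (fun y => d + h y) y _ (- p) hk dk).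
- by move=> y /H[h1 _]; rewrite mulr_ge0 ?radial_ge0.
- move=> y yab; rewrite normrM normrN normrM.
  have -> : `|s| = 1.
    by apply/eqP; rewrite -(@eqrXn2 _ 2)//; rewrite expr1n real_normK ?num_real// s1.
  rewrite mul1r ger0_norm ?invr_ge0// ler_wpM2l ?invr_ge0//.
  exact: radial_prim_le d0 p1 (h0 y yab).
- by rewrite mulr_ge0 ?(ltW D0).
Qed.

Lemma radial_measurable1 (d p T : R) (D : set R) :
  measurable_fun D (fun x : R => `|x| * radial d p (T - x ^+ 2)).
Proof.
apply: measurable_funS (_ : measurable_fun setT _) => //.
apply: measurable_funM; first exact: normr_measurable.
have mT : measurable_fun setT (fun x : R => T - x ^+ 2).
  by apply: measurable_funB => //; apply: measurable_funX.
apply: measurable_funM; first exact: (measurableT_comp (measurable_powR _)).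
by apply: (measurableT_comp (measurable_powR _)); exact: measurable_funD.
Qed.

Lemma radial_bound (d p S : R) : 0 < d -> 1 < p -> 0 < S ->
  (\int[mu]_(x in `](- S)%R, S[) (`|x| * radial d p (S ^+ 2 - x ^+ 2))%:E <= (2 * (d * (p - 1))^-1)%:E)%E.
Proof.
move=> d0 p1 S0; have NS : - S < 0 by rewrite oppr_lt0.
rewrite mulr_natl mulr2n.
have sq x : - S < x < S -> x ^+ 2 < S ^+ 2.
  by rewrite -ltr_norml => h; rewrite -[x ^+ 2]real_normK ?num_real// ltrXn2r// ?normr_ge0.
apply: (@integral_oo_split _ _ 0) => //; first exact: radial_measurable1.
- by move=> x _; rewrite mulr_ge0 ?radial_ge0.
- apply: (@radial_side _ _ _ (-1)) => //; first by rewrite sqrrN expr1n.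
  move=> x /andP[h1 h2]; split; first by rewrite mulN1r; lra.
  by apply: sq; rewrite h1 (lt_trans h2).
- apply: (@radial_side _ _ _ 1) => //; first by rewrite expr1n.
  move=> x /andP[h1 h2]; split; first by rewrite mul1r; lra.
  by apply: sq; rewrite h2 (lt_trans NS).
Qed.
End IntBounds.

(** * Tonelli's theorem for the disk, chord by chord *)

Section DiskTonelli.
Variable R : realType.
Notation mu := (@lebesgue_measure R).
Notation RR := (measurableTypeR R * measurableTypeR R)%type.
Notation mu2 := (mu \x mu)%E.
Variables (h : R -> R -> R) (m : R -> R) (K L : R).
Hypothesis h0 : forall s t, 0 <= h s t.
Hypothesis m0 : forall t, 0 <= m t.
Hypothesis mm : measurable_fun setT m.
Hypothesis K0 : 0 <= K.
Hypothesis hK : forall S t : R, 0 < S -> S ^+ 2 = 1 - t ^+ 2 ->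
  (\int[mu]_(s in `](- S)%R, S[) (h s t)%:E <= (K * m t)%:E)%E.
Hypothesis mL : (\int[mu]_(t in `](-3)%R, 3%R[) (m t)%:E <= L%:E)%E.

(** The section at height [t] is a chord of half-length sqrt(1 - t^2), or empty when t^2 >= 1.
    Extending the outer variable to ]-3, 3[ matches the interval of [tail_bound]. *)
Lemma disk_section_le (t : R) (f : R -> \bar R) :
  (forall s, s ^+ 2 + t ^+ 2 < 1 -> f s = (h s t)%:E) ->
  (forall s, ~ s ^+ 2 + t ^+ 2 < 1 -> f s = 0%E) ->
  (\int[mu]_s f s <= ((fun t => (K * m t)%:E) \_ `](-3)%R, 3%R[) t)%E.
Proof.
move=> f1 f2; have [t1|t1] := ltP (t ^+ 2) 1; last first.
  rewrite (_ : (\int[mu]_s f s)%E = 0%E); last first.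
    rewrite integral0_eq// => s _; apply: f2; have := sqr_ge0 s; lra.
  by apply: erestrict_ge0 => s _; rewrite lee_fin mulr_ge0.
pose S := Num.sqrt (1 - t ^+ 2); have S0 : 0 < S by rewrite sqrtr_gt0 subr_gt0.
have SE : S ^+ 2 = 1 - t ^+ 2 by rewrite sqr_sqrtr// subr_ge0 ltW.
rewrite (_ : (\int[mu]_s f s)%E = (\int[mu]_(s in `](- S)%R, S[) (h s t)%:E)%E); last first.
  rewrite [RHS]integral_mkcond; apply: eq_integral => s _ /=; rewrite patchE.
  have sE : (s ^+ 2 + t ^+ 2 < 1) = (- S < s < S).
    rewrite -ltr_norml -[s ^+ 2]real_normK ?num_real//.
    by rewrite -[RHS](@ltr_pXn2r _ 2) ?nnegrE ?normr_ge0 ?(ltW S0)// SE ltrBrDr.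
  case: ifPn => [|ns].
    by rewrite inE /= in_itv /= -sE; exact: f1.
  by apply: f2; rewrite sE => hs; move: ns; rewrite notin_setE /= in_itv /=; apply.
rewrite patchE mem_set; first exact: hK.
rewrite /= in_itv /= -ltr_norml; apply: (@lt_trans _ _ 1); last by rewrite ltr1n.
by rewrite -(@ltr_pXn2r _ 2) ?nnegrE ?normr_ge0// real_normK ?num_real// expr1n.
Qed.

Let Km_le : (\int[mu]_t ((fun t => (K * m t)%:E) \_ `](-3)%R, 3%R[) t <= (K * L)%:E)%E.
Proof.
rewrite -integral_mkcond EFinM.
have mm' : measurable_fun `](-3 : R), 3[ (EFin \o m).
  by apply/measurable_EFinP; exact: measurable_funS mm.
rewrite (_ : (\int[mu]_(t in _) _)%E = (K%:E * \int[mu]_(t in `](-3)%R, 3%R[) (m t)%:E)%E).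
  by apply: lee_wpmul2l; rewrite ?lee_fin.
rewrite -ge0_integralZl//; last by move=> t _; rewrite lee_fin.
Qed.

Let mKm : measurable_fun setT ((fun t => (K * m t)%:E) \_ `](-3 : R), 3[).
Proof.
apply/(measurable_restrictT _ (measurable_itv _)); apply/measurable_EFinP.
by apply: measurable_funM => //; exact: measurable_funS mm.
Qed.

Lemma disk2_iter_x : measurable_fun (@disk2 R) (fun q : RR => h q.1 q.2) ->
  (\int[mu2]_(q in @disk2 R) (h q.1 q.2)%:E <= (K * L)%:E)%E.
Proof.
move=> mh; rewrite integral_mkcond; set f := (f in (\int[_]_q f q)%E).
have mf : measurable_fun setT f.
  by apply/(measurable_restrictT _ (@disk2_measurable R)); apply/measurable_EFinP.
have f0 q : (0 <= f q)%E by apply: erestrict_ge0 => ? _; rewrite lee_fin.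
rewrite (fubini_tonelli2 f mf f0); apply: le_trans Km_le.
apply: ge0_le_integral => //.
- by move=> t _; apply: integral_ge0.
- by apply: measurable_fun_fubini_tonelli_G.
- move=> t _; apply: disk_section_le => s hs; rewrite /f patchE.
    by rewrite mem_set.
  by rewrite memNset.
Qed.

Lemma disk2_iter_y : measurable_fun (@disk2 R) (fun q : RR => h q.2 q.1) ->
  (\int[mu2]_(q in @disk2 R) (h q.2 q.1)%:E <= (K * L)%:E)%E.
Proof.
move=> mh; rewrite integral_mkcond; set f := (f in (\int[_]_q f q)%E).
have mf : measurable_fun setT f.
  by apply/(measurable_restrictT _ (@disk2_measurable R)); apply/measurable_EFinP.
have f0 q : (0 <= f q)%E by apply: erestrict_ge0 => ? _; rewrite lee_fin.
rewrite (fubini_tonelli1 f mf f0); apply: le_trans Km_le.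
apply: ge0_le_integral => //.
- by move=> t _; apply: integral_ge0.
- by apply: measurable_fun_fubini_tonelli_F.
- move=> t _; apply: disk_section_le => s hs; rewrite /f patchE.
    by rewrite mem_set// /disk2 /= addrC.
  by rewrite memNset// /disk2 /= addrC.
Qed.
End DiskTonelli.

(** * Besov norms of disk automorphisms *)

Section Moebius.
Variable R : realType.
Notation mu := (@lebesgue_measure R).
Notation RR := (measurableTypeR R * measurableTypeR R)%type.
Notation mu2 := (mu \x mu)%E.
Implicit Types (w z : R[i]).

Lemma sub_conj_neq0 w z : disk w -> disk z -> 1 - Num.conj w * z != 0.
Proof. by move=> dw dz; rewrite -cabs_gt0 sub_conj_gt0. Qed.

Lemma hasD_sub_conj w z : hasD (fun u => 1 - Num.conj w * u) z (- Num.conj w).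
Proof.
have := hasDB (@hasD_cst _ 1 z) (hasDM (@hasD_cst _ (Num.conj w) z) (@hasD_id _ z)).
by rewrite mul0r mulr1 !add0r.
Qed.

Lemma cabs_1sub (x : R) : cabs (1 - x%:C%C) = `|1 - x|.
Proof. by rewrite -cabs_real rmorphB rmorph1. Qed.

Definition moebius' w z : R[i] := - (1 - w * Num.conj w) / (1 - Num.conj w * z) ^+ 2.

Lemma hasD_moebius w z : disk w -> disk z -> hasD (moebius w) z (moebius' w z).
Proof.
move=> dw dz; have D0 := sub_conj_neq0 dw dz.
have h1 := hasDB (@hasD_cst _ w z) (@hasD_id _ z).
have h2 := @hasD_comp _ (fun u => u^-1) (fun u => 1 - Num.conj w * u) z _ _ (hasDV D0) (hasD_sub_conj w z).
have -> : moebius' w z = (0 - 1) * (1 - Num.conj w * z)^-1 +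
    (w - z) * (- Num.conj w * - (1 - Num.conj w * z) ^- 2).
  by rewrite /moebius'; field.
exact: (hasDM h1 h2).
Qed.

Lemma holo_moebius w : disk w -> holo (moebius w).
Proof. by move=> dw; apply: (@hasD_holo _ _ (moebius' w)) => z; exact: hasD_moebius. Qed.

Lemma cD_moebius w z : disk w -> disk z -> cD (moebius w) z = moebius' w z.
Proof. by move=> dw dz; apply: hasD_cD; exact: hasD_moebius. Qed.

Lemma cabs_moebius' w z : disk w ->
  cabs (moebius' w z) = (1 - cabs w ^+ 2) / cabs (1 - Num.conj w * z) ^+ 2.
Proof.
move=> dw; rewrite /moebius' cabsM cabsN cabsV cabsX mul_conj.
by rewrite cabs_1sub gtr0_norm// disk_sq.
Qed.

Lemma hasD_moebius' w z : disk w -> disk z ->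
  hasD (moebius' w) z (- (1 - w * Num.conj w) * (2 * Num.conj w) / (1 - Num.conj w * z) ^+ 3).
Proof.
move=> dw dz; have D0 := sub_conj_neq0 dw dz.
have h2 := @hasD_comp _ (fun u => u^-1) (fun u => 1 - Num.conj w * u) z _ _ (hasDV D0) (hasD_sub_conj w z).
have h3 := hasDM (@hasD_cst _ (- (1 - w * Num.conj w)) z) (hasDM h2 h2).
have E u : moebius' w u = - (1 - w * Num.conj w) * ((1 - Num.conj w * u)^-1 * (1 - Num.conj w * u)^-1).
  by rewrite /moebius' expr2 invfM.
have -> : moebius' w = fun u => - (1 - w * Num.conj w) * ((1 - Num.conj w * u)^-1 * (1 - Num.conj w * u)^-1).
  by apply/funext => u; exact: E.
have -> : - (1 - w * Num.conj w) * (2 * Num.conj w) / (1 - Num.conj w * z) ^+ 3 =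
    0 * ((1 - Num.conj w * z)^-1 * (1 - Num.conj w * z)^-1) + - (1 - w * Num.conj w) *
      (- Num.conj w * - (1 - Num.conj w * z) ^- 2 * (1 - Num.conj w * z)^-1 +
      (1 - Num.conj w * z)^-1 * (- Num.conj w * - (1 - Num.conj w * z) ^- 2)).
  by field.
exact: h3.
Qed.

(** This degenerates as |w| tends to 1, but only finiteness of the B^1 integral is drawn from it;
    the uniform norm bound comes from the one-atom representation. *)
Lemma cD2_moebius w z : disk w -> disk z ->
  cabs (cD (cD (moebius w)) z) <= 4 / (1 - cabs w) ^+ 3.
Proof.
move=> dw dz; have dw1 : 0 < 1 - cabs w by move: dw; rewrite /disk /=; lra.
have dz1 : 0 < 1 - cabs z by move: dz; rewrite /disk /=; lra.
have -> : cD (cD (moebius w)) z = - (1 - w * Num.conj w) * (2 * Num.conj w) / (1 - Num.conj w * z) ^+ 3.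
  apply: hasD_cD; apply: (hasD_local dz1 _ (hasD_moebius' dw dz)) => u /disk_ball du.
  by rewrite cD_moebius.
rewrite cabsM cabsV cabsX cabsM cabsN mul_conj.
rewrite cabs_1sub gtr0_norm ?disk_sq//.
rewrite cabsM cabs_conj.
have -> : cabs (2 : R[i]) = 2 by rewrite -(rmorph_nat (real_complex R)) cabs_real normr_nat.
have D : 1 - cabs w <= cabs (1 - Num.conj w * z).
  apply: le_trans (cabs_sub_conj z w); rewrite lerD2l lerN2 ler_piMr ?cabs_ge0//.
  by apply: ltW.
have c0 := cabs_ge0 w; have c2 : 0 <= cabs w ^+ 2 by exact: sqr_ge0.
apply: ler_pM; rewrite ?invr_ge0 ?exprn_ge0 ?cabs_ge0//.
- by rewrite !mulr_ge0// ltW// disk_sq.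
- rewrite [leRHS](_ : 4 = 1 * 4); last by rewrite mul1r.
  by apply: ler_pM; rewrite ?mulr_ge0 ?(ltW (disk_sq dw))//; lra.
- rewrite lef_pV2 ?posrE ?exprn_gt0 ?(lt_le_trans dw1)//.
  by rewrite lerXn2r// nnegrE ?cabs_ge0// ltW.
Qed.

Lemma disk2_int_cst (c : R) : 0 <= c -> (\int[mu2]_(q in @disk2 R) c%:E <= (4 * c)%:E)%E.
Proof.
move=> c0; have sub : @disk2 R `<=` square2 0 1.
  move=> [x y]; rewrite /disk2 /square2 /= !in_itv /= => h.
  have hx := sqr_ge0 x; have hy := sqr_ge0 y.
  have n1 (t : R) : t ^+ 2 < 1 -> 0 - 1 <= t <= 0 + 1.
    move=> t1; rewrite sub0r add0r -ler_norml -(@ler_pXn2r _ 2) ?nnegrE ?normr_ge0//.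
    by rewrite real_normK ?num_real// expr1n ltW.
  by split; apply: n1; lra.
apply: (@le_trans _ _ (\int[mu2]_(q in square2 (0 : R[i])%R 1%R) c%:E)%E).
  apply: ge0_subset_integral => //; [exact: disk2_measurable|exact: square2_measurable].
apply: (@le_trans _ _ (c%:E * (4 * 1 ^+ 2)%R%:E)%E).
  by apply: eqW; rewrite -(square2_mu 0 ltr01); exact: integral_cst (square2_measurable 0 1) _.
by rewrite -EFinM lee_fin expr1n mulr1 mulrC.
Qed.

Lemma besov1_moebius w : disk w -> (besov1_int (moebius w) < +oo)%E.
Proof.
move=> dw; have dw1 : 0 < 1 - cabs w by move: dw; rewrite /disk /=; lra.
pose c := 4 / (1 - cabs w) ^+ 3.
have c0 : 0 <= c by rewrite divr_ge0// exprn_ge0// ltW.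
apply: (@le_lt_trans _ _ (pi^-1 * (4 * c))%:E); last by rewrite ltry.
rewrite /besov1_int area_intP (_ : pi * _ = 4 * c); last first.
  by rewrite mulVKf// gt_eqF// pi_gt0.
apply: le_trans (disk2_int_cst c0); rewrite -!cDfE.
apply: ge0_le_integral => //.
- exact: disk2_measurable.
- by move=> q _; rewrite lee_fin cabs_ge0.
- apply/measurable_EFinP; apply: ccont_measurable => z dz.
  exact: hasD_ccont (holo_hasD (holo_cD (holo_cD (holo_moebius dw))) dz).
- by move=> q /disk2P dq; rewrite lee_fin cD2_moebius.
Qed.

Lemma besov1_norm_moebius w : disk w -> (besov1_norm (moebius w) <= 1)%E.
Proof.
(* Index 0 is reserved for the constant term, so the single atom has index 1. *)
move=> dw; pose c := fun j : nat => if j == 1%N then 1 else 0 : R[i].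
have S : (\sum_(0 <= j <oo) (cabs (c j))%:E = 1)%E.
  apply: lim_near_cst => //.
  exists 2%N => // n /= n2; rewrite sumEFin; congr _%:E.
  rewrite big_ltn ?(ltn_trans _ n2)// big_ltn//.
  have -> : c 0%N = 0 by []. have -> : c 1%N = 1 by [].
  rewrite cabs0 cabs1 add0r big_nat big1 ?addr0// => j /andP[j2 _].
  by case: j j2 => // -[//|j] _; rewrite (_ : c _ = 0)// cabs0.
rewrite -S; apply: ereal_inf_lbound => /=; exists c => //.
exists (fun=> w); split=> //; split; first by rewrite S ltry.
move=> z dz; rewrite /c /= subr0; apply: cvg_near_cst.
exists 2%N => // n /= n2.
rewrite big_ltn// big_nat big1 ?addr0 ?mul1r// => j /andP[j2 _].
by case: j j2 => // -[//|j] _; rewrite mul0r.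
Qed.
(* [x0] and [y0] are the coordinates of the reflected point [1 / conj w], or [0]
   when [w] is near the origin. *)
Lemma sub_conj_lower w : disk w -> exists x0 y0 : R, [/\ `|x0| <= 2, `|y0| <= 2 &
  forall z, disk z ->
   (1 - cabs w) + `|complex.Re z - x0| <= 4 * cabs (1 - Num.conj w * z) /\
   (1 - cabs w) + `|complex.Im z - y0| <= 4 * cabs (1 - Num.conj w * z)].
Proof.
move=> dw; have w0 := cabs_ge0 w.
have [wl|ws] := leP (1 / 2) (cabs w); last first.
  exists 0, 0; rewrite normr0; split=> // z dz; rewrite !subr0.
  have D := cabs_sub_conj z w; have z1 := ltW dz; have z0 := cabs_ge0 z.
  have hx := cabs_Re z; have hy := cabs_Im z.
  have : cabs w * cabs z <= 1 / 2 by rewrite -[leRHS]mulr1 ler_pM// ltW.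
  by split; lra.
have w1 : 0 < cabs w by lra.
have wn : Num.conj w != 0 by rewrite -cabs_gt0 cabs_conj.
pose v := (Num.conj w)^-1.
have v2 : cabs v <= 2 by rewrite cabsV cabs_conj -[2]invrK lef_pV2 ?posrE ?invr_gt0//; lra.
exists (complex.Re v), (complex.Im v); split; [exact: le_trans (cabs_Re _) v2|exact: le_trans (cabs_Im _) v2|].
move=> z dz.
have D : cabs (z - v) <= 2 * cabs (1 - Num.conj w * z).
  have -> : 1 - Num.conj w * z = - (Num.conj w * (z - v)) by rewrite mulrBr mulfV//; ring.
  rewrite cabsN cabsM cabs_conj mulrA ler_peMl ?cabs_ge0//; lra.
have D1 : 1 - cabs w <= cabs (1 - Num.conj w * z).
  apply: le_trans (cabs_sub_conj z w); rewrite lerD2l lerN2 ler_piMr ?cabs_ge0//.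
  by apply: ltW.
have D0 := cabs_ge0 (1 - Num.conj w * z).
have hx := cabs_Re (z - v); have hy := cabs_Im (z - v).
have Ex : complex.Re (z - v) = complex.Re z - complex.Re v by case: (z) (v) => a b [].
have Ey : complex.Im (z - v) = complex.Im z - complex.Im v by case: (z) (v) => a b [].
by rewrite -Ex -Ey; split; lra.
Qed.

Definition besov_density (p : R) (w z : R[i]) :=
  powR (cabs (cD (moebius w) z)) p * powR (1 - cabs z ^+ 2) (p - 2).

(** The identity [sub_conj_id] gives |alpha_w'| (1 - |z|^2) <= 1. The bound is used only well inside
    the disk, where its right side is harmless. *)
Lemma besov_density_bloch (p : R) w z : 1 < p -> disk w -> disk z ->
  besov_density p w z <= (1 - cabs z ^+ 2) ^- 2.
Proof.
move=> p1 dw dz; have e0 := disk_sq dz.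
rewrite /besov_density cD_moebius//; set A := cabs _; set e := 1 - _.
have A0 : 0 <= A by exact: cabs_ge0.
have -> : powR e (p - 2) = powR e p * e ^- 2.
  by rewrite powRD ?(gt_eqF e0) ?implybT// powRN powR_mulrn// ltW.
rewrite mulrA -powRM ?(ltW e0)// ler_piMl ?invr_ge0 ?exprn_ge0 ?(ltW e0)//.
have Ae : A * e <= 1.
  rewrite /A cabs_moebius'// mulrAC ler_pdivrMr ?exprn_gt0 ?sub_conj_gt0// mul1r.
  by rewrite sub_conj_id lerDr sqr_ge0.
have -> : 1 = powR 1 p :> R by rewrite powR1.
by apply: ge0_ler_powR; rewrite ?nnegrE ?mulr_ge0 ?(ltW e0)//; lra.
Qed.

Lemma besov_density_tail (p t : R) w z : 1 < p -> disk w -> disk z ->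
  let d := 1 - cabs w in
  d + `|t| <= 4 * cabs (1 - Num.conj w * z) ->
  besov_density p w z <=
    powR 32 p * powR d p * radial d p (1 - cabs z ^+ 2) * powR (d + `|t|) (- p).
Proof.
move=> p1 dw dz d dt; have e0 := disk_sq dz; have ez := disk_sq_le dz.
have d0 : 0 < d by rewrite subr_gt0.
have p0 : 0 <= p by lra.
rewrite /besov_density cD_moebius// cabs_moebius'// /radial.
set D := cabs (1 - _) in dt *; set e := 1 - _ in e0 ez *.
have D0 : 0 < D by exact: sub_conj_gt0.
have w0 := cabs_ge0 w; have z0 := cabs_ge0 z.
have dz1 : 0 < 1 - cabs z by rewrite subr_gt0.
have De : d + e <= 4 * D.
  have h1 : d <= D.
    apply: le_trans (cabs_sub_conj z w); rewrite lerD2l lerN2 ler_piMr//; exact: ltW.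
  have h2 : 1 - cabs z <= D.
    apply: le_trans (cabs_sub_conj z w); rewrite lerD2l lerN2 ler_piMl//; exact: ltW.
  by lra.
have X0 : 0 < d + e by rewrite addr_gt0.
have Y0 : 0 < d + `|t| by rewrite ltr_pwDl.
(* 1 - |w|^2 is at most 2d, and d + e and d + |t| are each at most 4D, whence 32 = 2 * 16. *)
have key : (1 - cabs w ^+ 2) / D ^+ 2 <= 32 * d * ((d + e) * (d + `|t|))^-1.
  rewrite ler_pdivrMr ?exprn_gt0// mulrAC ler_pdivlMr ?mulr_gt0//.
  have h : (d + e) * (d + `|t|) <= (4 * D) * (4 * D) by apply: ler_pM => //; exact: ltW.
  have h' : 1 - cabs w ^+ 2 <= 2 * d by exact: disk_sq_le.
  apply: le_trans (ler_pM _ _ h' h) _; rewrite ?mulr_ge0 ?(ltW X0) ?(ltW Y0) ?(ltW (disk_sq dw))//.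
  by apply: eqW; ring.
have K : powR ((1 - cabs w ^+ 2) / D ^+ 2) p <=
    powR 32 p * powR d p * (powR (d + e) (- p) * powR (d + `|t|) (- p)).
  rewrite -!powRM ?(ltW X0) ?(ltW Y0) ?(ltW d0)//.
  have E0 : 0 < (d + e) * (d + `|t|) by rewrite mulr_gt0.
  rewrite -[- p]mulN1r powRrM powR_inv1 ?(ltW E0)// -powRM ?invr_ge0 ?mulr_ge0 ?(ltW X0) ?(ltW Y0) ?(ltW d0)//.
  apply: ge0_ler_powR => //; rewrite nnegrE.
    by rewrite divr_ge0 ?exprn_ge0 ?(ltW D0) ?(ltW (disk_sq dw)).
  by apply: mulr_ge0; rewrite ?invr_ge0 ?(ltW E0)// mulr_ge0 ?(ltW d0).
have -> : powR 32 p * powR d p * (powR e (p - 2) * powR (d + e) (- p)) * powR (d + `|t|) (- p) =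
  powR 32 p * powR d p * (powR (d + e) (- p) * powR (d + `|t|) (- p)) * powR e (p - 2) by ring.
by rewrite ler_wpM2r ?powR_ge0.
Qed.

(* The factor [|s|] is the Jacobian of [s |-> 1 - t^2 - s^2]; the density is
   dominated by this function wherever [|s| >= 1/2]. *)
Definition majorant (p d y0 s t : R) :=
  2 * powR 32 p * powR d p * (`|s| * radial d p (1 - t ^+ 2 - s ^+ 2)) * powR (d + `|t - y0|) (- p).

Lemma majorant_ge0 p d y0 s t : 0 <= majorant p d y0 s t.
Proof. by rewrite !mulr_ge0 ?radial_ge0 ?powR_ge0. Qed.

Lemma majorant_measurable p d y0 : measurable_fun setT (fun q : RR => majorant p d y0 q.1 q.2).
Proof.
have m1 : measurable_fun setT (fun q : RR => q.1 : R) by exact: measurable_fst.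
have m2 : measurable_fun setT (fun q : RR => q.2 : R) by exact: measurable_snd.
have me : measurable_fun setT (fun q : RR => 1 - q.2 ^+ 2 - q.1 ^+ 2 : R).
  by apply: measurable_funB; [apply: measurable_funB => //|]; exact: measurable_funX.
apply: measurable_funM.
  apply: measurable_funM => //; apply: measurable_funM.
    exact: (measurableT_comp (@normr_measurable R setT) m1).
  apply: measurable_funM; first exact: (measurableT_comp (measurable_powR _) me).
  by apply: (measurableT_comp (measurable_powR _)); exact: measurable_funD.
apply: (measurableT_comp (measurable_powR _)); apply: measurable_funD => //.
by apply: (measurableT_comp (@normr_measurable R setT)); exact: measurable_funB.
Qed.

Lemma majorant_section p d y0 (S t : R) : 0 < d -> 1 < p -> 0 < S -> S ^+ 2 = 1 - t ^+ 2 ->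
  (\int[mu]_(s in `](- S)%R, S[) (majorant p d y0 s t)%:E <=
   (4 * powR 32 p * powR d p / (d * (p - 1)) * powR (d + `|t - y0|) (- p))%:E)%E.
Proof.
move=> d0 p1 S0 SE; set m := powR (d + _) _.
pose c := 2 * powR 32 p * powR d p * m.
have c0 : 0 <= c by rewrite !mulr_ge0 ?powR_ge0.
rewrite (_ : (\int[mu]_(s in _) _)%E =
   (c%:E * \int[mu]_(s in `](- S)%R, S[) (`|s| * radial d p (S ^+ 2 - s ^+ 2))%:E)%E).
  apply: (@le_trans _ _ (c%:E * (2 * (d * (p - 1))^-1)%:E)%E).
    by apply: lee_wpmul2l; rewrite ?lee_fin//; exact: radial_bound.
  by rewrite -EFinM lee_fin; apply: eqW; rewrite /c; ring.
rewrite -ge0_integralZl//.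
- apply: eq_integral => s _; rewrite -EFinM; congr _%:E.
  by rewrite /majorant SE /c -/m; ring.
- by apply/measurable_EFinP; exact: radial_measurable1.
- by move=> s _; rewrite lee_fin mulr_ge0 ?radial_ge0.
Qed.

(** The powers of [d] are d^p from the numerator, 1/d from the chord integral and d^(1-p) from the
    tail integral: they cancel, so the bound is uniform in [w]. *)
Lemma majorant_int p d y0 : 0 < d -> 1 < p -> `|y0| <= 2 ->
  (\int[mu2]_(q in @disk2 R) (majorant p d y0 q.1 q.2)%:E <= (16 * powR 32 p / (p - 1) ^+ 2)%:E)%E /\
  (\int[mu2]_(q in @disk2 R) (majorant p d y0 q.2 q.1)%:E <= (16 * powR 32 p / (p - 1) ^+ 2)%:E)%E.
Proof.
move=> d0 p1 y2; have q0 : 0 < p - 1 by rewrite subr_gt0.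
have -> : 16 * powR 32 p / (p - 1) ^+ 2 =
  4 * powR 32 p * powR d p / (d * (p - 1)) * (4 * (powR d (1 - p) / (p - 1))).
  have -> : powR d (1 - p) = d / powR d p.
    by rewrite powRB ?(gt_eqF d0) ?implybT// powRr1// ltW.
  have dp := powR_gt0 p d0; field; by rewrite !gt_eqF.
have K0 : 0 <= 4 * powR 32 p * powR d p / (d * (p - 1)).
  by rewrite divr_ge0 ?mulr_ge0 ?powR_ge0 ?(ltW d0) ?(ltW q0).
have m0 t : 0 <= powR (d + `|t - y0|) (- p) by exact: powR_ge0.
have mm : measurable_fun setT (fun t : R => powR (d + `|t - y0|) (- p)) by exact: tail_measurable.
have hK S t := @majorant_section p d y0 S t d0 p1.
have tL := tail_bound d0 p1 y2.
have mxy := majorant_measurable p d y0.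
split.
  apply: (disk2_iter_x (majorant_ge0 p d y0) m0 mm K0 hK tL).
  exact: measurable_funS mxy.
apply: (disk2_iter_y (majorant_ge0 p d y0) m0 mm K0 hK tL).
apply: (@measurable_funS _ _ _ _ setT) => //.
have sw : measurable_fun setT (fun q : RR => (q.2, q.1) : RR) by exact: measurable_swap.
exact: (measurableT_comp mxy sw).
Qed.

(** Where |x| >= 1/2 or |y| >= 1/2 the Jacobian can be inserted at the cost of a factor 2, with
    integration along that coordinate. Where both are smaller, 1 - |z|^2 >= 1/2 and the density is
    at most 4. *)
Lemma besov_density_le p w : 1 < p -> disk w -> exists x0 y0 : R, [/\ `|x0| <= 2, `|y0| <= 2 &
  forall z, disk z -> besov_density p w z <= 4 +
    (majorant p (1 - cabs w) y0 (complex.Re z) (complex.Im z) +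
     majorant p (1 - cabs w) x0 (complex.Im z) (complex.Re z))].
Proof.
move=> p1 dw; have [x0 [y0 [hx hy H]]] := sub_conj_lower dw; exists x0, y0; split=> // z dz.
set d := 1 - cabs w; set x := complex.Re z; set y := complex.Im z.
have [Hx Hy] := H z dz; rewrite -/d -/x -/y in Hx Hy.
have g1 := majorant_ge0 p d y0 x y; have g2 := majorant_ge0 p d x0 y x.
have ze : 1 - cabs z ^+ 2 = 1 - y ^+ 2 - x ^+ 2 by rewrite cabs_sq -/x -/y; ring.
have [xl|xs] := leP (1 / 2) `|x|.
  have := besov_density_tail p1 dw dz Hy; rewrite -/d ze.
  set P := _ * _ * _ * _ => hP.
  have P0 : 0 <= P by rewrite !mulr_ge0 ?radial_ge0 ?powR_ge0.
  have E : majorant p d y0 x y = 2 * `|x| * P by rewrite /majorant /P; ring.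
  have : P <= 2 * `|x| * P by rewrite ler_peMl//; lra.
  by rewrite -E; lra.
have [yl|ys] := leP (1 / 2) `|y|.
  have := besov_density_tail p1 dw dz Hx; rewrite -/d ze (_ : 1 - y ^+ 2 - x ^+ 2 = 1 - x ^+ 2 - y ^+ 2); last by ring.
  set P := _ * _ * _ * _ => hP.
  have P0 : 0 <= P by rewrite !mulr_ge0 ?radial_ge0 ?powR_ge0.
  have E : majorant p d x0 y x = 2 * `|y| * P by rewrite /majorant /P; ring.
  have : P <= 2 * `|y| * P by rewrite ler_peMl//; lra.
  by rewrite -E; lra.
have sq (t : R) : `|t| < 1 / 2 -> t ^+ 2 <= 1 / 4.
  move=> h; rewrite -[t ^+ 2]real_normK ?num_real// (_ : 1 / 4 = (1 / 2) ^+ 2); last by field.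
  by rewrite lerXn2r ?nnegrE ?normr_ge0 ?ltW.
have e2 : 1 / 2 <= 1 - cabs z ^+ 2 by rewrite ze; have := sq x xs; have := sq y ys; lra.
apply: le_trans (besov_density_bloch p1 dw dz) _.
have : (1 - cabs z ^+ 2) ^- 2 <= 4.
  rewrite -[4]invrK lef_pV2 ?posrE ?invr_gt0// ?exprn_gt0 ?disk_sq//.
  rewrite (_ : 4^-1 = (1 / 2) ^+ 2); last by field.
  by rewrite lerXn2r ?nnegrE ?(ltW (disk_sq dz)).
by lra.
Qed.

Lemma besov_moebius p : 1 < p -> exists M : R, 0 <= M /\
  forall w, disk w -> (besov_int p (moebius w) <= M%:E)%E.
Proof.
move=> p1; pose c := 16 * powR 32 p / (p - 1) ^+ 2 : R.
have c0 : 0 <= c by rewrite /c divr_ge0 ?sqr_ge0// mulr_ge0 ?powR_ge0.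
exists (pi^-1 * (16 + (c + c))); split.
  by rewrite mulr_ge0 ?invr_ge0 ?pi_ge0// addr_ge0// addr_ge0.
move=> w dw; rewrite /besov_int area_intP mulVKf ?gt_eqF ?pi_gt0//.
have [x0 [y0 [hx hy H]]] := besov_density_le p1 dw.
have d0 : 0 < 1 - cabs w by rewrite subr_gt0.
have [I1 _] := majorant_int d0 p1 hy; have [_ I2] := majorant_int d0 p1 hx.
set d := 1 - cabs w in H I1 I2 d0.
have m1 : measurable_fun (@disk2 R) (fun q : RR => majorant p d y0 q.1 q.2).
  exact: measurable_funS (majorant_measurable p d y0).
have m2 : measurable_fun (@disk2 R) (fun q : RR => majorant p d x0 q.2 q.1).
  apply: (@measurable_funS _ _ _ _ setT) => //.
  have sw : measurable_fun setT (fun q : RR => (q.2, q.1) : RR) by exact: measurable_swap.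
  exact: (measurableT_comp (majorant_measurable p d x0) sw).
have mD := @disk2_measurable R.
rewrite -cDfE.
apply: (@le_trans _ _ (\int[mu2]_(q in @disk2 R) (4%:E +
   ((majorant p d y0 q.1 q.2)%:E + (majorant p d x0 q.2 q.1)%:E)))%E).
  apply: ge0_le_integral => //.
  - by move=> q _; rewrite lee_fin mulr_ge0 ?powR_ge0.
  - by apply/measurable_EFinP; apply: besov_measurable; exact: holo_moebius.
  - by apply: emeasurable_funD => //; apply: emeasurable_funD; exact/measurable_EFinP.
  - by move=> q /disk2P dq; rewrite -!EFinD lee_fin; exact: (H _ dq).
rewrite ge0_integralD//; last 2 first.
- by move=> q _; rewrite -EFinD lee_fin addr_ge0 ?majorant_ge0.
- by apply: emeasurable_funD; exact/measurable_EFinP.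
rewrite [leRHS]EFinD; apply: leeD.
  by rewrite (_ : 16 = 4 * 4); [exact: disk2_int_cst|ring].
rewrite ge0_integralD//; last 4 first.
- by move=> q _; rewrite lee_fin majorant_ge0.
- exact/measurable_EFinP.
- by move=> q _; rewrite lee_fin majorant_ge0.
- exact/measurable_EFinP.
by rewrite [leRHS]EFinD; apply: leeD.
Qed.

Lemma hasD_scale (c : R[i]) f z (l : R[i]) : hasD f z l -> hasD (fun u => c * f u) z (c * l).
Proof. by move=> fl; have := hasDM (@hasD_cst _ c z) fl; rewrite mul0r add0r. Qed.

Lemma holo_scale (c : R[i]) f : holo f -> holo (fun u => c * f u).
Proof.
by move=> fh; apply: (@hasD_holo _ _ (fun z => c * cD f z)) => z dz; apply/hasD_scale/holo_hasD.
Qed.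

Lemma cD_scale (c : R[i]) f z : holo f -> disk z -> cD (fun u => c * f u) z = c * cD f z.
Proof. by move=> fh dz; apply/hasD_cD/hasD_scale/holo_hasD. Qed.

Definition cscale (k : R) (f : R[i] -> R[i]) z := k%:C%C * f z.

Lemma besov_intP (p M : R) f : (besov_int p f <= M%:E)%E =
  (\int[mu2]_(q in @disk2 R) (powR (cabs (cD f (Complex q.1 q.2))) p *
     powR (1 - cabs (Complex q.1 q.2) ^+ 2) (p - 2))%:E <= (pi * M)%:E)%E.
Proof. by rewrite /besov_int area_intP cDfE. Qed.

Lemma besov_int_scale (p k M : R) f : holo f -> 0 <= k -> 0 <= M ->
  (besov_int p f <= M%:E)%E -> (besov_int p (cscale k f) <= (powR k p * M)%:E)%E.
Proof.
move=> fh k0 M0 H; rewrite (besov_intP p M f) in H.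
rewrite (besov_intP p (powR k p * M) (cscale k f)).
rewrite mulrCA EFinM.
rewrite (_ : (\int[mu2]_(q in _) _)%E = ((powR k p)%:E * \int[mu2]_(q in @disk2 R)
   (powR (cabs (cD f (Complex q.1 q.2))) p * powR (1 - cabs (Complex q.1 q.2) ^+ 2) (p - 2))%:E)%E).
  by apply: lee_wpmul2l => //; rewrite lee_fin powR_ge0.
rewrite -ge0_integralZl//; last 4 first.
- exact: disk2_measurable.
- by apply/measurable_EFinP; exact: besov_measurable.
- by move=> q _; rewrite lee_fin mulr_ge0 ?powR_ge0.
- by rewrite lee_fin powR_ge0.
apply: eq_integral => q; rewrite inE => /disk2P dq; rewrite -EFinM; congr _%:E.
by rewrite cD_scale// cabsM cabs_real ger0_norm// powRM ?cabs_ge0// mulrA.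
Qed.

Lemma moebius_unit_ball (p : R) : 1 <= p -> exists2 k : R, 0 < k & forall w, disk w ->
  besov p (cscale k (moebius w)) /\
  (besov_norm p (cscale k (moebius w)) <= 1)%E.
Proof.
move=> p1; have [pE|pE] := eqVneq p 1.
  exists 1 => // w dw; rewrite (_ : cscale 1 (moebius w) = moebius w); last first.
    by apply/funext => z; rewrite /cscale rmorph1 mul1r.
  rewrite /besov /besov_norm pE eqxx; split; last exact: besov1_norm_moebius.
  by split; [exact: holo_moebius|exact: besov1_moebius].
have {pE}p1 : 1 < p by rewrite lt_neqAle eq_sym pE.
have p0 : 0 < p by lra.
have [M [M0 HM]] := besov_moebius p1.
(* The 1 bounds the modulus at 0, and M^(1/p) the seminorm, by homogeneity. *)
pose B := 1 + powR M p^-1; have B0 : 0 < B by rewrite ltr_pwDl// powR_ge0.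
pose k := B^-1; have k0 : 0 < k by rewrite invr_gt0.
have k0' := ltW k0.
exists k => // w dw; have mh := holo_moebius dw.
have I := besov_int_scale mh k0' M0 (HM w dw).
rewrite /besov /besov_norm (gt_eqF p1); split; first split.
- exact: holo_scale.
- by apply: le_lt_trans I _; rewrite ltry.
have I0 : (0 <= besov_int p (cscale k (moebius w)))%E.
  by apply: area_int_ge0 => z; rewrite lee_fin mulr_ge0 ?powR_ge0.
have F : fine (besov_int p (cscale k (moebius w))) <= powR k p * M.
  by rewrite -lee_fin fineK// ge0_fin_numE//; apply: le_lt_trans I _; rewrite ltry.
have E1 : k + k * powR M p^-1 = 1.
  by rewrite -[X in X + _]mulr1 -mulrDr -/B mulVf// gt_eqF.
rewrite lee_fin -E1; apply: lerD.
  rewrite cabsM cabs_real gtr0_norm// ler_piMr//.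
  exact: cabs_moebius_le dw (@disk0 R).
have -> : k * powR M p^-1 = powR (powR k p * M) p^-1.
  by rewrite powRM ?powR_ge0// -powRrM divff ?gt_eqF// powRr1.
apply: ge0_ler_powR => //; first by rewrite invr_ge0 ltW.
- by rewrite nnegrE fine_ge0.
- by rewrite nnegrE mulr_ge0 ?powR_ge0.
Qed.
End Moebius.

(** * Necessity *)

Section Forward.
Variable R : realType.
Implicit Types (a b u w z P Q : R[i]).

Lemma disk_moebius w z : disk w -> disk z -> disk (moebius w z).
Proof.
move=> dw dz; rewrite /disk /= /moebius cabsM cabsV ltr_pdivrMr ?sub_conj_gt0// mul1r.
rewrite -(@ltr_pXn2r _ 2) ?nnegrE ?cabs_ge0// sub_conj_id ltrDl.
by rewrite mulr_gt0 ?disk_sq.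
Qed.

Lemma conj_sub_conj a u : Num.conj (1 - Num.conj a * u) = 1 - a * Num.conj u.
Proof. by rewrite rmorphB rmorph1 rmorphM /= conjK. Qed.

(** Up to a unimodular constant, alpha_w with w = alpha_a(u) equals alpha_u o alpha_a; the right
    side is the chain rule for that composite. *)
Lemma moebius'_moebius a u z : disk a -> disk u -> disk z ->
  moebius' (moebius a u) z = - ((1 - a * Num.conj u) / (1 - Num.conj a * u)) * (1 - u * Num.conj u) *
    ((1 - a * Num.conj a) / ((1 - Num.conj a * z) ^+ 2 * (1 - Num.conj u * moebius a z) ^+ 2)).
Proof.
move=> da du dz; have D1 := sub_conj_neq0 da du; have D2 := sub_conj_neq0 da dz.
have D3 := sub_conj_neq0 du (disk_moebius da dz).
have D4 : 1 - a * Num.conj u != 0 by rewrite mulrC sub_conj_neq0.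
have D5 : (1 - Num.conj a * z) - Num.conj u * (a - z) != 0.
  have -> : (1 - Num.conj a * z) - Num.conj u * (a - z) =
     (1 - Num.conj a * z) * (1 - Num.conj u * moebius a z) by rewrite /moebius; field.
  by rewrite mulf_neq0.
have cE : Num.conj (moebius a u) = (Num.conj a - Num.conj u) / (1 - a * Num.conj u).
  by rewrite -conj_sub_conj /moebius rmorphM fmorphV rmorphB.
rewrite /moebius' cE /moebius.
move: (Num.conj a) (Num.conj u) D1 D2 D4 D5 => a' u' D1 D2 D4 D5.
by field; rewrite D1 D2 D4 D5.
Qed.

Lemma rho_sym a b : rho a b = rho b a.
Proof.
rewrite !rhoE cabsB; congr (_ / _).
by rewrite -cabs_conj conj_sub_conj mulrC.
Qed.

Lemma rho_moebius a b : rho a b = cabs (moebius a b).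
Proof. by rewrite rho_sym rhoE /moebius cabsM cabsV cabsB. Qed.

Lemma rho_le1 a b : disk a -> disk b -> rho a b <= 1.
Proof. by move=> da db; rewrite rho_moebius cabs_moebius_le. Qed.

(* With [|u| = 1/2] fixed, this product is of first order in [rho a b]; the
   choice [u = c * moebius a b] would only give second order. *)
Lemma test_point a b : disk a -> disk b -> exists u, [/\ disk u, cabs u <= 1 / 2 &
  Num.conj u * moebius a b = (rho a b / 2)%:C%C].
Proof.
move=> da db; set c := moebius a b; have [c0|c0] := eqVneq c 0.
  exists 0; split; rewrite ?cabs0//; first exact: disk0.
  by rewrite c0 mulr0 rho_moebius -/c c0 cabs0 mul0r.
have r0 : 0 < cabs c by rewrite cabs_gt0.
have u2 : cabs (((2 * cabs c)^-1)%:C%C * c) = 1 / 2.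
  rewrite cabsM cabs_real gtr0_norm ?invr_gt0 ?mulr_gt0//; field; by rewrite gt_eqF.
exists (((2 * cabs c)^-1)%:C%C * c); split.
- by rewrite /disk /= u2; lra.
- by rewrite u2.
rewrite rmorphM /= -mulrA [Num.conj c * c]mulrC mul_conj.
rewrite (_ : Num.conj _ = ((2 * cabs c)^-1)%:C%C); last by rewrite conjcE /= oppr0.
rewrite -rmorphM rho_moebius -/c; congr (_%:C%C); field; by rewrite gt_eqF.
Qed.

(* The quotient is the factor relating the kernel at [b] of [test_bound_rho] to
   [1 / (1 - |b|^2)]; its modulus is [1 - (rho a b)^2]. *)
Lemma kernel_close a b : disk a -> disk b ->
  cabs ((1 - a * Num.conj a) * (1 - b * Num.conj b) / (1 - Num.conj a * b) ^+ 2 - 1) <= 3 * rho a b.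
Proof.
move=> da db; have D0 := sub_conj_neq0 da db; have D := sub_conj_gt0 db da.
set k := 1 - Num.conj a * b in D0 D *.
have r : rho a b = cabs (b - a) / cabs k by rewrite rho_sym rhoE.
have -> : (1 - a * Num.conj a) * (1 - b * Num.conj b) / k ^+ 2 - 1 =
   (Num.conj k - k) / k - ((b - a) / k) * (Num.conj (b - a) / k).
  rewrite /k conj_sub_conj rmorphB /=; field; exact: D0.
apply: le_trans (cabsD _ _) _; rewrite cabsN !cabsM !cabsV cabs_conj -r.
have r0 := rho_ge0 a b; have r1 := rho_le1 da db.
have h : cabs (Num.conj k - k) <= 2 * cabs (b - a).
  have -> : Num.conj k - k = Num.conj a * (b - a) - a * Num.conj (b - a).
    by rewrite /k conj_sub_conj rmorphB /=; ring.
  apply: le_trans (cabsD _ _) _; rewrite cabsN !cabsM !cabs_conj.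
  have := ler_piMl (cabs_ge0 (b - a)) (ltW da); lra.
have h1 : cabs (Num.conj k - k) / cabs k <= 2 * rho a b.
  by rewrite r mulrA ler_wpM2r ?invr_ge0 ?cabs_ge0.
have : rho a b * rho a b <= rho a b by rewrite ler_piMl.
by lra.
Qed.

(** What compactness leaves at one point z: there a = phi z, b = psi z, P = nu phi' and Q = nu psi'.
    From here on only the geometry of the disk matters. *)
Definition test_bound a b P Q (e : R) := forall w, disk w ->
  cabs (P * moebius' w a - Q * moebius' w b) <= e.

Lemma test_bound_sym a b P Q e : test_bound a b P Q e -> test_bound b a Q P e.
Proof. by move=> H w dw; rewrite cabsB; exact: H. Qed.

(** The bound is tested at w = alpha_a(u). As alpha_a(a) = 0, the parameter [u] acts only on the
    kernel at [b], apart from the common factor 1 - |u|^2. *)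
Lemma test_bound_kernel a b u P Q e : test_bound a b P Q e -> disk a -> disk b -> disk u ->
  (1 - cabs u ^+ 2) * cabs (P / (1 - a * Num.conj a) -
    Q * ((1 - a * Num.conj a) / (1 - Num.conj a * b) ^+ 2) / (1 - Num.conj u * moebius a b) ^+ 2) <= e.
Proof.
move=> H da db du; apply: le_trans (H _ (disk_moebius da du)).
have D1 := sub_conj_neq0 da du; have D2 := sub_conj_neq0 da db.
have D3 := sub_conj_neq0 du (disk_moebius da db); have D4 := sub_conj_neq0 da da.
have D5 : 1 - a * Num.conj u != 0 by rewrite mulrC sub_conj_neq0.
have D6 : 1 - a * Num.conj a != 0 by rewrite mulrC.
rewrite !moebius'_moebius//.
have -> : moebius a a = 0 by rewrite /moebius subrr mul0r.
rewrite mulr0 subr0.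
have E : cabs (1 - u * Num.conj u) = 1 - cabs u ^+ 2.
  by rewrite mul_conj cabs_1sub gtr0_norm// disk_sq.
have L : cabs ((1 - a * Num.conj u) / (1 - Num.conj a * u)) = 1.
  rewrite cabsM cabsV -conj_sub_conj cabs_conj divff// gt_eqF// cabs_gt0//.
rewrite -E -cabsM -[cabs (_ * (_ - _))]mul1r -L -cabsM -cabsN; apply: eqW.
congr cabs; set m := moebius a b in D3 *; field.
by rewrite D1 D2 D3 D4.
Qed.

(** With u = 0 one gets |A - Y| <= e, with the point of [test_point] |A - sY| <= 2e for a real s >=
    1 + rho. Subtracting, rho |Y| <= 3e, and then rho |A| <= 4e because rho <= 1. *)
Lemma test_bound_rho a b P Q e : test_bound a b P Q e -> disk a -> disk b ->
  cabs (P / (1 - a * Num.conj a) - Q * ((1 - a * Num.conj a) / (1 - Num.conj a * b) ^+ 2)) <= e /\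
  rho a b * cabs (P / (1 - a * Num.conj a)) <= 4 * e.
Proof.
move=> H da db; set A := P / _; set Y := Q * _.
have h1 : cabs (A - Y) <= e.
  have := test_bound_kernel H da db (@disk0 R).
  by rewrite rmorph0 mul0r subr0 expr1n divr1 cabs0 expr0n subr0 mul1r.
have [u [du u2 uE]] := test_point da db.
have h2 := test_bound_kernel H da db du; rewrite -/A -/Y uE in h2.
set r := rho a b in h2 uE *; have r0 : 0 <= r by exact: rho_ge0.
have r1 : r <= 1 by exact: rho_le1.
split=> //; have e0 : 0 <= e by exact: le_trans (cabs_ge0 _) h1.
pose s : R := (1 - r / 2) ^- 2.
(* Amounts to (1 + r)(1 - r/2)^2 = 1 - 3r^2/4 + r^3/4 <= 1. *)
have s1 : 1 + r <= s.
  rewrite /s -[1 + r]invrK lef_pV2 ?posrE ?invr_gt0 ?exprn_gt0//; [|lra|lra].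
  rewrite -[leRHS]mul1r ler_pdivlMr; last by lra.
  by nra.
have h3 : cabs (A - Y * s%:C%C) <= 2 * e.
  have -> : Y * s%:C%C = Y / (1 - (r / 2)%:C%C) ^+ 2.
    by rewrite /s fmorphV rmorphXn rmorphB rmorph1.
  have c0 := cabs_ge0 (A - Y / (1 - (r / 2)%:C%C) ^+ 2).
  have u4 : cabs u ^+ 2 <= 1 / 2.
    by have := cabs_ge0 u; nra.
  by nra.
have h4 : cabs Y * (s - 1) <= 3 * e.
  have -> : cabs Y * (s - 1) = cabs ((A - Y) - (A - Y * s%:C%C)).
    have -> : (A - Y) - (A - Y * s%:C%C) = Y * (s - 1)%:C%C by rewrite rmorphB rmorph1; ring.
    by rewrite cabsM cabs_real ger0_norm//; lra.
  by apply: le_trans (cabsD _ _) _; rewrite cabsN; lra.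
have Y0 := cabs_ge0 Y.
have h5 : cabs A <= e + cabs Y by have := cabsD (A - Y) Y; rewrite subrK; lra.
have h6 : r * cabs Y <= 3 * e by nra.
by nra.
Qed.

(** The roles of [a] and [b] are exchanged for the second bound. In the third, [Y] is [B] times the
    quotient of [kernel_close], so replacing it by [B] costs 3 rho |B| <= 12 e on top of |A - Y| <=
    e. *)
Lemma test_bound_final a b P Q e : test_bound a b P Q e -> disk a -> disk b ->
  [/\ rho a b * cabs (P / (1 - a * Num.conj a)) <= 4 * e,
      rho a b * cabs (Q / (1 - b * Num.conj b)) <= 4 * e &
      cabs (P / (1 - a * Num.conj a) - Q / (1 - b * Num.conj b)) <= 13 * e].
Proof.
move=> H da db; have [h1 h2] := test_bound_rho H da db.
have [_ h3] := test_bound_rho (test_bound_sym H) db da; rewrite rho_sym in h3.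
split=> //.
have Db : 1 - b * Num.conj b != 0 by rewrite mulrC sub_conj_neq0.
have Da : 1 - Num.conj a * b != 0 by rewrite sub_conj_neq0.
set A := P / _ in h1 h2 *; set B := Q / _ in h3 *; set Y := Q * _ in h1.
have -> : A - B = (A - Y) + B * ((1 - a * Num.conj a) * (1 - b * Num.conj b) / (1 - Num.conj a * b) ^+ 2 - 1).
  by rewrite /Y /B; field; rewrite Da Db.
apply: le_trans (cabsD _ _) _; rewrite cabsM.
have := ler_wpM2l (cabs_ge0 B) (kernel_close da db).
lra.
Qed.
End Forward.

(** * From compactness to the boundary conditions *)

Section Necessity.
Variables (R : realType) (nu : R[i] -> R) (phi psi : R[i] -> R[i]).
Hypothesis nu0 : forall z, disk z -> 0 < nu z.
Hypothesis phis : selfmap phi.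
Hypothesis psis : selfmap psi.
Let T := comp_diff phi psi.
Implicit Types (w z : R[i]).

Lemma holo_comp_diff f : holo f -> holo (T f).
Proof.
move=> fh; apply: (@hasD_holo _ _
  (fun z => cD phi z * cD f (phi z) - cD psi z * cD f (psi z))) => z.
exact: comp_diff_hasD.
Qed.

Lemma comp_diff_scale (k : R) f : T (cscale k f) = cscale k (T f).
Proof. by apply/funext => z; rewrite /T /comp_diff /cscale mulrBr. Qed.

Lemma bloch_norm_ge f z : disk z -> ((nu z * cabs (cD f z))%:E <= bloch_norm nu f)%E.
Proof.
move=> dz; apply: (@le_trans _ _ (bloch_sup nu f)).
  by apply: ereal_sup_ubound => /=; exists z => //; rewrite cDE.
by rewrite /bloch_norm leeDr// lee_fin cabs_ge0.
Qed.

Lemma subseq_ge (s : nat -> nat) : (forall m n, (m < n)%N -> (s m < s n)%N) ->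
  forall n, (n <= s n)%N.
Proof. by move=> hs; elim=> // n IH; apply: leq_ltn_trans IH (hs _ _ _). Qed.

(** Failure gives pairs (w_n, z_n) with |z_n| tending to 1 and the quantity at least [e]. A
    subsequence of the images converges to some [g] in the little space, whose own vanishing at the
    circle contradicts this along the subsequence. *)
Lemma compact_moebius_vanish (p : R) : 1 <= p -> compact_Bp_Bnu0 p nu T ->
  forall e : R, 0 < e -> exists r : R, r < 1 /\
  forall w z, disk w -> r < cabs z -> cabs z < 1 -> nu z * cabs (cD (T (moebius w)) z) < e.
Proof.
move=> p1 [_ Tc] e e0; have [k k0 Hk] := @moebius_unit_ball R p p1.
apply: contrapT => /forallNP NH.
have bad (n : nat) : exists wz : R[i] * R[i], [/\ disk wz.1, 1 - n.+1%:R^-1 < cabs wz.2, disk wz.2 &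
    e <= nu wz.2 * cabs (cD (T (moebius wz.1)) wz.2)].
  apply: contrapT => /forallNP H; apply: (NH (1 - n.+1%:R^-1)); split.
    by rewrite gtrBl invr_gt0 ltr0n.
  move=> w z dw hz dz; rewrite ltNge; apply/negP => he.
  by apply: (H (w, z)).
have [wz Hwz] := choice bad.
pose u n := cscale k (moebius (wz n).1).
have uB n : besov p (u n) /\ (besov_norm p (u n) <= 1)%E by apply: Hk; have [] := Hwz n.
have [s [g [hs [[[gh _] g0] C]]]] := Tc u uB.
(* One half for [g] near the circle, one half for the distance to [g]: together less than the
   [k * e] that each bad pair guarantees. *)
have ek : 0 < k * e / 2 by rewrite divr_gt0// mulr_gt0.
have [r [r1 Hr]] := g0 _ ek.
pose h n := fun z => T (u (s n)) z - g z.
have [N _ HN] : \forall n \near \oo, (bloch_norm nu (h n) < (k * e / 2)%:E)%E.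
  have : nbhs (0%E : \bar R) [set x | (x < (k * e / 2)%:E)%E].
    by apply: open_ereal_lt'; rewrite lte_fin.
  exact: C.
have r2 : 0 < 1 - r by rewrite subr_gt0.
have [k1 _ Hk1] := near_infty_natSinv_lt (PosNum r2).
(* [N] makes the distance to [g] small; [k1], together with [n <= s n], puts the point [z] beyond
   radius [r]. *)
pose n := maxn N k1.
have [dw hz dz he] := Hwz (s n).
set w := (wz (s n)).1 in dw he; set z := (wz (s n)).2 in hz dz he.
have mh := holo_moebius dw; have Tmh := holo_comp_diff mh.
have hn : nu z * cabs (cD (h n) z) < k * e / 2.
  rewrite -lte_fin; apply: le_lt_trans (bloch_norm_ge _ dz) _; apply: HN.
  by rewrite /= leq_maxl.
have rz : r < cabs z.
  apply: le_lt_trans hz; have /= H := Hk1 (s n).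
  have : (k1 <= s n)%N by apply: leq_trans (subseq_ge hs n); exact: leq_maxr.
  by move=> /H; set t := _^-1; clear; lra.
have hg := Hr z rz dz; rewrite -cDE ger0_norm in hg; last first.
  by rewrite mulr_ge0 ?cabs_ge0 ?(ltW (nu0 dz)).
have E : cD (h n) z = k%:C%C * cD (T (moebius w)) z - cD g z.
  apply: hasD_cD; apply: hasDB; last exact: holo_hasD.
  by rewrite /u comp_diff_scale; apply/hasD_scale/holo_hasD.
rewrite E in hn.
have tri : cabs (k%:C%C * cD (T (moebius w)) z) <= cabs (k%:C%C * cD (T (moebius w)) z - cD g z) + cabs (cD g z).
  by have := cabsD (k%:C%C * cD (T (moebius w)) z - cD g z) (cD g z); rewrite subrK.
rewrite [leLHS]cabsM cabs_real gtr0_norm// in tri.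
have := ler_wpM2l (ltW (nu0 dz)) tri; rewrite mulrDr mulrCA => h'.
have := ler_wpM2l (ltW k0) he; lra.
Qed.

Lemma compact_conditions (p : R) : 1 <= p -> compact_Bp_Bnu0 p nu T ->
  lim_bdry0 (aterm nu phi psi) /\ lim_bdry0 (bterm nu phi psi).
Proof.
move=> p1 Tc.
have key (e : R) : 0 < e -> exists r : R, r < 1 /\ forall z, r < cabs z -> cabs z < 1 ->
    aterm nu phi psi z < e /\ bterm nu phi psi z < e.
  (* 14 exceeds the constants 4 and 13 of [test_bound_final], which makes both conclusions
     strict. *)
  move=> e0; have e1 : 0 < e / 14 by rewrite divr_gt0.
  have [r [r1 H]] := compact_moebius_vanish p1 Tc e1.
  exists r; split=> // z rz dz; have n0 := nu0 dz.
  have da := phis.2 z dz; have db := psis.2 z dz.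
  have tb : test_bound (phi z) (psi z) ((nu z)%:C%C * cD phi z) ((nu z)%:C%C * cD psi z) (e / 14).
    move=> w dw; apply: le_trans (ltW (H w z dw rz dz)).
    rewrite (hasD_cD (comp_diff_hasD phis psis (holo_moebius dw) dz)) !cD_moebius//.
    by rewrite -{3}[nu z](gtr0_norm n0) -cabs_real -cabsM mulrBr !mulrA.
  have [] := test_bound_final tb da db.
  have E a : 1 - a * Num.conj a = (1 - cabs a ^+ 2)%:C%C :> R[i] by rewrite mul_conj rmorphB rmorph1.
  rewrite !E => h1 h2 h3; split; last by apply: le_lt_trans h3 _; lra.
  have N a x : disk a -> cabs ((nu z)%:C%C * x / (1 - cabs a ^+ 2)%:C%C) = cabs x / (1 - cabs a ^+ 2) * nu z.
    move=> da'; rewrite !cabsM cabsV !cabs_real (gtr0_norm n0) (gtr0_norm (disk_sq da')); ring.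
  rewrite !N// in h1 h2.
  by rewrite /aterm [ltLHS]mulrC; case: (leP (cabs (cD phi z) / _) _) => _; [apply: le_lt_trans h2 _|apply: le_lt_trans h1 _]; lra.
split=> e e0; have [r [r1 H]] := key e e0; exists r; split=> // z rz dz; have [ha hb] := H z rz dz.
  by rewrite ger0_norm//; exact: aterm_ge0.
by rewrite ger0_norm//; exact: cabs_ge0.
Qed.
End Necessity.

Theorem theorem4p1 (R : realType) (p : R) (nu : R[i] -> R)
    (phi psi : R[i] -> R[i]) :
  1 <= p ->
  (forall z, disk z -> 0 < nu z) ->
  {within (@disk R : set R[i]^o), continuous (nu : R[i]^o -> R)} ->
  (forall z w, disk z -> disk w -> cabs z = cabs w -> nu z = nu w) ->
  selfmap phi -> selfmap psi ->
  (compact_Bp_Bnu0 p nu (comp_diff phi psi) <->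
   (lim_bdry0 (fun z =>
      Num.max (cabs (cderiv phi z) / (1 - cabs (phi z) ^+ 2))
              (cabs (cderiv psi z) / (1 - cabs (psi z) ^+ 2))
      * nu z * rho (phi z) (psi z)) /\
    lim_bdry0 (fun z =>
      cabs ((nu z)%:C%C * cderiv phi z / (1 - cabs (phi z) ^+ 2)%:C%C
            - (nu z)%:C%C * cderiv psi z / (1 - cabs (psi z) ^+ 2)%:C%C)))).
Proof.
move=> p1 nu0 nuC _ phis psis; rewrite -cDfE.
split; first exact: compact_conditions.
(* Mapping into the little space needs only some Bloch constant for each [f]; compactness needs one
   constant for the whole unit ball. *)
move=> [Ha Hb]; split=> [f /(besov_bloch p1)[C]|u uB].
  exact: blochC_little.
have [C HC] := @besov_unit_ball R p p1.
by apply: (@blochC_compact _ _ _ _ nu0 nuC phis psis Ha Hb u C 2) => n; have [h1 h2] := uB n; have [] := HC _ h1 h2.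
Qed.
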